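(* Suppose that $(M,\rho,\pi)$ is a quasi-Poisson $G\times H$-manifold and $C\subseteq G$ is a reducing subgroup. 1. If the $C$-action on $M$ induces a regular equivalence relation, then the bivector field $\pi$ descends to define a quasi-Poisson $H$-structure on $M/C$. 2. Let $\tau_G$ and $\tau_H$ be ($s_G$- and $s_H$-preserving) automorphisms of $G$ and $H$, and let $(\mu_G,\mu_H):M\to G\times H$ be a $(\tau_G,\tau_H)$-twisted moment map. If $S\subseteq G$ is a $\hat C$-stable submanifold such that (i) $S$ is in a clean position relative to $\mu_G$, and (ii) the action of $C$ on $\mu_G^{-1}(S)$ induces a regular equivalence relation, then $\mu_G^{-1}(S)/C$ is a quasi-Poisson $H$-manifold (with the residual $H$-action and the bivector field induced by $\pi$), and $\mu_H$ descends to define a $\tau_H$-twisted moment map $\mu_H:\mu_G^{-1}(S)/C\to H$. Moreover, if all the stated assumptions (of 1 and 2) hold, then $\mu_G^{-1}(S)/C\subseteq M/C$ is a quasi-Poisson $H$-submanifold.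
   Context: For a Lie group $G$ with Lie algebra $\mathfrak g$ and a chosen $\mathrm{Ad}$-invariant $s=\sum s^{ij}e_i\otimes e_j\in S^2\mathfrak g$, define $s^\sharp:\mathfrak g^*\to\mathfrak g$ by $\beta(s^\sharp\alpha)=s(\alpha,\beta)$ and $\phi\in\bigwedge^3\mathfrak g$ by $\phi(\alpha,\beta,\gamma)=\frac14\alpha([s^\sharp\beta,s^\sharp\gamma])$. For a $G$-action $\rho$ on $M$, $\rho:\mathfrak g\to\Gamma(TM)$ also denotes the infinitesimal action $\rho(\xi)_x=\frac{d}{dt}|_0\exp(-t\xi)\cdot x$, extended to $\bigwedge\mathfrak g\to\Gamma(\bigwedge TM)$. A quasi-Poisson $G$-manifold is $(M,\rho,\pi)$ with $\pi$ a $G$-invariant bivector field satisfying $\frac12[\pi,\pi]=\rho(\phi)$. For a product $G\times H$ of groups with chosen $s_G\in S^2\mathfrak g$, $s_H\in S^2\mathfrak h$ one uses $s=s_G+s_H$. A map $\mu:M\to G$ is a $\tau$-twisted moment map ($\tau$ an $s$-preserving automorphism of $G$) if it is equivariant for the action $g\cdot\tilde g=\tau(g)\tilde gg^{-1}$ of $G$ on $G$, and the image of $\pi$ under $\mu_*\otimes\mathrm{id}:TM\otimes TM\to TG\otimes TM$ is $-\frac12\sum_{i,j}s^{ij}(e_i^L+\tau(e_i)^R)\otimes\rho(e_j)$ (with $\xi^{L},\xi^R$ the left/right invariant vector fields). For $G\times H$ this is applied with the automorphism $(\tau_G,\tau_H)$. A Lie subgroup $C\subseteq G$ with Lie algebra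 $\mathfrak c$ is reducing if $[s_G^\sharp\alpha,s_G^\sharp\beta]\in\mathfrak c$ for all $\alpha,\beta\in\operatorname{ann}(\mathfrak c)\subseteq\mathfrak g^*$. Then $\hat{\mathfrak c}:=\{(\xi+s_G^\sharp\alpha,\xi-s_G^\sharp\alpha):\xi\in\mathfrak c,\alpha\in\operatorname{ann}(\mathfrak c)\}$ is a Lie subalgebra of $\mathfrak g\oplus\mathfrak g$; $\hat C\subseteq G\times G$ is a Lie subgroup with Lie algebra $\hat{\mathfrak c}$ such that the diagonal inclusion $\mathfrak c\subseteq\hat{\mathfrak c}$ lifts to $C\subseteq\hat C$. $\hat C\subseteq G\times G$ acts on $G$ by $(g_1,g_2)\cdot g=\tau_G(g_1)\,g\,g_2^{-1}$. $S$ is in a clean position relative to $\mu_G$ if, with $\operatorname{gr}(\mu_G)=\{(\mu_G(x),x)\}$, $\operatorname{gr}(\mu_G)\cap(S\times M)\subseteq G\times M$ is a submanifold with tangent space $T\operatorname{gr}(\mu_G)\cap(TS\times TM)$. A group action on a manifold $N$ induces a regular equivalence relation if its orbit space is a manifold such that the quotient map is a surjective submersion. The bivector on $\mu_G^{-1}(S)/C$ induced by $\pi$: its value on covectors $a,b$ at the class of $x$ is $\pi(\alpha,\beta)$, where $\alpha,\beta\in T_x^*M$ are any covectors whose restrictions to $T_x\mu_G^{-1}(S)$ are the pullbacks of $a,b$. A quasi-Poisson $H$-submanifold is an $H$-invariant submanifold to which the bivector field is tangent, with the restricted structure. *)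

(* Defs.v *)
(* Smooth manifolds are Hausdorff second countable spaces with a smooth atlas,
   tangent vectors at x are point derivations of C^oo(M) at x, and multivectors
   are given by their values on differentials of functions. *)
From HB Require Import structures.
From mathcomp Require Import all_boot all_order all_algebra.
From mathcomp Require Import boolp classical_sets functions cardinality reals.
From mathcomp Require Import topology normedtype landau derive.

Set Implicit Arguments.
Unset Strict Implicit.
Unset Printing Implicit Defensive.

Import Order.TTheory GRing.Theory Num.Theory numFieldNormedType.Exports.
Local Open Scope classical_set_scope.
Local Open Scope ring_scope.

(* [Ck A k f]: on the open set A, f is k times continuously differentiable *)
Fixpoint Ck (R : realType) (n : nat) (W : normedModType R) (A : set 'rV[R]_n)
    (k : nat) (f : 'rV[R]_n -> W) : Prop :=
  if k is k'.+1 then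
    (forall x, A x -> differentiable f x) /\
    (forall v, Ck A k' (fun x => 'D_v f x))
  else forall x, A x -> {for x, continuous f}.

Definition smooth_on (R : realType) (n : nat) (W : normedModType R)
    (A : set 'rV[R]_n) (f : 'rV[R]_n -> W) : Prop := forall k, Ck A k f.

(* The dimension belongs to the chart, so that different components of a
   manifold may have different dimensions.  [cmap] and [cinv] are only
   meaningful on [cdom] and on its image. *)
Record chart (R : realType) (T : topologicalType) := Chart {
  cdim : nat;
  cdom : set T;
  cmap : T -> 'rV[R]_cdim;
  cinv : 'rV[R]_cdim -> T;
  cdom_open : open cdom;
  cimg_open : open (cmap @` cdom);
  cmapK : forall x, cdom x -> cinv (cmap x) = x;
  cmap_cont : forall x, cdom x -> {for x, continuous cmap};
  cinv_cont : forall y, (cmap @` cdom) y -> {for y, continuous cinv}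
}.
Arguments cdom {R T} c _.
Arguments cmap {R T} c _.
Arguments cinv {R T} c _.
Arguments cdom_open {R T} c.
Arguments cimg_open {R T} c.

(* The empty manifold is allowed. *)
HB.mixin Record isManifold (R : realType) T of Topological T := {
  mfd_hausdorff : hausdorff_space T;
  mfd_second_countable : @second_countable T;
  atlas : set (chart R T);
  atlas_cover : forall x : T, exists2 c, atlas c & cdom c x;
  atlas_compat : forall c d, atlas c -> atlas d ->
    smooth_on (cmap c @` (cdom c `&` cdom d)) (cmap d \o cinv c)
}.

#[short(type="manifoldType")]
HB.structure Definition Manifold (R : realType) :=
  { T of Topological T & isManifold R T }.

Arguments atlas {R} s _.

Definition smooth_map (R : realType) (M N : manifoldType R) (f : M -> N) : Prop :=
  continuous f /\
  forall c d, atlas M c -> atlas N d ->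
    smooth_on (cmap c @` (cdom c `&` f @^-1` cdom d)) (cmap d \o f \o cinv c).

Section CkTheory.
Context {R : realType}.

Lemma Ck_ext n (W : normedModType R) (A : set 'rV[R]_n) k (f g : 'rV[R]_n -> W) :
  open A -> (forall x, A x -> f x = g x) -> Ck A k f -> Ck A k g.
Proof.
move=> oA; elim: k f g => [|k IH] f g fg /=.
  move=> fC x Ax; have fgx : \near x, f x = g x.
    by apply: filterS (open_nbhs_nbhs (conj oA Ax)) => y /fg.
  rewrite /prop_for/continuous_at/= -(fg _ Ax).
  by move/near_eq_cvg: fgx => /cvg_trans; apply; exact: fC.
case=> fd fD; have fgn x : A x -> \near x, f x = g x.
  by move=> Ax; apply: filterS (open_nbhs_nbhs (conj oA Ax)) => y /fg.
split=> [x Ax|v].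
  have /diff_locallyP[dc de] := fd x Ax.
  suff ge : g \o shift x = cst (g x) + 'd f x +o_ (0 : 'rV[R]_n) id.
    by apply/diff_locallyP; rewrite (diff_unique dc ge).
  apply/eqaddoP => e e0; move/eqaddoP: de => /(_ e e0) de.
  have fg0 : \forall y \near (0 : 'rV[R]_n), f (y + x) = g (y + x).
    by have := fgn x Ax; rewrite (near_shift (0 : 'rV[R]_n) x) /= ; apply: filterS => y /=; rewrite subr0.
  by apply: filterS2 fg0 de => y /= fgy; rewrite !fctE /= -fgy -(fg x Ax).
apply: IH (fD v) => x Ax; exact/near_eq_derive/fgn.
Qed.

Lemma Ck_comp_lin m n (W : normedModType R) (A : set 'rV[R]_n) (B : set 'rV[R]_m)
    (L : {linear 'rV[R]_m -> 'rV[R]_n}) k (f : 'rV[R]_n -> W) :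
  continuous L -> (forall x, B x -> A (L x)) -> Ck A k f -> Ck B k (f \o L).
Proof.
move=> Lc BA; elim: k f => [|k IH] f /=.
  by move=> fC x Bx; apply: continuous_comp; [exact: Lc|exact/fC/BA].
case=> fd fD; split=> [x Bx|v].
  by apply: differentiable_comp; [exact: linear_differentiable|exact/fd/BA].
suff -> : (fun x => 'D_v (f \o L) x) = (fun y => 'D_(L v) f y) \o L by exact: IH.
apply/funext => x /=; rewrite /derive.
suff -> : (fun h : R => h^-1 *: (((f \o L) \o shift x) (h *: v) - (f \o L) x))
  = (fun h => h^-1 *: ((f \o shift (L x)) (h *: L v) - f (L x))) by [].
by apply/funext => h /=; rewrite linearP.
Qed.


Lemma Ck_along_lin m n (W : normedModType R) (A : set 'rV[R]_n) (B : set 'rV[R]_m)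
    (L : {linear 'rV[R]_m -> 'rV[R]_n}) k (f : 'rV[R]_n -> W) (g : 'rV[R]_m -> W) :
  Ck A k f -> open B -> continuous L -> (forall x, B x -> A (L x)) ->
  (forall x, B x -> f (L x) = g x) -> Ck B k g.
Proof.
move=> fC oB Lc BA fg; exact: Ck_ext oB fg (Ck_comp_lin Lc BA fC).
Qed.

Lemma Ck_lin_comp n (V W : normedModType R) (A : set 'rV[R]_n)
    (L : {linear V -> W}) k (f : 'rV[R]_n -> V) :
  open A -> continuous L -> Ck A k f -> Ck A k (L \o f).
Proof.
move=> oA Lc; elim: k f => [|k IH] f /=.
  by move=> fC x Ax; apply: continuous_comp; [exact: fC|exact: Lc].
case=> fd fD; split=> [x Ax|v].
  by apply: differentiable_comp; [exact: fd|exact: linear_differentiable].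
apply: Ck_ext oA _ (IH _ (fD v)) => x Ax /=.
have dLx : differentiable L (f x) by exact: linear_differentiable.
have dLf : differentiable (L \o f) x by apply: differentiable_comp => //; exact: fd.
rewrite (deriveE _ dLf) (deriveE _ (fd x Ax)) (diff_comp (fd x Ax) dLx) /=.
by rewrite diff_lin.
Qed.

Lemma CkD n (W : normedModType R) (A : set 'rV[R]_n) k (f g : 'rV[R]_n -> W) :
  open A -> Ck A k f -> Ck A k g -> Ck A k (f \+ g).
Proof.
move=> oA; elim: k f g => [|k IH] f g /=.
  by move=> fC gC x Ax; apply: continuousD; [exact: fC|exact: gC].
move=> [fd fD] [gd gD]; split=> [x Ax|v].
  by apply: differentiableD; [exact: fd|exact: gd].
apply: Ck_ext oA _ (IH _ _ (fD v) (gD v)) => x Ax /=.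
by rewrite deriveD//; apply: diff_derivable; [exact: fd|exact: gd].
Qed.

Lemma continuous_row_mx (T : topologicalType) m n (f : T -> 'rV[R]_m)
    (g : T -> 'rV[R]_n) x :
  {for x, continuous f} -> {for x, continuous g} ->
  {for x, continuous (fun z => row_mx (f z) (g z))}.
Proof.
move=> fx gx A /nbhs_ballP[e /= e0 eA].
have fe : \forall z \near x, ball (f x) e (f z) := fx _ (nbhsx_ballx (f x) e e0).
have ge : \forall z \near x, ball (g x) e (g z) := gx _ (nbhsx_ballx (g x) e e0).
rewrite nbhs_simpl/=.
apply: filterS2 fe ge => z /= [_ fz] [_ gz]; apply: eA; split=> // i j.
by rewrite !mxE; case: splitP => k _; [exact: fz|exact: gz].
Qed.

Lemma Ck_row_mx p m n (A : set 'rV[R]_p) k (f : 'rV[R]_p -> 'rV[R]_m)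
    (g : 'rV[R]_p -> 'rV[R]_n) :
  open A -> Ck A k f -> Ck A k g -> Ck A k (fun z => row_mx (f z) (g z)).
Proof.
move=> oA fC gC.
pose L1 : {linear 'rV[R]_m -> 'rV[R]_(m + n)} := mulmxr (row_mx 1%:M 0).
pose L2 : {linear 'rV[R]_n -> 'rV[R]_(m + n)} := mulmxr (row_mx 0 1%:M).
have E1 : L1 =1 (fun u => row_mx u 0).
  by move=> u; rewrite /= mul_mx_row mulmx1 mulmx0.
have E2 : L2 =1 (fun u => row_mx 0 u).
  by move=> u; rewrite /= mul_mx_row mulmx1 mulmx0.
have c1 : continuous L1.
  rewrite (funext E1) => u.
  by apply: (@continuous_row_mx _ _ _ id (cst 0)); [exact: cvg_id|exact: cst_continuous].
have c2 : continuous L2.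
  rewrite (funext E2) => u.
  by apply: (@continuous_row_mx _ _ _ (cst 0) id); [exact: cst_continuous|exact: cvg_id].
apply: Ck_ext oA _ (CkD oA (Ck_lin_comp oA c1 fC) (Ck_lin_comp oA c2 gC)).
by move=> z _ /=; rewrite !mul_mx_row !mulmx1 !mulmx0 add_row_mx addr0 add0r.
Qed.

Lemma cmap_open_img (T : topologicalType) (c : chart R T) (V : set T) :
  open V -> open (cmap c @` (cdom c `&` V)).
Proof.
move=> oV; rewrite openE => _ [x [xc xV] <-].
have cx : (cmap c @` cdom c) (cmap c x) by exists x.
have /= nV : nbhs (cinv c (cmap c x)) V by rewrite cmapK//; exact: open_nbhs_nbhs.
have h1 : \forall y \near cmap c x, V (cinv c y) := cinv_cont cx nV.
have h2 : \forall y \near cmap c x, (cmap c @` cdom c) y.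
  exact: open_nbhs_nbhs (conj (cimg_open c) cx).
rewrite /interior /=; near=> y.
have [z zc zy] : (cmap c @` cdom c) y by near: y.
exists z => //; split=> //.
suff : V (cinv c y) by rewrite -zy cmapK.
by near: y.
Unshelve. all: by end_near. Qed.

Lemma open_setM2 (S T : topologicalType) (A : set S) (B : set T) :
  open A -> open B -> open (A `*` B).
Proof.
move=> oA oB; rewrite openE => -[x y] [/= Ax By].
by exists (A, B); [split; exact: open_nbhs_nbhs|].
Qed.

End CkTheory.

Section ProdChart.
Context {R : realType} (S T : topologicalType) (c : chart R S) (d : chart R T).

Let dom := cdom c `*` cdom d.
Let map (p : S * T) : 'rV[R]_(cdim c + cdim d) := row_mx (cmap c p.1) (cmap d p.2).
Let inv (z : 'rV[R]_(cdim c + cdim d)) : S * T :=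
  (cinv c (lsubmx z), cinv d (rsubmx z)).

Let imgE : map @` dom =
  (lsubmx @^-1` (cmap c @` cdom c)) `&` (rsubmx @^-1` (cmap d @` cdom d)).
Proof.
apply/seteqP; split=> [_ [[x y] [/= xc yd] <-]|z [[x xc xz] [y yd yz]]].
  by split; rewrite /preimage/= ?row_mxKl ?row_mxKr; [exists x|exists y].
by exists (x, y) => //; rewrite /map/= xz yz hsubmxK.
Qed.

Let dom_open : open dom.
Proof. by apply: open_setM2; exact: cdom_open. Qed.

Let img_open : open (map @` dom).
Proof.
rewrite imgE; apply: openI; apply: open_comp; try exact: cimg_open.
  by move=> ? _; exact: continuous_lsubmx.
by move=> ? _; exact: continuous_rsubmx.
Qed.

Let mapK p : dom p -> inv (map p) = p.
Proof. by case: p => x y [/= xc yd]; rewrite /inv row_mxKl row_mxKr !cmapK. Qed.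

Let map_cont p : dom p -> {for p, continuous map}.
Proof.
case: p => x y [/= xc yd]; apply: continuous_row_mx.
  by apply: continuous_comp; [exact: cvg_fst|exact: cmap_cont].
by apply: continuous_comp; [exact: cvg_snd|exact: cmap_cont].
Qed.

Let inv_cont z : (map @` dom) z -> {for z, continuous inv}.
Proof.
rewrite imgE => -[zc zd].
have h1 : {for z, continuous (cinv c \o lsubmx)}.
  by apply: continuous_comp; [exact: continuous_lsubmx|exact: cinv_cont].
have h2 : {for z, continuous (cinv d \o rsubmx)}.
  by apply: continuous_comp; [exact: continuous_rsubmx|exact: cinv_cont].
exact: (cvg_pair h1 h2).
Qed.

Definition prod_chart : chart R (S * T)%type :=
  Chart dom_open img_open mapK map_cont inv_cont.

End ProdChart.

Section ProdManifold.
Context {R : realType} (M N : manifoldType R).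

Let hausd : hausdorff_space (M * N)%type.
Proof.
move=> [x y] [x' y'] cl; congr pair.
  apply: (@mfd_hausdorff R M) => A B Ax Bx.
  have [] := cl (A `*` setT) (B `*` setT).
  - by exists (A, setT) => //; split=> //; exact: filterT.
  - by exists (B, setT) => //; split=> //; exact: filterT.
  by move=> [a b] [[/= Aa _] [Ba _]]; exists a.
apply: (@mfd_hausdorff R N) => A B Ax Bx.
have [] := cl (setT `*` A) (setT `*` B).
- by exists (setT, A) => //; split=> //; exact: filterT.
- by exists (setT, B) => //; split=> //; exact: filterT.
by move=> [a b] [[/= _ Aa] [_ Ba]]; exists b.
Qed.

Let sc : @second_countable (M * N)%type.
Proof.
have [B cB [oB bB]] := @mfd_second_countable R M.
have [C cC [oC bC]] := @mfd_second_countable R N.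
exists ((fun p => p.1 `*` p.2) @` (B `*` C)).
  exact: card_le_trans (card_image_le _ _) (countableX cB cC).
split=> [_ [[U V] [/= BU CV] <-]|[x y] A [[P Q] [/= Px Qy] PQA]].
  by apply: open_setM2; [exact: oB|exact: oC].
have [U [BU Ux] UP] := bB x P Px.
have [V [CV Vy] VQ] := bC y Q Qy.
exists (U `*` V); first by split=> //; exists (U, V).
by apply: subset_trans PQA => -[a b] [/= /UP ? /VQ ?].
Qed.

Let prod_atlas : set (chart R (M * N)%type) :=
  [set prod_chart c d | c in atlas M & d in atlas N].

Let cover p : exists2 c, prod_atlas c & cdom c p.
Proof.
case: p => x y; have [c ac cx] := @atlas_cover R M x.
have [d ad dy] := @atlas_cover R N y.
by exists (prod_chart c d); [exists c => //; exists d|].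
Qed.

Let compat c d : prod_atlas c -> prod_atlas d ->
  smooth_on (cmap c @` (cdom c `&` cdom d)) (cmap d \o cinv c).
Proof.
move=> [a aa [b ab <-]] [a' aa' [b' ab' <-]] k.
set B := (_ @` _); have oB : open B by exact/cmap_open_img/cdom_open.
apply: Ck_row_mx => //.
- apply: (Ck_along_lin (L := @lsubmx R 1 _ _) (atlas_compat a a' aa aa' k)) => //.
    exact: continuous_lsubmx.
  by move=> _ [[x y] [[/= xa yb] [/= xa' yb']] <-]; exists x => //=; rewrite row_mxKl.
- apply: (Ck_along_lin (L := @rsubmx R 1 _ _) (atlas_compat b b' ab ab' k)) => //.
    exact: continuous_rsubmx.
  by move=> _ [[x y] [[/= xa yb] [/= xa' yb']] <-]; exists y => //=; rewrite row_mxKr.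
Qed.

HB.instance Definition _ :=
  isManifold.Build R (M * N)%type hausd sc cover compat.

End ProdManifold.

HB.mixin Record isLieGroup (R : realType) G of Manifold R G & Group G := {
  mulg_smooth : smooth_map (fun p : G * G => (p.1 * p.2)%g);
  invg_smooth : smooth_map (fun x : G => x^-1%g)
}.

#[short(type="lieGroupType")]
HB.structure Definition LieGroup (R : realType) :=
  { G of Manifold R G & Group G & isLieGroup R G }.


Section ProdLieGroup.
Context {R : realType} (G H : lieGroupType R).

Let mul_smooth :
  smooth_map (fun p : (G * H) * (G * H) => (p.1 * p.2)%g : (G * H)%type).
Proof.
have [cG sG] := @mulg_smooth R G; have [cH sH] := @mulg_smooth R H.
have cGH : continuous (fun p : (G * H) * (G * H) => (p.1 * p.2)%g : (G * H)%type).
  move=> p.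
  have f1 : {for p, continuous (fst : (G * H) * (G * H) -> _)} by exact: cvg_fst.
  have f2 : {for p, continuous (snd : (G * H) * (G * H) -> _)} by exact: cvg_snd.
  have g1 : {for p, continuous (fun q : (G * H) * (G * H) => (q.1.1, q.2.1))}.
    apply: cvg_pair.
      exact: (continuous_comp f1 (@cvg_fst _ _ _ _ _)).
    exact: (continuous_comp f2 (@cvg_fst _ _ _ _ _)).
  have g2 : {for p, continuous (fun q : (G * H) * (G * H) => (q.1.2, q.2.2))}.
    apply: cvg_pair.
      exact: (continuous_comp f1 (@cvg_snd _ _ _ _ _)).
    exact: (continuous_comp f2 (@cvg_snd _ _ _ _ _)).
  have h1 := continuous_comp g1 (cG _); have h2 := continuous_comp g2 (cH _).
  exact: (cvg_pair h1 h2).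
split=> //.
move=> _ _ [_ [a aa [b ab <-]] [_ [a' aa' [b' ab' <-]] <-]] [d ad [e ae <-]] k.
set B := (_ @` _); have oB : open B.
  apply/cmap_open_img/open_comp; last exact: cdom_open.
  by move=> p _; exact: cGH.
have lc := @continuous_lsubmx R 1; have rc := @continuous_rsubmx R 1.
have aac : atlas (G * G)%type (prod_chart a a') by exists a => //; exists a'.
have bbc : atlas (H * H)%type (prod_chart b b') by exists b => //; exists b'.
pose V := 'rV[R]_((cdim a + cdim b) + (cdim a' + cdim b')).
pose L1 (z : V) := row_mx (lsubmx (lsubmx z)) (lsubmx (rsubmx z)).
pose L2 (z : V) := row_mx (rsubmx (lsubmx z)) (rsubmx (rsubmx z)).
have L1lin : linear L1.
  by move=> x u v; rewrite /L1 !linearP scale_row_mx add_row_mx.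
have L2lin : linear L2.
  by move=> x u v; rewrite /L2 !linearP scale_row_mx add_row_mx.
pose L1M := GRing.isLinear.Build _ _ _ _ _ L1lin.
pose L2M := GRing.isLinear.Build _ _ _ _ _ L2lin.
pose L1L : {linear V -> _} := HB.pack L1 L1M.
pose L2L : {linear V -> _} := HB.pack L2 L2M.
have L1c : continuous L1.
  by move=> z; exact: (continuous_row_mx (continuous_comp (lc _ _ z) (lc _ _ _))
    (continuous_comp (rc _ _ z) (lc _ _ _))).
have L2c : continuous L2.
  by move=> z; exact: (continuous_row_mx (continuous_comp (lc _ _ z) (rc _ _ _))
    (continuous_comp (rc _ _ z) (rc _ _ _))).
apply: Ck_row_mx => //.
- apply: (Ck_along_lin (L := L1L) (sG _ d aac ad k)) => //.
    move=> _ [[[x y] [x' y']] [[[/= xa yb] [/= xa' yb']] [/= zd ze]] <-].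
    by exists (x, x') => //=; rewrite /L1 !row_mxKl !row_mxKr !row_mxKl.
  by move=> z _ /=; rewrite /L1 row_mxKl row_mxKr.
- apply: (Ck_along_lin (L := L2L) (sH _ e bbc ae k)) => //.
    move=> _ [[[x y] [x' y']] [[[/= xa yb] [/= xa' yb']] [/= zd ze]] <-].
    by exists (y, y') => //=; rewrite /L2 !row_mxKl !row_mxKr.
  by move=> z _ /=; rewrite /L2 row_mxKl row_mxKr.
Qed.

Let inv_smooth : smooth_map (fun p : G * H => p^-1%g : (G * H)%type).
Proof.
have [cG sG] := @invg_smooth R G; have [cH sH] := @invg_smooth R H.
have cGH : continuous (fun p : G * H => p^-1%g : (G * H)%type).
  move=> p.
  have h1 : {for p, continuous ((fun x => x^-1%g) \o fst)}.
    by apply: continuous_comp; [exact: cvg_fst|exact: cG].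
  have h2 : {for p, continuous ((fun x => x^-1%g) \o snd)}.
    by apply: continuous_comp; [exact: cvg_snd|exact: cH].
  exact: (cvg_pair h1 h2).
split=> //.
move=> _ _ [a aa [b ab <-]] [d ad [e ae <-]] k.
set B := (_ @` _); have oB : open B.
  apply/cmap_open_img/open_comp; last exact: cdom_open.
  by move=> p _; exact: cGH.
apply: Ck_row_mx => //.
- apply: (Ck_along_lin (L := @lsubmx R 1 _ _) (sG a d aa ad k)) => //.
    exact: continuous_lsubmx.
  by move=> _ [[x y] [[/= xa yb] [/= zd ze]] <-]; exists x => //=; rewrite row_mxKl.
- apply: (Ck_along_lin (L := @rsubmx R 1 _ _) (sH b e ab ae k)) => //.
    exact: continuous_rsubmx.
  by move=> _ [[x y] [[/= xa yb] [/= zd ze]] <-]; exists y => //=; rewrite row_mxKr.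
Qed.

HB.instance Definition _ := isLieGroup.Build R (G * H)%type mul_smooth inv_smooth.

End ProdLieGroup.

Section Tangent.
Context {R : realType}.

Definition Cinf (M : manifoldType R) : set (M -> R) :=
  [set f : M -> R | forall c, atlas M c -> smooth_on (cmap c @` cdom c) (f \o cinv c)].

(* Functionals on C^oo(M) are functionals on all functions M -> R with the
   junk value 0 at the functions that are not smooth, so that they are equal as
   soon as they agree on C^oo(M). *)
Definition functional (M : manifoldType R) := (M -> R) -> R.

Definition on_Cinf (M : manifoldType R) (v : functional M) : functional M :=
  fun f => if `[< Cinf f >] then v f else 0.

Definition tangent (M : manifoldType R) (x : M) (v : functional M) : Prop :=
  [/\ forall f, ~ Cinf f -> v f = 0,
      forall (a : R) f g, Cinf f -> Cinf g ->
        v (fun y => a * f y + g y) = a * v f + v g &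
      forall f g, Cinf f -> Cinf g ->
        v (fun y => f y * g y) = f x * v g + g x * v f].

Definition pushforward (M N : manifoldType R) (F : M -> N) (v : functional M) :
    functional N :=
  on_Cinf (fun u => v (u \o F)).

Definition immersion (M N : manifoldType R) (F : M -> N) : Prop :=
  forall x v w, tangent x v -> tangent x w ->
    pushforward F v = pushforward F w -> v = w.

Definition submersion (M N : manifoldType R) (F : M -> N) : Prop :=
  forall x w, tangent (F x) w -> exists2 v, tangent x v & pushforward F v = w.

(* the differentials of u and u' at x coincide in T_x^* M *)
Definition same_differential (M : manifoldType R) (x : M) (u u' : M -> R) : Prop :=
  forall v, tangent x v -> v u = v u'.

Definition embedding (N M : manifoldType R) (i : N -> M) : Prop :=
  [/\ smooth_map i, injective i, immersion i &
      forall U, open U -> exists2 V, open V & U = i @^-1` V].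

(* Submanifolds are embedded submanifolds. *)
Definition submanifold (M : manifoldType R) (A : set M) : Prop :=
  exists (N : manifoldType R) (i : N -> M), embedding i /\ range i = A.

(* [tangent_sub A x v]: v belongs to T_x A, a subspace of T_x M *)
Definition tangent_sub (M : manifoldType R) (A : set M) (x : M)
    (v : functional M) : Prop :=
  exists (N : manifoldType R) (i : N -> M) (a : N) (w : functional N),
    [/\ embedding i, range i = A, i a = x, tangent a w & v = pushforward i w].

(* [quotient_by E q]: q is a surjective submersion onto the manifold Q whose
   fibres are the classes of the equivalence relation E; such a Q is the orbit
   space N/E with its (unique) manifold structure, and E is regular when it
   exists. *)
Definition quotient_by (N Q : manifoldType R) (E : N -> N -> Prop)
    (q : N -> Q) : Prop :=
  [/\ smooth_map q, range q = setT, submersion q &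
      forall x y, q x = q y <-> E x y].

End Tangent.

Section Bivector.
Context {R : realType} (M : manifoldType R).

(* An element p of Lambda^2 T_x M is a skew bilinear form on T_x^* M; since every
   covector at x is some d_x f, it is recorded as (f, g) |-> p(d_x f, d_x g),
   the derivation property in each argument meaning that the value only depends
   on the differentials at x. *)
Definition bivector (x : M) (p : (M -> R) -> (M -> R) -> R) : Prop :=
  (forall f, tangent x (p f)) /\ (forall f g, p f g = - p g f).

Definition bivector_field (pi : M -> (M -> R) -> (M -> R) -> R) : Prop :=
  (forall x, bivector x (pi x)) /\
  (forall f g, Cinf f -> Cinf g -> Cinf (fun x => pi x f g)).

(* The Schouten bracket of two bivector fields, evaluated on df, dg, dh: a sum
   over the cyclic permutations of f, g, h.  The normalization is the usual one:
   [X /\ Y, X /\ Y] = 2 X /\ Y /\ [X, Y], with (X /\ Y)(df, dg) = Xf Yg - Xg Yf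
   and the determinant convention for trivectors. *)
Definition schouten (pi sg : M -> (M -> R) -> (M -> R) -> R) (x : M)
    (f g h : M -> R) : R :=
  let nest f g h := pi x f (fun y => sg y g h) + sg x f (fun y => pi y g h) in
  nest f g h + nest g h f + nest h f g.

End Bivector.

(* The tensor sum_ij s^ij e_i (x) e_j.  The e_i may form a basis but need not. *)
Record tensor2 (R : realType) (G : lieGroupType R) := Tensor2 {
  tdim : nat;
  tvec : 'I_tdim -> functional G;
  tcoef : 'M[R]_tdim
}.
Arguments tvec {R G} t _.
Arguments tcoef {R G} t.

Section LieGroups.
Context {R : realType}.

Definition lie_algebra (G : lieGroupType R) (xi : functional G) : Prop :=
  tangent (1%g : G) xi.

Definition linv (G : lieGroupType R) (xi : functional G) (g : G) : functional G :=
  pushforward (fun h : G => (g * h)%g) xi.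

Definition rinv (G : lieGroupType R) (xi : functional G) (g : G) : functional G :=
  pushforward (fun h : G => (h * g)%g) xi.

(* the bracket of left-invariant vector fields *)
Definition bracket (G : lieGroupType R) (xi eta : functional G) : functional G :=
  on_Cinf (fun u => xi (fun g => linv eta g u) - eta (fun g => linv xi g u)).

(* linear forms on the Lie algebra; values outside it are irrelevant *)
Definition dual (G : lieGroupType R) (al : functional G -> R) : Prop :=
  forall (a : R) xi eta, lie_algebra xi -> lie_algebra eta ->
    al (fun u => a * xi u + eta u) = a * al xi + al eta.

Definition in_S2 (G : lieGroupType R) (s : tensor2 G) : Prop :=
  (forall i, lie_algebra (tvec s i)) /\ (tcoef s)^T = tcoef s.

Definition tensor_eval (G : lieGroupType R) (s : tensor2 G)
    (al be : functional G -> R) : R :=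
  \sum_(i < tdim s) \sum_(j < tdim s) tcoef s i j * al (tvec s i) * be (tvec s j).

Definition sharp (G : lieGroupType R) (s : tensor2 G) (al : functional G -> R) :
    functional G :=
  fun u => \sum_(i < tdim s) \sum_(j < tdim s)
    tcoef s i j * al (tvec s i) * tvec s j u.

(* (T (x) T) s = s, for a linear endomorphism T of the Lie algebra *)
Definition preserves (G : lieGroupType R) (s : tensor2 G)
    (T : functional G -> functional G) : Prop :=
  forall al be, dual al -> dual be ->
    tensor_eval s (al \o T) (be \o T) = tensor_eval s al be.

Definition Ad_invariant (G : lieGroupType R) (s : tensor2 G) : Prop :=
  forall g : G, preserves s (pushforward (fun h : G => (g * h * g^-1)%g)).

Definition phi (G : lieGroupType R) (s : tensor2 G)
    (al be ga : functional G -> R) : R :=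
  4^-1 * al (bracket (sharp s be) (sharp s ga)).

Definition inl_mor (G H : lieGroupType R) (g : G) : G * H := (g, 1%g).
Definition inr_mor (G H : lieGroupType R) (h : H) : G * H := (1%g, h).

(* (xi, eta) in g (+) h, as an element of the Lie algebra of G * H *)
Definition pair_vec (G H : lieGroupType R) (xi : functional G)
    (eta : functional H) : functional (G * H)%type :=
  fun u => pushforward (@inl_mor G H) xi u + pushforward (@inr_mor G H) eta u.

(* s_G + s_H *)
Definition tensor_add (G H : lieGroupType R) (sG : tensor2 G) (sH : tensor2 H) :
    tensor2 (G * H)%type :=
  @Tensor2 R (G * H)%type (tdim sG + tdim sH)
    (fun k => match fintype.split k with
              | inl i => pushforward (@inl_mor G H) (tvec sG i)
              | inr j => pushforward (@inr_mor G H) (tvec sH j)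
              end)
    (block_mx (tcoef sG) 0 0 (tcoef sH)).

Definition lie_automorphism (G : lieGroupType R) (tau : G -> G) : Prop :=
  [/\ {morph tau : x y / (x * y)%g}, smooth_map tau &
      exists2 tau' : G -> G, smooth_map tau' & cancel tau tau' /\ cancel tau' tau].

Definition lie_subgroup (C G : lieGroupType R) (i : C -> G) : Prop :=
  [/\ {morph i : x y / (x * y)%g}, smooth_map i, injective i & immersion i].

Definition lie_subalgebra (C G : lieGroupType R) (i : C -> G) :
    set (functional G) :=
  [set pushforward i xi | xi in @lie_algebra C].

Definition ann (G : lieGroupType R) (c : set (functional G))
    (al : functional G -> R) : Prop :=
  dual al /\ forall xi, c xi -> al xi = 0.

Definition reducing (C G : lieGroupType R) (s : tensor2 G) (i : C -> G) : Prop :=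
  forall al be, ann (lie_subalgebra i) al -> ann (lie_subalgebra i) be ->
    lie_subalgebra i (bracket (sharp s al) (sharp s be)).

Definition c_hat (G : lieGroupType R) (s : tensor2 G) (c : set (functional G)) :
    set (functional (G * G)%type) :=
  [set v | exists xi al, [/\ c xi, ann c al &
     v = pair_vec (fun u => xi u + sharp s al u) (fun u => xi u - sharp s al u)]].

(* i' : C' -> G * G is a Lie subgroup integrating c_hat, to which the diagonal
   inclusion of C lifts *)
Definition integrates_c_hat (C G C' : lieGroupType R) (s : tensor2 G)
    (i : C -> G) (i' : C' -> G * G) : Prop :=
  [/\ lie_subgroup i', lie_subalgebra i' = c_hat s (lie_subalgebra i) &
      exists j : C -> C', [/\ {morph j : x y / (x * y)%g}, smooth_map j &
        forall c, i' (j c) = (i c, i c)]].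

End LieGroups.

Section QuasiPoisson.
Context {R : realType}.

Definition lie_action (G : lieGroupType R) (M : manifoldType R)
    (act : G -> M -> M) : Prop :=
  [/\ forall x, act 1%g x = x,
      forall g h x, act (g * h)%g x = act g (act h x) &
      smooth_map (fun p : G * M => act p.1 p.2)].

(* rho(xi)_x = d/dt|_0 exp(- t xi) . x is the image of - xi under the
   differential at 1 of the orbit map g |-> g . x. *)
Definition rho (G : lieGroupType R) (M : manifoldType R) (act : G -> M -> M)
    (xi : functional G) (x : M) : functional M :=
  fun f => - pushforward (fun g : G => act g x) xi f.

(* The trivector rho(phi)_x evaluated on df, dg, dh is phi evaluated on the
   images of these covectors under the transpose of rho_x. *)
Definition rho_phi (G : lieGroupType R) (M : manifoldType R) (s : tensor2 G)
    (act : G -> M -> M) (x : M) (f g h : M -> R) : R :=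
  phi s (fun xi => rho act xi x f) (fun xi => rho act xi x g)
    (fun xi => rho act xi x h).

Definition quasi_poisson (G : lieGroupType R) (s : tensor2 G)
    (M : manifoldType R) (act : G -> M -> M)
    (pi : M -> (M -> R) -> (M -> R) -> R) : Prop :=
  [/\ lie_action act,
      bivector_field pi,
      forall k x f g, Cinf f -> Cinf g ->
        pi (act k x) f g = pi x (f \o act k) (g \o act k) &
      forall x f g h, Cinf f -> Cinf g -> Cinf h ->
        2^-1 * schouten pi pi x f g h = rho_phi s act x f g h].

(* An element of T_(mu x) G (x) T_x M is tested on pairs of functions u on G and
   f on M; the image of pi under mu_* (x) id then has the value
   pi(d(u \o mu), df). *)
Definition moment_map (G : lieGroupType R) (s : tensor2 G) (tau : G -> G)
    (M : manifoldType R) (act : G -> M -> M)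
    (pi : M -> (M -> R) -> (M -> R) -> R) (mu : M -> G) : Prop :=
  [/\ smooth_map mu,
      forall g x, mu (act g x) = (tau g * mu x * g^-1)%g &
      forall x u f, Cinf u -> Cinf f ->
        pi x (u \o mu) f =
          - 2^-1 * \sum_(i < tdim s) \sum_(j < tdim s) tcoef s i j *
            (linv (tvec s i) (mu x) u + rinv (pushforward tau (tvec s i)) (mu x) u) *
            rho act (tvec s j) x f].

Definition graph_of (G : lieGroupType R) (M : manifoldType R) (mu : M -> G) :
    set (G * M)%type :=
  [set p | p.1 = mu p.2].

Definition clean_position (G : lieGroupType R) (M : manifoldType R) (mu : M -> G)
    (S : set G) : Prop :=
  submanifold (graph_of mu `&` (S `*` setT)) /\
  forall p, (graph_of mu `&` (S `*` setT)) p ->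
    forall v, tangent_sub (graph_of mu `&` (S `*` setT)) p v <->
      [/\ tangent_sub (graph_of mu) p v,
          tangent_sub S p.1 (pushforward fst v) &
          tangent p.2 (pushforward snd v)].

(* The structure induced on a quotient q : N -> Q of a submanifold i : N -> M by
   an action of G * H and a bivector field on M; in the value of the bivector,
   f, f' represent covectors at q(a) and F, F' covectors at i(a) whose
   restrictions to T_a N are the pullbacks of the former. *)
Definition residual_action (G H : lieGroupType R) (M N Q : manifoldType R)
    (act : G * H -> M -> M) (i : N -> M) (q : N -> Q) (actQ : H -> Q -> Q) : Prop :=
  forall h a b, i b = act (1%g, h) (i a) -> actQ h (q a) = q b.

Definition induced_bivector (M N Q : manifoldType R)
    (pi : M -> (M -> R) -> (M -> R) -> R) (i : N -> M) (q : N -> Q)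
    (piQ : Q -> (Q -> R) -> (Q -> R) -> R) : Prop :=
  forall a F F' f f', Cinf F -> Cinf F' -> Cinf f -> Cinf f' ->
    same_differential a (F \o i) (f \o q) ->
    same_differential a (F' \o i) (f' \o q) ->
    piQ (q a) f f' = pi (i a) F F'.

(* piQ is the image of pi under q *)
Definition descends (M Q : manifoldType R) (pi : M -> (M -> R) -> (M -> R) -> R)
    (q : M -> Q) (piQ : Q -> (Q -> R) -> (Q -> R) -> R) : Prop :=
  forall x f g, Cinf f -> Cinf g -> piQ (q x) f g = pi x (f \o q) (g \o q).

(* The last clause says that piQ is, along P, the image of piP, which is a
   section of Lambda^2 TP: piQ is tangent to P, with restriction piP. *)
Definition quasi_poisson_submanifold (H : lieGroupType R) (s : tensor2 H)
    (Q : manifoldType R) (actQ : H -> Q -> Q)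
    (piQ : Q -> (Q -> R) -> (Q -> R) -> R)
    (P : manifoldType R) (actP : H -> P -> P)
    (piP : P -> (P -> R) -> (P -> R) -> R) (j : P -> Q) : Prop :=
  [/\ quasi_poisson s actQ piQ,
      quasi_poisson s actP piP,
      embedding j,
      forall h z, j (actP h z) = actQ h (j z) &
      forall z f g, Cinf f -> Cinf g -> piQ (j z) f g = piP z (f \o j) (g \o j)].

End QuasiPoisson.

(* Main.v *)
(** A function on M whose differential vanishes on the C-orbits kills c, so that on
    such functions the trivector rho(phi) only sees the h-components: the g-part
    is alpha([s^# beta, s^# gamma]) with alpha, beta, gamma in ann(c), which
    vanishes because C is reducing.  Hence pi descends to M/C.  On the preimage N
    of S the value pi(F, F') on extensions F, F' of C-invariant functions does
    not depend on the extensions: by cleanness a covector that kills T N is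
    d(u o mu) with du = 0 on T S, the moment map condition rewrites
    pi(u o mu, F') as du applied to the action of (s^# beta, - s^# beta) with
    beta = rho(.)F' in ann(c), and this element of c_hat acts tangentially to S.

    Tangent vectors being derivations, all of this rests on Hadamard's lemma
    (derivations are directional derivatives) and on the inverse function theorem
    (embeddings have local smooth retractions, submersions local sections). *)
From mathcomp Require Import all_boot all_order all_algebra.
From mathcomp Require Import boolp classical_sets functions cardinality reals.
From mathcomp Require Import set_interval constructive_ereal ereal realfun exp.
(* [measure] exports another [pushforward]: Defs has to come after it. *)
From mathcomp Require Import measure lebesgue_measure lebesgue_integral ftc.
Require Import Defs.
From HB Require Import structures.
From mathcomp Require Import topology normedtype landau derive sequences.
From mathcomp Require Import ring lra interval_inference.

Set Implicit Arguments.
Unset Strict Implicit.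
Unset Printing Implicit Defensive.

Import Order.TTheory GRing.Theory Num.Theory numFieldNormedType.Exports.
Local Open Scope classical_set_scope.
Local Open Scope ring_scope.

(** * Calculus in R^n *)

(** Both parts are one reduction along an embedding i : N -> M of a C- and H-stable submanifold;
    part 1 is the case i = id. Beyond the reducing condition it rests on the vanishing of pi(F, F')
    when F kills T N and F' is invariant to first order along N. The bivector of the quotient has to
    be compared with pi by way of functions on M, but an invariant function on N extends to M only
    locally in general. Extensions are therefore globally smooth functions prescribed only near one
    point of N. Agreement near the point, rather than equality of differentials at it, is what the
    Schouten bracket demands, since it differentiates pi(F, F') once more. The action of hat C on G
    has an inverse in its second factor: this is why the element (v, - v) of c_hat, and not (v, v),
    produces the vector v^L + tau(v)^R of the moment map condition. In rho(phi) the g- and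
    h-components separate because the bracket of the product Lie algebra has no mixed terms, which
    comes down to the symmetry of second derivatives. *)

Section Calculus.
Context {R : realType}.

Lemma Ck_sub n (W : normedModType R) (A B : set 'rV[R]_n) k (f : 'rV[R]_n -> W) :
  A `<=` B -> Ck B k f -> Ck A k f.
Proof.
move=> AB; elim: k f => [|k IH] f /=; first by move=> h x /AB/h.
by case=> h1 h2; split=> [x /AB/h1|v] //; apply: IH.
Qed.

Lemma Ck_prev n (W : normedModType R) (A : set 'rV[R]_n) k (f : 'rV[R]_n -> W) :
  Ck A k.+1 f -> Ck A k f.
Proof.
elim: k f => [|k IH] f [h1 h2].
  by move=> x /h1 /differentiable_continuous.
by split=> // v; apply: IH.
Qed.

Lemma Ck_cst n (W : normedModType R) (A : set 'rV[R]_n) k (a : W) :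
  Ck A k (fun _ => a).
Proof.
elim: k a => [|k IH] a /=; first by move=> x _; exact: cst_continuous.
split=> [x _|v]; first exact: differentiable_cst.
have -> : (fun x => 'D_v (fun _ : 'rV[R]_n => a) x) = (fun _ => 0 : W).
  by apply/funext => x; rewrite derive_cst.
exact: IH.
Qed.

Lemma Ck_lin n (W : normedModType R) (A : set 'rV[R]_n) k (L : {linear 'rV[R]_n -> W}) :
  continuous L -> Ck A k L.
Proof.
move=> Lc; case: k => [|k] /=; first by move=> x _; exact: Lc.
split=> [x _|v]; first exact: linear_differentiable.
have -> : (fun x => 'D_v L x) = (fun _ => L v).
  by apply/funext => x; rewrite deriveE ?diff_lin//; exact: linear_differentiable.
exact: Ck_cst.
Qed.

Lemma CkM n (A : set 'rV[R]_n) k (f g : 'rV[R]_n -> R) :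
  open A -> Ck A k f -> Ck A k g -> Ck A k (fun x => f x * g x).
Proof.
move=> oA; elim: k f g => [|k IH] f g /=.
  by move=> fC gC x Ax; apply: continuousM; [exact: fC|exact: gC].
move=> [fd fD] [gd gD]; have fp : Ck A k f by apply: Ck_prev; split.
have gp : Ck A k g by apply: Ck_prev; split.
split=> [x Ax|v].
  by apply: differentiableM; [exact: fd|exact: gd].
apply: Ck_ext oA _ (CkD oA (IH _ _ fp (gD v)) (IH _ _ gp (fD v))) => x Ax /=.
by rewrite deriveM//; apply: diff_derivable; [exact: fd|exact: gd].
Qed.

Lemma CkV n (A : set 'rV[R]_n) k (f : 'rV[R]_n -> R) :
  open A -> (forall x, A x -> f x != 0) -> Ck A k f -> Ck A k (fun x => (f x)^-1).
Proof.
move=> oA f0; elim: k f f0 => [|k IH] f f0 /=.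
  by move=> fC x Ax; apply: continuousV; [exact: f0|exact: fC].
move=> [fd fD]; have fp : Ck A k f by apply: Ck_prev; split.
split=> [x Ax|v].
  by apply: differentiableV; [exact: fd|exact: f0].
have C1 := IH _ f0 fp.
have C2 := CkM oA (CkM oA (CkM oA C1 C1) (fD v)) (@Ck_cst _ R A k (-1)).
apply: Ck_ext oA _ C2 => x Ax /=.
rewrite deriveV//; [|exact: f0|apply: diff_derivable; exact: fd].
by rewrite expr2 invfM /GRing.scale /= mulrN1 mulNr.
Qed.

Lemma Ck_sum n (W : normedModType R) (A : set 'rV[R]_n) k I (r : seq I) (P : pred I)
    (f : I -> 'rV[R]_n -> W) :
  open A -> (forall i, P i -> Ck A k (f i)) -> Ck A k (fun x => \sum_(i <- r | P i) f i x).
Proof.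
move=> oA h; elim: r => [|i r IH].
  by apply: Ck_ext oA _ (@Ck_cst n W A k 0) => x _; rewrite big_nil.
case: (boolP (P i)) => Pi.
  by apply: Ck_ext oA _ (CkD oA (h i Pi) IH) => x _; rewrite big_cons Pi.
by apply: Ck_ext oA _ IH => x _; rewrite big_cons (negbTE Pi).
Qed.

Lemma Ck_prod n (A : set 'rV[R]_n) k I (r : seq I) (P : pred I)
    (f : I -> 'rV[R]_n -> R) :
  open A -> (forall i, P i -> Ck A k (f i)) -> Ck A k (fun x => \prod_(i <- r | P i) f i x).
Proof.
move=> oA h; elim: r => [|i r IH].
  by apply: Ck_ext oA _ (@Ck_cst n R A k 1) => x _; rewrite big_nil.
case: (boolP (P i)) => Pi.
  by apply: Ck_ext oA _ (CkM oA (h i Pi) IH) => x _; rewrite big_cons Pi.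
by apply: Ck_ext oA _ IH => x _; rewrite big_cons (negbTE Pi).
Qed.

Lemma Ck_coordP m n (A : set 'rV[R]_n) k (f : 'rV[R]_n -> 'rV[R]_m) :
  open A -> Ck A k f <-> forall j, Ck A k (fun x => f x 0 j).
Proof.
move=> oA; split=> [fC j|fC].
  have Llin : linear (fun u : 'rV[R]_m => u 0 j) by move=> a u v; rewrite !mxE.
  pose LM := GRing.isLinear.Build _ _ _ _ _ Llin.
  pose L : {linear 'rV[R]_m -> R} := HB.pack (fun u : 'rV[R]_m => u 0 j) LM.
  by apply: (@Ck_lin_comp _ _ _ _ _ L) => //; exact: coord_continuous.
have Lc j : continuous (fun r : R => r *: (delta_mx 0 j : 'rV[R]_m)).
  by move=> r; apply: scalel_continuous.
have Llin j : linear (fun r : R => r *: (delta_mx 0 j : 'rV[R]_m)).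
  by move=> a u v; rewrite scalerDl scalerA.
pose L j : {linear R -> 'rV[R]_m} :=
  HB.pack (fun r : R => r *: (delta_mx 0 j : 'rV[R]_m)) (GRing.isLinear.Build _ _ _ _ _ (Llin j)).
have := @Ck_sum _ _ A k _ (index_enum 'I_m) xpredT _ oA (fun j _ => Ck_lin_comp (L := L j) oA (Lc j) (fC j)).
by apply: Ck_ext => // x _; exact/esym/row_sum_delta.
Qed.

Lemma derive_sum_coord n (W : normedModType R) (f : 'rV[R]_n -> W) x v : differentiable f x ->
  'D_v f x = \sum_i v 0 i *: 'D_(delta_mx 0 i) f x.
Proof.
move=> fd; rewrite deriveE// {1}(row_sum_delta v) linear_sum.
by apply: eq_bigr => i _; rewrite linearZ /= deriveE.
Qed.

Lemma derive_chain m n (W : normedModType R) (f : 'rV[R]_n -> 'rV[R]_m) (g : 'rV[R]_m -> W) x v :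
  differentiable f x -> differentiable g (f x) ->
  'D_v (g \o f) x = 'D_('D_v f x) g (f x).
Proof.
move=> fd gd; have gfd : differentiable (g \o f) x by exact: differentiable_comp.
by rewrite !deriveE// diff_comp.
Qed.

Lemma derive_coord m n (f : 'rV[R]_n -> 'rV[R]_m) x v j : differentiable f x ->
  ('D_v f x) 0 j = 'D_v (fun y => f y 0 j) x.
Proof.
move=> fd.
have Llin : linear (fun u : 'rV[R]_m => u 0 j) by move=> a u w; rewrite !mxE.
pose LM := GRing.isLinear.Build _ _ _ _ _ Llin.
pose L : {linear 'rV[R]_m -> R} := HB.pack (fun u : 'rV[R]_m => u 0 j) LM.
have Lc : continuous L by exact: coord_continuous.
have Ld y : differentiable L y by exact: linear_differentiable.
have -> : (fun y => f y 0 j) = L \o f by [].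
by rewrite (derive_chain v fd (Ld _)) (deriveE _ (Ld _)) diff_lin.
Qed.

(** Induction on k through the chain rule in coordinates: the derivative is a sum of products of a
    derivative of a coordinate of f with a partial derivative of g composed with f. Real values of g
    make each summand an instance of [CkM]. *)
Lemma Ck_comp m n (A : set 'rV[R]_n) (B : set 'rV[R]_m) k (f : 'rV[R]_n -> 'rV[R]_m)
    (g : 'rV[R]_m -> R) :
  open A -> (forall x, A x -> B (f x)) -> Ck A k f -> Ck B k g ->
  Ck A k (g \o f).
Proof.
move=> oA AB; elim: k g => [|k IH] g.
  by move=> fC gC x Ax; apply: continuous_comp; [exact: fC|apply: gC; exact: AB].
move=> fC [gd gD]; have [fd fD] := fC.
split=> [x Ax|v].
  by apply: differentiable_comp; [exact: fd|apply: gd; exact: AB].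
have fp := Ck_prev fC.
have h i := CkM oA ((Ck_coordP k _ oA).1 (fD v) i) (IH _ fp (gD (delta_mx 0 i))).
apply: Ck_ext oA _ (Ck_sum (index_enum 'I_m) (P := xpredT) oA (fun i _ => h i)) => x Ax /=.
have gdx := gd _ (AB _ Ax).
by rewrite (derive_chain v (fd _ Ax) gdx) (derive_sum_coord _ gdx).
Qed.

End Calculus.

(** * The inverse function theorem *)

Section InverseFunction.
Context {R : realType}.

Lemma coord_le_norm n (v : 'rV[R]_n) i : `|v 0 i| <= `|v|.
Proof.
have -> : `|v| = mx_norm v by [].
rewrite mx_normrE; apply/bigmax_geP; right => /=.
by exists (0, i).
Qed.

Lemma norm_le_coord n (v : 'rV[R]_n) e : 0 <= e -> (forall i, `|v 0 i| <= e) -> `|v| <= e.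
Proof.
move=> e0 h; have -> : `|v| = mx_norm v by [].
rewrite mx_normrE; apply: bigmax_le => //.
by move=> -[i j] _ /=; rewrite ord1; exact: h.
Qed.

Lemma is_derive_line n (W : normedModType R) (f : 'rV[R]_n -> W) y v t :
  differentiable f (y + t *: v) ->
  is_derive t 1 (fun s : R => f (y + s *: v)) ('D_v f (y + t *: v)).
Proof.
move=> fd0; have fd : derivable f (y + t *: v) v by exact: diff_derivable.
have E : (fun h : R => h^-1 *: (((fun s : R => f (y + s *: v)) \o shift t) (h *: (1 : R))
      - f (y + t *: v)))
    = (fun h => h^-1 *: ((f \o shift (y + t *: v)) (h *: v) - f (y + t *: v))).
  apply/funext => h /=; congr (_ *: (f _ - _)).
  have -> : h *: (1 : R) = h by exact: mulr1.
  by rewrite scalerDl addrCA.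
apply: DeriveDef; first by rewrite /derivable E.
by rewrite /derive E.
Qed.

Lemma mvt_line n (f : 'rV[R]_n -> R) x y :
  (forall t : R, 0 <= t <= 1 -> differentiable f (y + t *: (x - y))) ->
  exists2 t : R, 0 <= t <= 1 & f x - f y = 'D_(x - y) f (y + t *: (x - y)).
Proof.
move=> fd; pose phi (s : R) : R := f (y + s *: (x - y)).
have dphi (t : R) : 0 <= t <= 1 -> is_derive t (1 : R) phi ('D_(x - y) f (y + t *: (x - y))).
  by move=> /fd; exact: is_derive_line.
have [||c] := @MVT R phi (fun t => 'D_(x - y) f (y + t *: (x - y))) 0 1 ltr01.
- by move=> t; rewrite in_itv /= => /andP[t0 t1]; apply: dphi; rewrite !ltW.
- apply: derivable_within_continuous => t; rewrite in_itv /= => /dphi h.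
  exact: ex_derive.
rewrite in_itv /= => /andP[c0 c1]; rewrite subr0 mulr1 /phi scale1r scale0r addr0.
by rewrite (addrC y) subrK => E; exists c => //; rewrite !ltW.
Qed.

Lemma ball_segment n (a x y : 'rV[R]_n) r t : 0 <= t <= 1 ->
  `|x - a| <= r -> `|y - a| <= r -> `|y + t *: (x - y) - a| <= r.
Proof.
move=> /andP[t0 t1] xr yr.
have -> : y + t *: (x - y) - a = t *: (x - a) + (1 - t) *: (y - a).
  rewrite !scalerBr scalerBl scale1r scalerBl scale1r.
  by apply/rowP => i; rewrite !mxE; ring.
apply: le_trans (ler_normD _ _) _; rewrite !normrZ (ger0_norm t0) ger0_norm ?subr_ge0//.
have t1' : 0 <= 1 - t by rewrite subr_ge0.
have h1 := ler_wpM2l t0 xr; have h2 := ler_wpM2l t1' yr.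
by lra.
Qed.

(** The mean value theorem is applied to each coordinate; the norm of ['rV] being the largest
    coordinate, the constant K survives. *)
Lemma lipschitz_of_derive n m (f : 'rV[R]_n -> 'rV[R]_m) a r K : 0 <= K ->
  (forall z, `|z - a| <= r -> differentiable f z) ->
  (forall z v, `|z - a| <= r -> `|'D_v f z| <= K * `|v|) ->
  forall x y, `|x - a| <= r -> `|y - a| <= r -> `|f x - f y| <= K * `|x - y|.
Proof.
move=> K0 fd fD x y xr yr; apply: norm_le_coord; first by rewrite mulr_ge0.
move=> i; have sg (t : R) : 0 <= t <= 1 -> `|y + t *: (x - y) - a| <= r.
  by move=> ht; apply: ball_segment.
have [t /sg ht E] := @mvt_line n (fun z => f z 0 i) x y (fun t ht =>
  differentiable_comp (fd _ (sg _ ht)) (@differentiable_coord R _ _ _ 0 i)).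
rewrite !mxE E -derive_coord; last exact: fd.
by apply: le_trans (coord_le_norm _ _) _; exact: fD.
Qed.

Lemma contraction_fixpoint n (phi : 'rV[R]_n -> 'rV[R]_n) a r : 0 <= r ->
  (forall z, `|z - a| <= r -> `|phi z - a| <= r) ->
  (forall z z', `|z - a| <= r -> `|z' - a| <= r -> `|phi z - phi z'| <= 2^-1 * `|z - z'|) ->
  exists2 z, `|z - a| <= r & phi z = z.
Proof.
move=> r0 pB pL.
pose X : completeNormedModType R :=
  HB.pack 'rV[R]_n (Complete.on 'rV[R]_n) (NormedModule.on 'rV[R]_n).
pose U : set X := [set z | `|z - a| <= r].
have pU : set_fun U U (phi : X -> X) by move=> z; exact: pB.
pose F : {fun U >-> U} := HB.pack (phi : X -> X) (isFun.Build _ _ U U (phi : X -> X) pU).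
have Fc : is_contraction F.
  exists (2^-1)%:nng; split; first by rewrite /=; lra.
  by move=> -[z z'] [/= Uz Uz']; exact: pL.
have Ucl : closed U.
  have -> : U = (fun z : X => `|z - a|) @^-1` [set t | t <= r] by [].
  apply: closed_comp; last exact: closed_le.
  move=> z _; apply: (@continuous_comp _ _ _ (fun z : X => z - a) (fun z : X => `|z|)).
    by apply: continuousB; [exact: cvg_id|exact: cst_continuous].
  exact: norm_continuous.
have [|z Uz zF] := banach_fixed_point Fc Ucl; first by exists a; rewrite /U /= subrr normr0.
by exists z => //; rewrite {2}zF.
Qed.

(** Cramer's rule: the entries of the inverse are polynomials in those of M divided by the
    determinant. *)
Lemma invmx_entry_Ck n m (A : set 'rV[R]_n) k (M : 'rV[R]_n -> 'M[R]_m) :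
  open A -> (forall x, A x -> M x \in unitmx) ->
  (forall i j, Ck A k (fun x => M x i j)) ->
  forall i j, Ck A k (fun x => invmx (M x) i j).
Proof.
move=> oA Mu MC i j.
have detC p (N : 'rV[R]_n -> 'M[R]_p) : (forall i j, Ck A k (fun x => N x i j)) ->
    Ck A k (fun x => \det (N x)).
  move=> NC; rewrite /determinant; apply: Ck_sum => // s _.
  by apply: CkM => //; [exact: Ck_cst|apply: Ck_prod => // ? _; exact: NC].
have C1 : Ck A k (fun x => (\det (M x))^-1).
  apply: CkV => //; last exact: detC.
  by move=> x /Mu; rewrite unitmxE unitfE.
have C2 : Ck A k (fun x => (\adj (M x)) i j).
  rewrite (_ : (fun x => _) = fun x => (-1) ^+ (j + i) * \det (row' j (col' i (M x)))); last first.
    by apply/funext => x; rewrite !mxE.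
  apply: CkM => //; first exact: Ck_cst.
  apply: detC => i' j'; rewrite (_ : (fun x => _) = fun x => M x (lift j i') (lift i j')) //.
  by apply/funext => x; rewrite !mxE.
apply: Ck_ext oA _ (CkM oA C1 C2) => x Ax.
by rewrite /invmx (Mu _ Ax) [RHS]mxE.
Qed.

Lemma linear_continuous_rV n (W : normedModType R) (L : {linear 'rV[R]_n -> W}) : continuous L.
Proof.
have hc i : continuous (fun v : 'rV[R]_n => v 0 i *: L (delta_mx 0 i)).
  move=> v; apply: (@continuous_comp _ _ _ (fun v : 'rV[R]_n => v 0 i) (fun r : R => r *: L (delta_mx 0 i))).
    exact: coord_continuous.
  exact: scalel_continuous.
have h (r : seq 'I_n) : continuous (fun v : 'rV[R]_n => \sum_(i <- r) v 0 i *: L (delta_mx 0 i)).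
  elim: r => [|i r IH].
    rewrite (_ : (fun v => _) = (fun _ => 0)); first exact: cst_continuous.
    by apply/funext => v; rewrite big_nil.
  rewrite (_ : (fun v => _) = (fun v : 'rV[R]_n => v 0 i *: L (delta_mx 0 i)) \+
    (fun v : 'rV[R]_n => \sum_(i <- r) v 0 i *: L (delta_mx 0 i))).
    by move=> v; apply: continuousD; [exact: hc|exact: IH].
  by apply/funext => v; rewrite big_cons.
rewrite (_ : (L : _ -> _) = (fun v => \sum_i v 0 i *: L (delta_mx 0 i))); first exact: h.
by apply/funext => v; rewrite {1}(row_sum_delta v) linear_sum; apply: eq_bigr => i _; rewrite linearZ.
Qed.

Lemma near_derive_close n m (f : 'rV[R]_n -> 'rV[R]_m) (U : set 'rV[R]_n) a (L : 'rV[R]_n -> 'rV[R]_m) e :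
  open U -> U a -> Ck U 1 f -> (forall v, 'D_v f a = L v) -> 0 < e ->
  \forall z \near a, U z /\ forall v, `|'D_v f z - L v| <= e * `|v|.
Proof.
move=> oU Ua [fd fD] fL e0.
(* The n partial derivatives contribute e / (n + 1) each; n + 1 in place of n covers n = 0. *)
have e0' : 0 < e / n.+1%:R by rewrite divr_gt0.
have hi i : \forall z \near a, `|'D_(delta_mx 0 i) f z - L (delta_mx 0 i)| <= e / n.+1%:R.
  rewrite -fL.
  have h : \forall z \near a, ball ('D_(delta_mx 0 i) f a) (e / n.+1%:R) ('D_(delta_mx 0 i) f z).
    exact: (fD (delta_mx 0 i) a Ua _ (nbhsx_ballx _ _ e0')).
  apply: filterS h => z; rewrite -ball_normE => h; rewrite /= in h.
  rewrite distrC; apply: ltW; exact: h.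
have h := @filter_forall _ _ _ (nbhs a) (nbhs_filter a) hi.
have hU : \forall z \near a, U z by exact: open_nbhs_nbhs.
apply: filterS2 hU h => z Uz hz; split=> // v.
rewrite -fL (derive_sum_coord _ (fd _ Uz)) (derive_sum_coord _ (fd _ Ua)) -sumrB.
apply: le_trans (ler_norm_sum _ _ _) _.
have : \sum_(i < n) `|v 0 i *: 'D_(delta_mx 0 i) f z - v 0 i *: 'D_(delta_mx 0 i) f a| <=
    \sum_(i < n) `|v| * (e / n.+1%:R).
  apply: ler_sum => i _; rewrite -scalerBr normrZ.
  apply: ler_pM => //; first exact: coord_le_norm.
  by rewrite fL.
move/le_trans; apply; rewrite sumr_const card_ord -[leLHS]mulr_natr -[leLHS]mulrA mulrC.
apply: ler_wpM2r => //; rewrite -mulrA ger_pMr// mulrC ler_pdivrMr// mul1r.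
by rewrite ler_nat.
Qed.

(** The identity derivative is a normalization, arranged by linear algebra on the Jacobian wherever
    the lemma is applied. Near a the map z - f z + y is a contraction with constant 1/2 whose fixed
    points are the solutions of f z = y, and g y is its fixed point. The derivative of g at y is the
    inverse Jacobian at g y, and this formula raises the order of smoothness of g one step at a
    time. *)
Lemma inverse_function n (f : 'rV[R]_n -> 'rV[R]_n) (U : set 'rV[R]_n) a :
  open U -> U a -> smooth_on U f -> (forall v, 'D_v f a = v) ->
  exists g : 'rV[R]_n -> 'rV[R]_n, exists V : set 'rV[R]_n,
    [/\ open V, V (f a), smooth_on V g, g (f a) = a &
     (forall y, V y -> U (g y) /\ f (g y) = y) /\ \forall z \near a, g (f z) = z].
Proof.
move=> oU Ua fS fL.
have e0 : 0 < 2^-1 :> R by rewrite invr_gt0.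
have /nbhs_ballP[r0 /= r00 rU] := near_derive_close oU Ua (fS 1%N) fL e0.
(* Half the radius makes the estimates available on a closed ball, where the fixed point is
   sought. *)
pose r := r0 / 2; have r_gt0 : 0 < r by rewrite divr_gt0.
have rB (z : 'rV[R]_n) : `|z - a| <= r -> U z /\ forall v, `|'D_v f z - v| <= 2^-1 * `|v|.
  move=> zr; apply: rU; rewrite -ball_normE /= distrC; apply: le_lt_trans zr _.
  by rewrite /r ltr_pdivrMr// ltr_pMr// ltr1n.
have fd z : U z -> differentiable f z by case: (fS 1%N) => h _ /h.
have fidL (x y : 'rV[R]_n) : `|x - a| <= r -> `|y - a| <= r ->
    `|(f x - x) - (f y - y)| <= 2^-1 * `|x - y|.
  apply: (@lipschitz_of_derive _ _ (fun z => f z - z) a r 2^-1); first exact: ltW.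
    move=> z /rB[Uz _]; apply: differentiableB; first exact: fd.
    exact: ex_diff.
  move=> z v /rB[Uz hz].
  have dz := @diff_derivable _ _ _ f z v (fd z Uz).
  rewrite deriveB; [rewrite derive_id; exact: hz|exact: dz|exact: derivable_id].
have finj (x y : 'rV[R]_n) : `|x - a| <= r -> `|y - a| <= r -> `|x - y| <= 2 * `|f x - f y|.
  move=> xr yr; have h := fidL x y xr yr.
  have : `|x - y| <= `|f x - f y| + `|(f x - x) - (f y - y)|.
    have -> : x - y = (f x - f y) - ((f x - x) - (f y - y)).
      by apply/rowP => i; rewrite !mxE; ring.
    exact: ler_normB.
  by lra.
have ra : `|a - a| <= r by rewrite subrr normr0 ltW.
(* The map z - f z + y moves a by at most |y - f a| and contracts by 1/2, so r / 2 is the distance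
   of y from f a up to which it preserves the closed r-ball. *)
pose V := ball (f a) (r / 2).
have gex (y : 'rV[R]_n) : exists z : 'rV[R]_n, V y -> `|z - a| < r /\ f z = y.
  case: (pselect (V y)) => [Vy|nVy]; last by exists a => /nVy.
  have Vy' : `|y - f a| < r / 2 by move: Vy; rewrite /V -ball_normE /= distrC.
  have [| | |z zr zE] := @contraction_fixpoint n (fun z => z - f z + y) a r.
  - exact: ltW.
  - move=> z zr; have h := fidL z a zr ra.
    have -> : z - f z + y - a = (y - f a) - ((f z - z) - (f a - a)).
      by apply/rowP => i; rewrite !mxE; ring.
    by apply: le_trans (ler_normB _ _) _; lra.
  - move=> z z' zr zr'; have h := fidL z z' zr zr'.
    have -> : z - f z + y - (z' - f z' + y) = - ((f z - z) - (f z' - z')).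
      by apply/rowP => i; rewrite !mxE; ring.
    by rewrite normrN.
  exists z => _; have zy : f z = y.
    apply/eqP; rewrite -subr_eq0; apply/eqP; rewrite -[RHS](subrr z) -{3}zE.
    by apply/rowP => i; rewrite !mxE; ring.
  split=> //; have := finj z a zr ra; rewrite zy; lra.
pose g y := projT1 (cid (gex y)).
have gP y : V y -> `|g y - a| < r /\ f (g y) = y by rewrite /g; case: cid.
have gPr y Vy : `|g y - a| <= r := ltW (gP y Vy).1.
have oV : open V by exact: ball_open.
have Vfa : V (f a) by apply: ballxx; rewrite divr_gt0.
have gfa : g (f a) = a.
  have [_ E] := gP _ Vfa; have := finj _ a (gPr _ Vfa) ra; rewrite E subrr normr0 mulr0.
  by rewrite normr_le0 subr_eq0 => /eqP.
have gL (y y' : 'rV[R]_n) : V y -> V y' -> `|g y - g y'| <= 2 * `|y - y'|.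
  move=> Vy Vy'; have := finj _ _ (gPr y Vy) (gPr y' Vy').
  by rewrite (gP y Vy).2 (gP y' Vy').2.
pose J z : 'M[R]_n := \matrix_(i, j) 'D_(delta_mx 0 i) (fun w => f w 0 j) z.
have DJ z v : U z -> 'D_v f z = v *m J z.
  move=> Uz; rewrite derive_sum_coord; last exact: fd.
  apply/rowP => j; rewrite summxE mxE; apply: eq_bigr => i _.
  by rewrite !mxE derive_coord//; exact: fd.
(* A vector v in the kernel satisfies |v| <= |v| / 2. *)
have Ju z : `|z - a| <= r -> J z \in unitmx.
  move=> /rB[Uz hz]; rewrite -row_free_unit; apply: inj_row_free => v vJ.
  have := hz v; rewrite DJ// vJ sub0r normrN => h.
  apply/eqP; rewrite -normr_le0; have := normr_ge0 v; lra.
have gD (y : 'rV[R]_n) : V y -> differentiable g y /\ forall v, 'D_v g y = v *m invmx (J (g y)).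
  move=> Vy; set z := g y; have zr := gPr y Vy.
  pose B : {linear 'rV[R]_n -> 'rV[R]_n} := mulmxr (invmx (J z)).
  have Bc : continuous B by exact: linear_continuous_rV.
  have [K K0 BK] := linear_lipschitz Bc.
  have zdf : differentiable f z by apply: fd; case: (rB _ zr).
  have gB e : 0 < e -> \forall k \near (0 : 'rV[R]_n), `|g (k + y) - (z + B k)| <= e * `|k|.
    (* With |w| <= 2 |k| below, this choice yields K e' |w| <= e |k|. *)
    move=> e1; pose e' := e / (2 * K); have e'0 : 0 < e' by rewrite divr_gt0// mulr_gt0.
    have /eqaddoP /(_ e' e'0) /nbhs_ballP[d /= d0 dB] := diff_locally zdf.
    have h1 : \forall k \near (0 : 'rV[R]_n), V (k + y).
      have Vy0 : nbhs (0 + y) V by rewrite add0r; exact: open_nbhs_nbhs.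
      have c : {for 0, continuous (fun k : 'rV[R]_n => k + y : 'rV[R]_n)}.
        by apply: continuousD; [exact: cvg_id|exact: cst_continuous].
      exact: c.
    have h2 : \forall k \near (0 : 'rV[R]_n), `|k| < d / 2.
      apply/nbhs_ballP; exists (d / 2); first by rewrite /= divr_gt0.
      by move=> k; rewrite -ball_normE /= sub0r normrN.
    apply: filterS2 h1 h2 => k Vk kd; set w := g (k + y) - z.
    have wk : `|w| <= 2 * `|k| by have := gL _ _ Vk Vy; rewrite addrK.
    have : ball 0 d w by rewrite -ball_normE /= sub0r normrN; lra.
    move/dB => /=; rewrite !fctE /= /w subrK (gP _ Vk).2 (gP _ Vy).2 -/z -/w => hw.
    have zU : U z by case: (rB _ zr).
    have -> : g (k + y) - (z + B k) = - B (k - w *m J z).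
      rewrite linearB /= -mulmxA mulmxV ?Ju// mulmx1 /w.
      by apply/rowP => i; rewrite !mxE; ring.
    rewrite normrN; apply: le_trans (BK _) _.
    have -> : k - w *m J z = k + y - (y + 'd f z w).
      rewrite -(deriveE _ zdf) DJ//.
      by apply/rowP => i; rewrite !mxE; ring.
    have h3 := ler_wpM2l (ltW K0) hw; apply: le_trans h3 _.
    have -> : K * (e' * `|w|) = e / 2 * `|w|.
      by rewrite /e'; field; rewrite gt_eqF.
    have e2 : 0 <= e / 2 by lra.
    by have := ler_wpM2l e2 wk; lra.
  have ge : g \o shift y = cst (g y) + B +o_ (0 : 'rV[R]_n) id.
    by apply/eqaddoP => e /gB; apply: filterS => k.
  have gd : differentiable g y by apply/diff_locallyP; rewrite (diff_unique Bc ge).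
  by split=> // v; rewrite deriveE// (diff_unique Bc ge).
have gC k : Ck V k g.
  elim: k => [|k IH]; first by move=> y /gD[/differentiable_continuous].
  split=> [y /gD[]//|v]; apply/Ck_coordP => // j.
  have JC i' j' : Ck V k (fun y => J (g y) i' j').
    rewrite (_ : (fun y => _) = (fun z => 'D_(delta_mx 0 i') (fun w => f w 0 j') z) \o g); last first.
      by apply/funext => y; rewrite /J mxE.
    apply: (@Ck_comp _ _ _ V U) => //.
      by move=> y Vy; case: (rB _ (gPr _ Vy)).
    have := (Ck_coordP k.+1 f oU).1 (fS k.+1) j'.
    by case=> _; apply.
  have iC := invmx_entry_Ck oV (fun y Vy => Ju _ (gPr y Vy)) JC.
  have := Ck_sum (index_enum 'I_n) (P := xpredT) oV (fun i _ => CkM oV (@Ck_cst _ n R V k (v 0 i)) (iC i j)).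
  by apply: Ck_ext => // y /gD[_ ->]; rewrite mxE.
exists g, V; split=> //; split=> [y Vy|]; first by case: (gP y Vy) => /ltW/rB[].
have h1 : \forall z \near a, V (f z).
  have := differentiable_continuous (fd a Ua); apply; exact: open_nbhs_nbhs.
have h2 : \forall z \near a, `|z - a| <= r.
  apply/nbhs_ballP; exists r => //= z; rewrite -ball_normE /= distrC; exact: ltW.
apply: filterS2 h1 h2 => z Vz zr.
have := finj _ _ (gPr _ Vz) zr; rewrite (gP _ Vz).2 subrr normr0 mulr0.
by rewrite normr_le0 subr_eq0 => /eqP.
Qed.

End InverseFunction.

(** * Hadamard's lemma *)

Section UnitIntegral.
Context {R : realType}.

Definition cont01 (phi : R -> R) := forall t : R, 0 <= t <= 1 -> {for t, continuous phi}.

(** Linearity, the sup bound and the fundamental theorem are all that Hadamard's lemma uses of the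
    integral over [0, 1]; measure theory stays behind this statement. *)
Lemma unit_integral_exists : exists I : (R -> R) -> R,
  [/\ forall a phi psi, cont01 phi -> cont01 psi ->
        I (fun t => a * phi t + psi t) = a * I phi + I psi,
      forall phi (K : R), cont01 phi -> (forall t : R, 0 <= t <= 1 -> `|phi t| <= K) -> `|I phi| <= K &
      forall F phi, cont01 phi -> (forall t : R, 0 <= t <= 1 -> is_derive t (1 : R) F (phi t)) ->
        I phi = F 1 - F 0].
Proof.
pose D : set R := `[0, 1]%classic.
pose mu := @lebesgue_measure R.
have mD : @measurable _ (measurableTypeR R) D by exact: measurable_itv.
have cw phi : cont01 phi -> {within D, continuous phi}.
  move=> c; apply: continuous_in_subspaceT => t; rewrite inE /D /= in_itv /= => tD.
  exact: c.
have ci phi : cont01 phi -> mu.-integrable D (EFin \o phi).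
  by move=> /cw c; apply: continuous_compact_integrable => //; exact: segment_compact.
exists (fun phi => Rintegral mu D phi); split.
- move=> a phi psi cphi cpsi; rewrite RintegralD//.
  + by rewrite RintegralZl//; exact: ci.
  + apply: ci => t tD; apply: continuousM; [exact: cst_continuous|exact: cphi].
  + exact: ci.
- move=> phi K cphi le; have iphi := ci _ cphi.
  have h := le_normr_Rintegral mD iphi.
  apply: (le_trans h).
  have := @le_Rintegral _ _ R mu D (fun t => `|phi t|) (fun=> K) mD.
  have muD : mu D = 1%E.
    by rewrite /mu /D lebesgue_measure_itv /= lte_fin ltr01 /= sube0.
  rewrite Rintegral_cst// (_ : fine _ = 1); last by rewrite -[RHS]/(fine (1%E : \bar R)); congr fine; exact: muD.
  rewrite mulr1.
  apply.
  + exact: integrable_norm.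
  + by apply: ci => t _; exact: cst_continuous.
  + by move=> t; rewrite /D /= in_itv /= => /le.
- move=> F phi cphi dF.
  rewrite /Rintegral (@continuous_FTC2 R phi F 0 1)//; first exact: cw.
    split.
    + by move=> t; rewrite in_itv /= => /andP[t0 t1]; have [|] := dF t; rewrite ?ltW.
    + have [//|d _] := dF 0; first by rewrite lexx ler01.
      apply: cvg_at_right_filter; apply: differentiable_continuous; exact/derivable1_diffP.
    + have [//|d _] := dF 1; first by rewrite lexx ler01.
      apply: cvg_at_left_filter; apply: differentiable_continuous; exact/derivable1_diffP.
  move=> t; rewrite in_itv /= => /andP[t0 t1]; rewrite derive1E.
  by have [|_ ->] := dF t; rewrite ?ltW.
Qed.

End UnitIntegral.

Section Hadamard.
Context {R : realType}.

Lemma ball_line n (a x : 'rV[R]_n) r (t : R) : 0 <= t <= 1 -> ball a r x -> ball a r (a + t *: (x - a)).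
Proof.
move=> /andP[t0 t1]; rewrite -!ball_normE /= opprD addrA subrr sub0r normrN normrZ distrC ger0_norm// => h.
by apply: le_lt_trans h; rewrite ler_piMl.
Qed.

(** Joint continuity of (t, y) |-> F (a + t (y - a)) gives a neighbourhood of x for each t, and
    compactness of [0, 1] gives one for all t. *)
Lemma unif_line n (F : 'rV[R]_n -> R) (a x : 'rV[R]_n) r e :
  (forall z : 'rV[R]_n, ball a r z -> {for z, continuous F}) -> ball a r x -> 0 < e ->
  \forall y \near x, forall t : R, 0 <= t <= 1 ->
    `|F (a + t *: (y - a)) - F (a + t *: (x - a))| <= e.
Proof.
move=> Fc xr e0.
pose P (y : 'rV[R]_n) (t : R) := `|F (a + t *: (y - a)) - F (a + t *: (x - a))| <= e.
have /compact_near_coveringP cov := @segment_compact R 0 1.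
have loc : forall t0 : R, `[0, 1]%classic t0 -> \forall t \near t0 & y \near x, P y t.
  move=> t0; rewrite /= in_itv /= => t01.
  have zr := ball_line t01 xr.
  pose G (p : R * 'rV[R]_n) := F (a + p.1 *: (p.2 - a)).
  have Lc : {for (t0, x), continuous (fun p : R * 'rV[R]_n => a + p.1 *: (p.2 - a))}.
    apply: cvgD; first exact: cvg_cst.
    apply: cvgZ; first exact: cvg_fst.
    by apply: cvgB; [exact: cvg_snd|exact: cvg_cst].
  have Gc : {for (t0, x), continuous G} by apply: continuous_comp; [exact: Lc|exact: Fc].
  have e2 : 0 < e / 2 by rewrite divr_gt0.
  have [[A B] /= [At Bx] AB] := Gc _ (nbhsx_ballx (G (t0, x)) _ e2).
  exists (A, B); first by split.
  move=> [t y] [/= At' By'].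
  have h1 := AB (t, y) (conj At' By').
  have h2 := AB (t, x) (conj At' (nbhs_singleton Bx)).
  move: h1 h2; rewrite /G -ball_normE /= => h1 h2.
  rewrite /P; set u := F _ in h1 h2 *; set v := F _ in h1 h2 *; set w := F _ in h1 h2 *.
  have -> : v - w = (u - w) - (u - v) by ring.
  by apply: le_trans (ler_normB _ _) _; lra.
have := cov _ (nbhs x) P (nbhs_filter x) loc.
move=> h; apply: filterS h => y Py t t01; apply: Py.
by rewrite /= in_itv.
Qed.

Lemma derive_of_estimate n (f : 'rV[R]_n -> R) x (c : 'I_n -> R) :
  (forall e, 0 < e -> \forall h \near (0 : 'rV[R]_n),
     `|f (h + x) - (f x + \sum_i h 0 i * c i)| <= e * `|h|) ->
  differentiable f x /\ forall v, 'D_v f x = \sum_i v 0 i * c i.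
Proof.
move=> est.
pose L (h : 'rV[R]_n) := \sum_i h 0 i * c i.
have Llin : linear L.
  move=> a u v; rewrite /L scaler_sumr -big_split; apply: eq_bigr => i _ /=.
  by rewrite !mxE /GRing.scale /=; ring.
pose LL : {linear 'rV[R]_n -> R} := HB.pack L (GRing.isLinear.Build _ _ _ _ _ Llin).
have Lc : continuous LL by exact: linear_continuous_rV.
have fe : f \o shift x = cst (f x) + LL +o_ (0 : 'rV[R]_n) id.
  by apply/eqaddoP => e /est h; apply: filterS h => h'; exact.
have fd : differentiable f x by apply/diff_locallyP; rewrite (diff_unique Lc fe).
split; first exact: fd.
by move=> v; rewrite (deriveE _ fd) (diff_unique Lc fe).
Qed.

(* [I (fun t => t^j F (a + t (x - a)))] is closed under differentiation in x:
   differentiating replaces (j, F) by (j + 1, D_v F). *)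
Section RadialIntegral.
Variables (I : (R -> R) -> R).
Hypothesis Ilin : forall a phi psi, cont01 phi -> cont01 psi ->
  I (fun t => a * phi t + psi t) = a * I phi + I psi.
Hypothesis Ibnd : forall phi (K : R), cont01 phi ->
  (forall t : R, 0 <= t <= 1 -> `|phi t| <= K) -> `|I phi| <= K.
Variables (n : nat) (a : 'rV[R]_n) (r : R).

Let radial j (F : 'rV[R]_n -> R) x := I (fun t => t ^+ j * F (a + t *: (x - a))).

Lemma cont01_radial j (F : 'rV[R]_n -> R) x :
  (forall z : 'rV[R]_n, ball a r z -> {for z, continuous F}) -> ball a r x ->
  cont01 (fun t => t ^+ j * F (a + t *: (x - a))).
Proof.
move=> Fc xr t t01; apply: continuousM; first exact: exprn_continuous.
apply: (@continuous_comp _ _ _ (fun t : R => a + t *: (x - a)) F).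
  apply: cvgD; first exact: cvg_cst.
  by apply: cvgZr_tmp; exact: cvg_id.
by apply: Fc; apply: ball_line.
Qed.

Lemma unit_integral_sum (s : seq 'I_n) (c : 'I_n -> R) (phi : 'I_n -> R -> R) :
  (forall i, cont01 (phi i)) ->
  cont01 (fun t => \sum_(i <- s) c i * phi i t) /\
  I (fun t => \sum_(i <- s) c i * phi i t) = \sum_(i <- s) c i * I (phi i).
Proof.
move=> pc; elim: s => [|i s [IH1 IH2]].
  have z : (fun t : R => \sum_(i <- [::]) c i * phi i t) = (fun=> 0).
    by apply/funext => t; rewrite big_nil.
  have c0 : cont01 (fun=> 0 : R) by move=> t _; exact: cst_continuous.
  rewrite z big_nil; split=> //; apply/eqP; rewrite -normr_le0.
  by apply: Ibnd => // t _; rewrite normr0.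
have z : (fun t : R => \sum_(i <- i :: s) c i * phi i t) =
    (fun t => c i * phi i t + \sum_(i <- s) c i * phi i t).
  by apply/funext => t; rewrite big_cons.
rewrite z big_cons; split; last by rewrite Ilin// IH2.
move=> t t01; apply: continuousD; last exact: IH1.
by apply: continuousM; [exact: cst_continuous|exact: pc].
Qed.

(** Differentiation under the integral sign: for each t the mean value theorem turns the increment
    of F into partial derivatives at an intermediate point, and [unif_line] bounds their variation
    uniformly in t. *)
Lemma radial_derive j (F : 'rV[R]_n -> R) x : Ck (ball a r) 1 F -> ball a r x ->
  differentiable (radial j F) x /\
  forall v, 'D_v (radial j F) x = \sum_i v 0 i * radial j.+1 ('D_(delta_mx 0 i) F) x.
Proof.
move=> [Fd FD] xr; apply: derive_of_estimate => e e0.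
have Fc (z : 'rV[R]_n) : ball a r z -> {for z, continuous F}.
  by move=> zr; apply: differentiable_continuous; exact: Fd.
have e0' : 0 < e / n.+1%:R by rewrite divr_gt0.
have hi i : \forall y \near x, forall t : R, 0 <= t <= 1 ->
    `|'D_(delta_mx 0 i) F (a + t *: (y - a)) - 'D_(delta_mx 0 i) F (a + t *: (x - a))| <= e / n.+1%:R.
  exact: unif_line (FD (delta_mx 0 i)) xr e0'.
have /nbhs_ballP[d /= d0 dB] := @filter_forall _ _ _ (nbhs x) (nbhs_filter x) hi.
have /nbhs_ballP[d' /= d'0 d'B] : nbhs x (ball a r) by apply: open_nbhs_nbhs; split=> //; exact: ball_open.
(* [d] controls the variation of the partial derivatives, [d'] keeps the segment from x to h + x in
   the ball. *)
apply/nbhs_ballP; exists (Num.min d d') => /=; first by rewrite lt_min d0.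
move=> h; rewrite -ball_normE /= sub0r normrN lt_min => /andP[hd hd'].
have hx s : 0 <= s <= 1 -> `|s *: h| <= `|h|.
  by move=> /andP[s0 s1]; rewrite normrZ ger0_norm// ler_piMl.
have hB s : 0 <= s <= 1 -> ball x d (s *: h + x) /\ ball a r (s *: h + x).
  move=> s01; have hs := hx s s01; split; last apply: d'B;
   rewrite -ball_normE /= opprD addrCA subrr addr0 normrN; exact: le_lt_trans hs _.
have hxr : ball a r (h + x) by have [|_] := hB 1; rewrite ?scale1r// ler01 lexx.
pose phi i t := t ^+ j.+1 * 'D_(delta_mx 0 i) F (a + t *: (x - a)).
have phic i : cont01 (phi i) by exact: (cont01_radial (j := j.+1) (FD (delta_mx 0 i)) xr).
have [sc sE] := unit_integral_sum (index_enum 'I_n) (fun i => h 0 i) phic.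
have c1 := cont01_radial (j := j) Fc hxr; have c2 := cont01_radial (j := j) Fc xr.
have c3 : cont01 (fun t => (-1) * (t ^+ j * F (a + t *: (x - a)) + \sum_i h 0 i * phi i t)
    + t ^+ j * F (a + t *: (h + x - a))).
  move=> t t01; apply: continuousD; last exact: c1.
  apply: continuousM; first exact: cst_continuous.
  by apply: continuousD; [exact: c2|exact: sc].
have c4 : cont01 (fun t => 1 * (t ^+ j * F (a + t *: (x - a))) + \sum_i h 0 i * phi i t).
  move=> t t01; apply: continuousD; last exact: sc.
  by apply: continuousM; [exact: cst_continuous|exact: c2].
have -> : radial j F (h + x) - (radial j F x + \sum_i h 0 i * radial j.+1 ('D_(delta_mx 0 i) F) x)
   = I (fun t => (-1) * (1 * (t ^+ j * F (a + t *: (x - a))) + \sum_i h 0 i * phi i t)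
      + t ^+ j * F (a + t *: (h + x - a))).
  by rewrite Ilin// Ilin// sE mul1r mulN1r addrC.
apply: Ibnd.
  by rewrite (_ : (fun t => _) = (fun t => (-1) * (t ^+ j * F (a + t *: (x - a)) + \sum_i h 0 i * phi i t)
    + t ^+ j * F (a + t *: (h + x - a))))//; apply/funext => t; rewrite mul1r.
move=> t t01; have /andP[t0 t1] := t01.
have Ep0 (s : R) : a + t *: (x - a) + s *: (a + t *: (h + x - a) - (a + t *: (x - a))) = a + t *: ((s *: h + x) - a).
  by apply/rowP => i; rewrite !mxE; ring.
have [|s s01 E] := @mvt_line R n F (a + t *: (h + x - a)) (a + t *: (x - a)).
  by move=> s s01; rewrite Ep0; apply: Fd; exact: (ball_line t01 (hB s s01).2).
have Eh : a + t *: (h + x - a) - (a + t *: (x - a)) = t *: h.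
  by apply/rowP => i; rewrite !mxE; ring.
have Ep : a + t *: (x - a) + s *: (t *: h) = a + t *: ((s *: h + x) - a).
  by apply/rowP => i; rewrite !mxE; ring.
move: E; rewrite Eh Ep derive_sum_coord; last by apply: Fd; exact: (ball_line t01 (hB s s01).2).
move=> E.
have -> : -1 * (1 * (t ^+ j * F (a + t *: (x - a))) + \sum_i h 0 i * phi i t)
      + t ^+ j * F (a + t *: (h + x - a)) =
   \sum_i t ^+ j.+1 * (h 0 i * ('D_(delta_mx 0 i) F (a + t *: (s *: h + x - a)) - 'D_(delta_mx 0 i) F (a + t *: (x - a)))).
  rewrite mul1r mulN1r addrC opprD addrA -mulrBr E mulr_sumr -sumrB.
  apply: eq_bigr => i _; rewrite /phi !mxE exprS /GRing.scale /=; ring.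
apply: le_trans (ler_norm_sum _ _ _) _.
have : \sum_(i < n) `|t ^+ j.+1 * (h 0 i * ('D_(delta_mx 0 i) F (a + t *: (s *: h + x - a)) - 'D_(delta_mx 0 i) F (a + t *: (x - a))))|
   <= \sum_(i < n) `|h| * (e / n.+1%:R).
  apply: ler_sum => i _; rewrite normrM normrM -[leRHS]mul1r.
  apply: ler_pM => //; first by rewrite normrX ger0_norm// exprn_ile1.
  apply: ler_pM => //; first exact: coord_le_norm.
  by apply: dB => //; exact: (hB s s01).1.
move/le_trans; apply; rewrite sumr_const card_ord -[leLHS]mulr_natr -[leLHS]mulrA mulrC.
apply: ler_wpM2r => //; rewrite -mulrA ger_pMr// mulrC ler_pdivrMr// mul1r.
by rewrite ler_nat.
Qed.

Lemma radial_Ck k j (F : 'rV[R]_n -> R) : Ck (ball a r) k F -> Ck (ball a r) k (radial j F).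
Proof.
have oB : open (ball a r) by exact: ball_open.
elim: k j F => [|k IH] j F.
  move=> Fc x xr A /nbhs_ballP[e /= e0 eA].
  have e2 : 0 < e / 2 by rewrite divr_gt0.
  have h := unif_line Fc xr e2.
  have h' : \forall y \near x, ball a r y by exact: open_nbhs_nbhs.
  suff H : \forall y \near x, A (radial j F y) by exact: H.
  apply: filterS2 h h' => y hy yr; apply: eA; rewrite -ball_normE /=.
  suff h : `|radial j F x - radial j F y| <= e / 2 by apply: le_lt_trans h _; lra.
  have cx := cont01_radial (j := j) Fc xr; have cy := cont01_radial (j := j) Fc yr.
  have -> : radial j F x - radial j F y = I (fun t => (-1) * (t ^+ j * F (a + t *: (y - a))) + t ^+ j * F (a + t *: (x - a))).
    by rewrite (Ilin (-1) cy cx) mulN1r addrC.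
  apply: Ibnd.
    move=> t t01; apply: continuousD; last exact: cx.
    by apply: continuousM; [exact: cst_continuous|exact: cy].
  move=> t t01; rewrite mulN1r addrC -mulrBr normrM distrC -[leRHS]mul1r.
  have /andP[t0 t1] := t01.
  apply: ler_pM => //; first by rewrite normrX ger0_norm// exprn_ile1.
  exact: hy.
move=> FC; have F1 : Ck (ball a r) 1 F.
  by elim: k FC {IH} => [//|k IH] FC; apply: IH; exact: Ck_prev.
split=> [x xr|v]; first by case: (radial_derive j F1 xr).
have h i : Ck (ball a r) k (fun x => v 0 i * radial j.+1 ('D_(delta_mx 0 i) F) x).
  by apply: CkM => //; [exact: Ck_cst|apply: IH; exact: (FC.2 (delta_mx 0 i))].
have := Ck_sum (index_enum 'I_n) (P := xpredT) oB (fun i _ => h i).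
by apply: Ck_ext => // x xr; case: (radial_derive j F1 xr) => _ ->.
Qed.

End RadialIntegral.

Lemma hadamard n (f : 'rV[R]_n -> R) a r : 0 < r -> smooth_on (ball a r) f ->
  exists2 g : 'I_n -> 'rV[R]_n -> R, forall i, smooth_on (ball a r) (g i) &
    forall x, ball a r x -> f x = f a + \sum_i (x 0 i - a 0 i) * g i x.
Proof.
move=> r0 fS; have [I [Ilin Ibnd Iftc]] := @unit_integral_exists R.
(* The mean of the i-th partial derivative over the segment from a to x. The factor [t ^+ 0] makes
   it literally a radial integral, so that [radial_Ck] applies. *)
exists (fun i x => I (fun t => t ^+ 0 * 'D_(delta_mx 0 i) f (a + t *: (x - a)))).
  by move=> i k; exact: (radial_Ck Ilin Ibnd 0 ((fS k.+1).2 (delta_mx 0 i))).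
move=> x xr; have [fd fD] := fS 1%N.
have phic i : cont01 (fun t => t ^+ 0 * 'D_(delta_mx 0 i) f (a + t *: (x - a))).
  exact: (cont01_radial (j := 0) (fD (delta_mx 0 i)) xr).
have [sc sE] := unit_integral_sum Ilin Ibnd (index_enum 'I_n) (fun i => (x - a) 0 i) phic.
have := Iftc (fun t => f (a + t *: (x - a))) _ sc.
rewrite sE scale1r scale0r addr0 (addrC a (x - a)) subrK => E.
rewrite (_ : \sum_i _ = f x - f a); first by rewrite addrCA subrr addr0.
have dF (t : R) : 0 <= t <= 1 -> is_derive t (1 : R) (fun t : R => f (a + t *: (x - a)))
    (\sum_i (x - a) 0 i * (t ^+ 0 * 'D_(delta_mx 0 i) f (a + t *: (x - a)))).
  move=> t01; have dt := fd _ (ball_line t01 xr).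
  have := is_derive_line dt; rewrite (derive_sum_coord _ dt).
  by under eq_bigr do rewrite -[X in _ *: X]mul1r -(expr0 t).
rewrite -(E dF).
by apply: eq_bigr => i _; rewrite !mxE.
Qed.

End Hadamard.

(** * Symmetry of second derivatives *)

Section Schwarz.
Context {R : realType}.

Lemma derive_scale n (W : normedModType R) (f : 'rV[R]_n -> W) x v (t : R) :
  differentiable f x -> 'D_(t *: v) f x = t *: 'D_v f x.
Proof. by move=> fd; rewrite !(deriveE _ fd) linearZ. Qed.

Lemma derive_shift_arg n (W : normedModType R) (f : 'rV[R]_n -> W) (x w v : 'rV[R]_n) :
  'D_v (fun y => f (y + w)) x = 'D_v f (x + w).
Proof.
have E : (fun h : R => h^-1 *: (((fun y => f (y + w)) \o shift x) (h *: v) - f (x + w)))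
    = (fun h => h^-1 *: ((f \o shift (x + w)) (h *: v) - f (x + w))).
  by apply/funext => h /=; rewrite addrA.
by rewrite /derive E.
Qed.

Lemma differentiable_shift_arg n (W : normedModType R) (f : 'rV[R]_n -> W) (x w : 'rV[R]_n) :
  differentiable f (x + w) -> differentiable (fun y => f (y + w)) x.
Proof.
move=> fd; apply: (@differentiable_comp _ _ _ _ (fun y : 'rV[R]_n => y + w) f); last exact: fd.
by apply: differentiableD; [exact: ex_diff|exact: differentiable_cst].
Qed.

(** The mean value theorem is applied along v to y |-> f (y + t w) - f y, and then along w to
    ['D_v f]. The bound on p is what allows continuity of the mixed derivative at x to be used. *)
Lemma second_difference n (f : 'rV[R]_n -> R) x (r t : R) v w :
  (forall z, `|z - x| <= r -> differentiable f z) ->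
  (forall z, `|z - x| <= r -> differentiable ('D_v f) z) ->
  `|t *: v| + `|t *: w| <= r ->
  exists2 p, `|p - x| <= `|t *: v| + `|t *: w| &
    f (x + t *: v + t *: w) - f (x + t *: v) - f (x + t *: w) + f x = t * (t * 'D_w ('D_v f) p).
Proof.
move=> fd fdv tr.
have nn s u : 0 <= s <= 1 -> `|s *: (t *: u)| <= `|t *: u| :> R.
  by move=> /andP[s0 s1]; rewrite normrZ ger0_norm// ler_piMl.
have n1 s : 0 <= s <= 1 -> `|x + s *: (t *: v) - x| <= `|t *: v|.
  by move=> s01; rewrite addrAC subrr add0r; exact: nn.
have n2 s s' : 0 <= s <= 1 -> 0 <= s' <= 1 ->
    `|x + s *: (t *: v) + s' *: (t *: w) - x| <= `|t *: v| + `|t *: w|.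
  move=> s01 s01'.
  have -> : x + s *: (t *: v) + s' *: (t *: w) - x = s *: (t *: v) + s' *: (t *: w).
    by apply/rowP => i; rewrite !mxE; ring.
  by apply: le_trans (ler_normD _ _) _; apply: lerD; exact: nn.
have n1' s : 0 <= s <= 1 -> `|x + s *: (t *: v) - x| <= r.
  by move=> s01; apply: le_trans (n1 s s01) _; have := normr_ge0 (t *: w); lra.
have n2' s s' : 0 <= s <= 1 -> 0 <= s' <= 1 ->
    `|x + s *: (t *: v) + s' *: (t *: w) - x| <= r.
  by move=> s01 s01'; apply: le_trans (n2 s s' s01 s01') _.
have one : 0 <= (1 : R) <= 1 by rewrite ler01 lexx.
pose phi (y : 'rV[R]_n) : R := f (y + t *: w) - f y.
have phid s : 0 <= s <= 1 -> differentiable (fun y => f (y + t *: w)) (x + s *: (t *: v)) /\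
   differentiable f (x + s *: (t *: v)).
  move=> s01; split; last by apply: fd; exact: n1'.
  by apply: differentiable_shift_arg; apply: fd; have := n2' s 1 s01 one; rewrite scale1r.
have [|s s01 E] := @mvt_line R n phi (x + t *: v) x.
  move=> s s01; rewrite (addrC x (t *: v)) addrK; have [h1 h2] := phid s s01.
  exact: differentiableB.
move: E; rewrite (addrC x (t *: v)) addrK ?(addrC (t *: v) x); have [h1 h2] := phid s s01.
rewrite derive_scale; last exact: differentiableB.
have -> : 'D_v phi (x + s *: (t *: v)) = 'D_v f (x + s *: (t *: v) + t *: w) - 'D_v f (x + s *: (t *: v)).
  rewrite deriveB; [|exact: diff_derivable|exact: diff_derivable].
  by rewrite derive_shift_arg.
set p := x + s *: (t *: v) => E.
have [|s' s01' E'] := @mvt_line R n ('D_v f) (p + t *: w) p.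
  by move=> s' s01'; apply: fdv; rewrite (addrC p (t *: w)) addrK; exact: n2'.
exists (p + s' *: (t *: w)); first exact: n2.
move: E'; rewrite (addrC p (t *: w)) addrK ?(addrC (t *: w) p) derive_scale; last by apply: fdv; exact: n2'.
move=> E'; move: E; rewrite E' /phi => E.
have -> : f (x + t *: v + t *: w) - f (x + t *: v) - f (x + t *: w) + f x =
   f (x + t *: v + t *: w) - f (x + t *: v) - (f (x + t *: w) - f x) by ring.
exact: E.
Qed.

Lemma dist_of_balls (a b b' c e : R) :
  b = b' -> ball a (e / 2) b -> ball c (e / 2) b' -> `|c - a| <= e.
Proof.
move=> <-; rewrite -!ball_normE /= => h1 h2.
have -> : c - a = (c - b) - (a - b) by ring.
by apply: le_trans (ler_normB _ _) _; lra.
Qed.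

(** The second difference along t v and t w is symmetric in v and w. Its two expansions equate the
    mixed derivatives at two points p and q close to x, and continuity brings both back to x. *)
Lemma schwarz n (f : 'rV[R]_n -> R) (U : set 'rV[R]_n) x v w : open U -> U x -> Ck U 2 f ->
  'D_v ('D_w f) x = 'D_w ('D_v f) x.
Proof.
move=> oU Ux [fd fD].
have cv := (fD v).2 w x Ux; have cw := (fD w).2 v x Ux.
apply/eqP; rewrite -subr_eq0 -normr_le0; apply/ler_addgt0Pl => e e0; rewrite addr0.
have e2 : 0 < e / 2 by rewrite divr_gt0.
have hv : \forall z \near x, ball ('D_w ('D_v f) x) (e / 2) ('D_w ('D_v f) z).
  exact: (cv _ (nbhsx_ballx _ _ e2)).
have hw : \forall z \near x, ball ('D_v ('D_w f) x) (e / 2) ('D_v ('D_w f) z).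
  exact: (cw _ (nbhsx_ballx _ _ e2)).
have hU : \forall z \near x, U z by exact: open_nbhs_nbhs.
have /nbhs_ballP[r /= r0 rB] : \forall z \near x, (ball ('D_w ('D_v f) x) (e / 2) ('D_w ('D_v f) z) /\
    ball ('D_v ('D_w f) x) (e / 2) ('D_v ('D_w f) z)) /\ U z.
  by apply: filterS3 hv hw hU.
have N0 : 0 < `|v| + `|w| + 1 by rewrite ltr_wpDl// addr_ge0.
(* The summand 1 keeps the denominator positive when v = w = 0; t has to be nonzero because t^2 is
   cancelled below. *)
pose t : R := r / 2 / (`|v| + `|w| + 1).
have t0 : 0 < t by rewrite divr_gt0// divr_gt0.
have nt (u : 'rV[R]_n) : `|t *: u| = t * `|u| by rewrite normrZ gtr0_norm.
have tr : `|t *: v| + `|t *: w| <= r / 2.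
  rewrite !nt -mulrDr /t mulrAC ler_pdivrMr//.
  by apply: ler_wpM2l; [rewrite divr_ge0// ltW|rewrite lerDl].
have B z : `|z - x| <= r / 2 -> ball x r z.
  by move=> zr; rewrite -ball_normE /= distrC; apply: le_lt_trans zr _; lra.
have dU z : `|z - x| <= r / 2 -> U z by move=> /B/rB[].
have [|||p pr Ep] := @second_difference n f x (r / 2) t v w.
- by move=> z /dU; exact: fd.
- by move=> z /dU; exact: (fD v).1.
- exact: tr.
have [|||q qr Eq] := @second_difference n f x (r / 2) t w v.
- by move=> z /dU; exact: fd.
- by move=> z /dU; exact: (fD w).1.
- by rewrite addrC; exact: tr.
have pq : 'D_w ('D_v f) p = 'D_v ('D_w f) q.
  have : t * (t * 'D_w ('D_v f) p) = t * (t * 'D_v ('D_w f) q).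
    apply: etrans (esym Ep) _; apply: etrans Eq.
    by rewrite (addrAC x (t *: w)); congr (_ + _); exact: addrAC.
  have tn : t != 0 by rewrite gt_eqF.
  by move/(mulfI tn)/(mulfI tn).
have hp := (rB p (B p (le_trans pr tr))).1.1.
rewrite addrC in tr; have hq := (rB q (B q (le_trans qr tr))).1.2.
exact: dist_of_balls pq hp hq.
Qed.

End Schwarz.

(** * Bump functions *)

Section Bump.
Context {R : realType}.

(** The functions p(1/t) exp(-1/t), extended by 0, form a family closed under differentiation: the
    derivative replaces p by X^2 (p - p'). Smoothness of exp(-1/t) is thus an induction over p. *)
Definition expinv (p : {poly R}) (t : R) : R :=
  if 0 < t then p.[t^-1] * expR (- t^-1) else 0.

(** With s = 1/t >= 1 and d = [size p], the polynomial is at most a constant times s^d, while exp(s)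
    >= s^(d + 2) / (d + 2)!. The two spare powers leave t^2, which makes the derivative at 0 exist
    and vanish. *)
Lemma expinv_sq_bound p : exists C, forall t, 0 < t -> t <= 1 -> `|expinv p t| <= C * t ^+ 2.
Proof.
pose d := size p; pose A := \sum_(i < d) `|p`_i|.
exists (A * (d.+2)`!%:R) => t t0 t1; rewrite /expinv t0.
set s := t^-1; have s1 : 1 <= s by rewrite /s invf_ge1.
have s0 : 0 < s by rewrite invr_gt0.
have hp : `|p.[s]| <= A * s ^+ d.
  rewrite horner_coef; apply: le_trans (ler_norm_sum _ _ _) _.
  rewrite /A mulr_suml; apply: ler_sum => i _; rewrite normrM normrX (ger0_norm (ltW s0)).
  by apply: ler_wpM2l => //; apply: ler_weXn2l => //; exact: ltnW.
have f0 : 0 < (d.+2)`!%:R :> R by rewrite ltr0n fact_gt0.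
have he : expR (- s) <= (d.+2)`!%:R * t ^+ d.+2.
  have := @expR_ge1Dxn R s d.+1 (ltW s0) => h.
  have h' : s ^+ d.+2 / (d.+2)`!%:R <= expR s by apply: le_trans h; rewrite lerDr.
  have -> : (d.+2)`!%:R * t ^+ d.+2 = (s ^+ d.+2 / (d.+2)`!%:R)^-1.
    by rewrite invfM invrK /s exprVn invrK mulrC.
  rewrite expRN lef_pV2 // posrE; first exact: expR_gt0.
  by rewrite divr_gt0// exprn_gt0.
rewrite normrM (ger0_norm (expR_ge0 _)).
apply: le_trans (ler_pM (normr_ge0 _) (expR_ge0 _) hp he) _.
have -> : A * s ^+ d * ((d.+2)`!%:R * t ^+ d.+2) = A * (d.+2)`!%:R * t ^+ 2 * (s * t) ^+ d.
  by rewrite -addn2 exprD exprMn; ring.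
by rewrite /s mulVf ?gt_eqF// expr1n mulr1.
Qed.

Lemma expinv_is_derive p t :
  is_derive t (1 : R) (expinv p) (expinv ('X ^+ 2 * (p - p^`())) t).
Proof.
have [t0|t0|t0] := ltrgtP 0 t.
- have nE : \forall x \near t, p.[x^-1] * expR (- x^-1) = expinv p x.
    have h : \forall x \near t, 0 < x by exact: lt_nbhsr.
    by apply: filterS h => x x0; rewrite /expinv x0.
  apply: (near_eq_is_derive nE).
  have tn : t != 0 by rewrite gt_eqF.
  have dV : is_derive t (1 : R) (fun x : R => x^-1) (- t ^- 2 *: 1).
    exact: (@is_deriveV _ id _ _ _ tn (is_derive_id _ _)).
  have dN : is_derive t (1 : R) (fun x : R => - x^-1) (- (- t ^- 2 *: 1)).
    exact: is_deriveN dV.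
  have d1 := is_derive1_comp (is_derive_poly p t^-1) dV.
  have d2 := @is_derive1_comp R expR (fun x => - x^-1) t _ _ (is_derive_expR (- t^-1)) dN.
  have d3 := is_deriveM d1 d2.
  apply: (is_derive_eq d3).
  rewrite /expinv t0 /= !(hornerM, hornerD, hornerN, hornerXn) /GRing.scale /=.
  rewrite hornerX -expr2 exprVn; ring.
- have nE : \forall x \near t, 0 = expinv p x.
    have h : \forall x \near t, x < 0 by exact: lt_nbhsl.
    by apply: filterS h => x x0; rewrite /expinv ltNge (ltW x0).
  apply: (near_eq_is_derive nE).
  have -> : expinv ('X ^+ 2 * (p - p^`())) t = 0 by rewrite /expinv ltNge (ltW t0).
  exact: is_derive_cst.
rewrite -t0; have e00 q : expinv q 0 = 0 by rewrite /expinv ltxx.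
rewrite e00.
have [C Cb] := expinv_sq_bound p.
have cv : (fun h : R => h^-1 *: ((expinv p \o shift 0) (h *: (1 : R)) - expinv p 0)) @ 0^' --> (0 : R).
  have C0 : 0 <= C by have := Cb 1 ltr01 (lexx _); rewrite expr1n mulr1; apply: le_trans.
  move=> B /nbhs_ballP[e /= e0 eB].
  have d0 : 0 < Num.min 1 (e / (C + 1)) by rewrite lt_min ltr01 divr_gt0// ltr_wpDl.
  suff H : \forall h \near 0^', B (h^-1 *: ((expinv p \o shift 0) (h *: (1 : R)) - expinv p 0)) by exact: H.
  exists (Num.min 1 (e / (C + 1))) => //= h; rewrite /= sub0r normrN lt_min => /andP[h1 he] h0.
  apply: eB; rewrite -ball_normE /= sub0r normrN addr0 e00 subr0.
  have -> : h *: (1 : R) = h by exact: mulr1.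
  rewrite /GRing.scale /= normrM normfV.
  have nh : 0 < `|h| by rewrite normr_gt0.
  rewrite mulrC ltr_pdivrMr//.
  have hb : `|expinv p h| <= C * `|h| ^+ 2.
    have [hp|hn] := ltP 0 h.
      by rewrite (gtr0_norm hp); apply: Cb => //; apply: ltW; rewrite -(gtr0_norm hp).
    by rewrite /expinv ltNge hn /= normr0 mulr_ge0// exprn_ge0.
  apply: le_lt_trans hb _; rewrite expr2 mulrA ltr_pM2r//.
  have C1 : 0 < C + 1 by lra.
  move: he; rewrite ltr_pdivlMr// => he; apply: le_lt_trans he.
  rewrite mulrC ler_wpM2l//; lra.
apply: DeriveDef; first by apply/cvg_ex; exists 0.
exact: (cvg_lim _ cv).
Qed.

Lemma derive_chain1 n (f : 'rV[R]_n -> R) (g : R -> R) x v (dg : R) :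
  differentiable f x -> is_derive (f x) (1 : R) g dg ->
  differentiable (g \o f) x /\ 'D_v (g \o f) x = dg * 'D_v f x.
Proof.
move=> fd [gd gE].
have gd' : differentiable g (f x) by exact/derivable1_diffP.
have gfd : differentiable (g \o f) x by exact: differentiable_comp.
split; first exact: gfd.
rewrite (deriveE _ gfd) (diff_comp fd gd') /= -(deriveE _ fd).
have E (r : R) : 'd g (f x) r = r * 'd g (f x) 1.
  by rewrite -[in LHS](mulr1 r); exact: linearZ.
by rewrite E -(deriveE _ gd') gE mulrC.
Qed.

Lemma Ck_expinv n (A : set 'rV[R]_n) k p (f : 'rV[R]_n -> R) :
  open A -> Ck A k f -> Ck A k (expinv p \o f).
Proof.
move=> oA; elim: k p => [|k IH] p.
  move=> fC x Ax; apply: continuous_comp; first exact: fC.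
  have [d _] := expinv_is_derive p (f x).
  by apply: differentiable_continuous; apply/derivable1_diffP.
move=> fC; have [fd fD] := fC; split=> [x Ax|v].
  exact: (derive_chain1 0 (fd x Ax) (expinv_is_derive p (f x))).1.
apply: Ck_ext oA _ (CkM oA (IH ('X ^+ 2 * (p - p^`())) (Ck_prev fC)) (fD v)) => x Ax.
exact/esym/(derive_chain1 v (fd x Ax) (expinv_is_derive p (f x))).2.
Qed.

Definition smooth_step (t : R) : R := expinv 1 t / (expinv 1 t + expinv 1 (1 - t)).

Lemma expinv1_ge0 (t : R) : 0 <= expinv 1 t.
Proof. by rewrite /expinv; case: ifP => // _; rewrite hornerC mul1r expR_ge0. Qed.

Lemma expinv1_gt0 (t : R) : 0 < t -> 0 < expinv 1 t.
Proof. by rewrite /expinv => ->; rewrite hornerC mul1r expR_gt0. Qed.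

Lemma smooth_step_denom (t : R) : 0 < expinv 1 t + expinv 1 (1 - t).
Proof.
have [t0|t0] := ltP 0 t; first by rewrite ltr_pwDl ?expinv1_gt0 ?expinv1_ge0.
by rewrite ltr_wpDl ?expinv1_ge0// expinv1_gt0//; lra.
Qed.

Lemma smooth_step0 (t : R) : t <= 0 -> smooth_step t = 0.
Proof. by move=> t0; rewrite /smooth_step {1}/expinv ltNge t0 /= mul0r. Qed.

Lemma smooth_step1 (t : R) : 1 <= t -> smooth_step t = 1.
Proof.
move=> t1; have e0 : expinv 1 (1 - t) = 0 by rewrite /expinv ltNge subr_le0 t1.
rewrite /smooth_step e0 addr0 mulfV// gt_eqF// expinv1_gt0//; lra.
Qed.

Lemma Ck_smooth_step n (A : set 'rV[R]_n) k (f : 'rV[R]_n -> R) :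
  open A -> Ck A k f -> Ck A k (smooth_step \o f).
Proof.
move=> oA fC; have fC' : Ck A k (fun x => 1 + (-1) * f x).
  by apply: CkD => //; [exact: Ck_cst|apply: CkM => //; exact: Ck_cst].
have C1 := Ck_expinv 1 oA fC; have C2 := Ck_expinv 1 oA fC'.
have C3 := CkD oA C1 C2.
have C4 : Ck A k (fun x => (expinv 1 (f x) + expinv 1 (1 + (-1) * f x))^-1).
  apply: CkV oA _ C3 => x _; have := smooth_step_denom (f x).
  by rewrite -(mulN1r (f x)); exact: lt0r_neq0.
by apply: Ck_ext oA _ (CkM oA C1 C4) => x _; rewrite mulN1r.
Qed.

Lemma Ck_coord n (A : set 'rV[R]_n) k i : Ck A k (fun x => x 0 i).
Proof.
have Llin : linear (fun u : 'rV[R]_n => u 0 i) by move=> a u w; rewrite !mxE.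
pose LM := GRing.isLinear.Build _ _ _ _ _ Llin.
pose L : {linear 'rV[R]_n -> R} := HB.pack (fun u : 'rV[R]_n => u 0 i) LM.
by apply: (@Ck_lin _ _ _ _ _ L); exact: coord_continuous.
Qed.

Lemma rV_bump n (a : 'rV[R]_n) (r : R) : 0 < r ->
  exists b : 'rV[R]_n -> R, [/\ forall k, Ck setT k b,
    forall x, `|x - a| <= r -> b x = 1 & forall x, b x != 0 -> `|x - a| <= 2 * r].
Proof.
(* 2 - (x_i - a_i)^2 / r^2 is at least 1 for |x_i - a_i| <= r and negative from 2 r on. The square
   keeps it smooth, and the product over i matches the sup norm. *)
move=> r0; pose s (i : 'I_n) (x : 'rV[R]_n) := 2 + (- (r ^+ 2)^-1) * ((x 0 i - a 0 i) * (x 0 i - a 0 i)).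
have r20 : 0 < r ^+ 2 by rewrite exprn_gt0.
exists (fun x => \prod_i smooth_step (s i x)); split.
- move=> k; apply: Ck_prod; first exact: openT.
  move=> i _; apply: Ck_smooth_step; first exact: openT.
  have cc : Ck setT k (fun x : 'rV[R]_n => x 0 i - a 0 i).
    apply: CkD; [exact: openT| |exact: Ck_cst].
    exact: Ck_coord.
  apply: CkD; [exact: openT|exact: Ck_cst|].
  apply: CkM; [exact: openT|exact: Ck_cst|].
  by apply: CkM; [exact: openT| |].
- move=> x xa; apply: big1 => i _; apply: smooth_step1; rewrite /s -expr2.
  have h : (x 0 i - a 0 i) ^+ 2 <= r ^+ 2.
    have h0 : `|x 0 i - a 0 i| <= r.
      by apply: le_trans xa; have := coord_le_norm (x - a) i; rewrite !mxE.
    by rewrite -real_normK ?num_real//; apply: lerXn2r; rewrite ?nnegrE ?normr_ge0 ?(ltW r0).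
  have : (r ^+ 2)^-1 * (x 0 i - a 0 i) ^+ 2 <= 1 by rewrite mulrC ler_pdivrMr// mul1r.
  by rewrite mulNr; lra.
- move=> x /prodf_neq0 bx; apply: norm_le_coord; first by lra.
  move=> i; have := bx i isT; apply: contraNT; rewrite -ltNge => h.
  apply/eqP; apply: smooth_step0; rewrite /s -expr2.
  have h2 : (2 * r) ^+ 2 <= (x 0 i - a 0 i) ^+ 2.
    have h0 : 2 * r <= `|x 0 i - a 0 i| by apply: ltW; move: h; rewrite !mxE.
    have r2 : 0 <= 2 * r by lra.
    by rewrite -[leRHS]real_normK ?num_real//; apply: lerXn2r; rewrite ?nnegrE ?normr_ge0.
  have : 2 <= (r ^+ 2)^-1 * (x 0 i - a 0 i) ^+ 2.
    rewrite mulrC ler_pdivlMr//; apply: le_trans h2; rewrite exprMn; lra.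
  by rewrite mulNr; lra.
Qed.

End Bump.

(** * Smoothness at a point of a manifold *)

Section LocalSmoothness.
Context {R : realType}.

Lemma Ck_local n (W : normedModType R) (A : set 'rV[R]_n) k (f : 'rV[R]_n -> W) :
  (forall x, A x -> exists2 U, U x & Ck U k f) -> Ck A k f.
Proof.
elim: k f => [|k IH] f h; first by move=> x /h[U Ux fC]; exact: fC.
split=> [x /h[U Ux [fd _]]|v]; first exact: fd.
by apply: IH => x /h[U Ux [_ fD]]; exists U; [exact: Ux|exact: fD].
Qed.

Lemma open_preimage_within (S T : topologicalType) (A : set S) (B : set T) (f : S -> T) :
  open A -> open B -> (forall x, A x -> {for x, continuous f}) ->
  open (A `&` f @^-1` B).
Proof.
move=> oA oB fc; rewrite openE => x [Ax Bx].
have h1 : \forall y \near x, A y by exact: open_nbhs_nbhs.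
have h2 : \forall y \near x, B (f y) by apply: (fc x Ax); exact: open_nbhs_nbhs.
exact: filterI.
Qed.

Lemma near_chart (T : topologicalType) (c : chart R T) (x : T) (P : T -> Prop) : cdom c x ->
  (\forall y \near x, P y) <-> (\forall z \near cmap c x, P (cinv c z)).
Proof.
move=> cx; have ci : (cmap c @` cdom c) (cmap c x) by exists x.
have hd : \forall y \near x, cdom c y by apply: open_nbhs_nbhs; split=> //; exact: cdom_open.
split=> h; first by apply: (cinv_cont ci); rewrite cmapK.
have h' : \forall y \near x, P (cinv c (cmap c y)) by exact: (cmap_cont cx h).
by apply: filterS2 hd h' => y cy; rewrite cmapK.
Qed.

Lemma near_cimg (T : topologicalType) (c : chart R T) (x : T) : cdom c x ->
  \forall z \near cmap c x, (cmap c @` cdom c) z.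
Proof. by move=> cx; apply: open_nbhs_nbhs; split; [exact: cimg_open|exists x]. Qed.

(** A property of the germ of f at x; one chart is enough because the atlas is compatible
    ([smooth_at_chart]). In this form functions can be cut off and glued. *)
Definition smooth_at (M : manifoldType R) (x : M) (f : M -> R) : Prop :=
  exists c : chart R M, [/\ atlas M c, cdom c x &
    exists U, [/\ open U, U (cmap c x) & smooth_on U (f \o cinv c)]].

Lemma near_open (T : topologicalType) (x : T) (P : T -> Prop) :
  (\forall y \near x, P y) -> exists U, [/\ open U, U x & forall y, U y -> P y].
Proof. by move=> h; exists (interior P); split; [exact: open_interior|exact: h|exact: interior_subset]. Qed.

Lemma smooth_at_chart (M : manifoldType R) (x : M) f (c : chart R M) :
  atlas M c -> cdom c x -> smooth_at x f ->
  exists U, [/\ open U, U (cmap c x), U `<=` cmap c @` cdom c & smooth_on U (f \o cinv c)].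
Proof.
move=> ac cx [d [ad dx [U [oU Ux fS]]]].
pose V := cmap c @` (cdom c `&` cdom d).
have oV : open V by apply: cmap_open_img; exact: cdom_open.
have TS := atlas_compat c d ac ad.
have oW := open_preimage_within oV oU (TS 0%N).
exists (V `&` (cmap d \o cinv c) @^-1` U); split; first exact: oW.
- by split; [exists x|rewrite /preimage /= cmapK].
- by move=> _ [[y [cy dy] <-] _]; exists y.
move=> k; have WV : V `&` (cmap d \o cinv c) @^-1` U `<=` V by move=> y [].
have := Ck_comp (f := cmap d \o cinv c) oW (fun y Wy => Wy.2) (Ck_sub WV (TS k)) (fS k).
apply: Ck_ext; first exact: oW.
by move=> _ [[y [cy dy] <-] _] /=; rewrite (cmapK cy) (cmapK dy).
Qed.

Lemma smooth_at_ext (M : manifoldType R) (x : M) f g :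
  (\forall y \near x, f y = g y) -> smooth_at x f -> smooth_at x g.
Proof.
move=> fg [c [ac cx [U [oU Ux fS]]]]; exists c; split=> //.
have /near_open[V [oV Vx VP]] := (near_chart _ cx).1 fg.
exists (U `&` V); split; [exact: openI|by split|].
move=> k; have UV : U `&` V `<=` U by move=> y [].
by apply: Ck_ext (Ck_sub UV (fS k)); [exact: openI|move=> y [_ /VP]].
Qed.

Lemma smooth_at_near (M : manifoldType R) (x : M) f : smooth_at x f -> \forall y \near x, smooth_at y f.
Proof.
move=> [c [ac cx [U [oU Ux fS]]]].
have hd : \forall y \near x, cdom c y by apply: open_nbhs_nbhs; split=> //; exact: cdom_open.
have hU : \forall y \near x, U (cmap c y) by apply: (cmap_cont cx); exact: open_nbhs_nbhs.
by apply: filterS2 hd hU => y cy Uy; exists c; split=> //; exists U.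
Qed.

Lemma CinfP (M : manifoldType R) (f : M -> R) : Cinf f <-> forall x, smooth_at x f.
Proof.
split=> [fS x|fS c ac k].
  have [c ac cx] := atlas_cover x; exists c; split=> //.
  exists (cmap c @` cdom c); split; [exact: cimg_open|by exists x|exact: fS].
apply: Ck_local => _ [x cx <-].
by have [U [oU Ux _ /(_ k) UC]] := smooth_at_chart ac cx (fS x); exists U.
Qed.

Lemma smooth_at_vec (M : manifoldType R) (x : M) m (h : M -> 'rV[R]_m) (c : chart R M) :
  atlas M c -> cdom c x -> (forall j, smooth_at x (fun y => h y 0 j)) ->
  exists V, [/\ open V, V (cmap c x) & smooth_on V (h \o cinv c)].
Proof.
move=> ac cx hS.
have hU j : \forall z \near cmap c x, exists U, [/\ open U, U z & smooth_on U ((fun y => h y 0 j) \o cinv c)].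
  have [U [oU Ux _ US]] := smooth_at_chart ac cx (hS j).
  have hz : \forall z \near cmap c x, U z by exact: open_nbhs_nbhs.
  by apply: filterS hz => z Uz; exists U.
have /near_open[V [oV Vx VP]] := @filter_forall _ _ _ (nbhs (cmap c x)) (nbhs_filter (cmap c x)) hU.
exists V; split=> // k.
apply/(Ck_coordP k _ oV) => j; apply: Ck_local => z Vz.
by have [U [oU Uz US]] := VP z Vz j; exists U => //; exact: US.
Qed.

Lemma smooth_at_Ck_comp (M : manifoldType R) (x : M) m (h : M -> 'rV[R]_m) (g : 'rV[R]_m -> R)
    (B : set 'rV[R]_m) :
  (forall j, smooth_at x (fun y => h y 0 j)) -> open B -> B (h x) -> smooth_on B g ->
  smooth_at x (g \o h).
Proof.
move=> hS oB Bx gS; have [c ac cx] := atlas_cover x.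
have [V [oV Vx hC]] := smooth_at_vec ac cx hS.
have oW := open_preimage_within oV oB (hC 0%N).
exists c; split=> //; exists (V `&` (h \o cinv c) @^-1` B); split; first exact: oW.
  by split; [exact: Vx|rewrite /preimage /= cmapK].
move=> k; have WV : V `&` (h \o cinv c) @^-1` B `<=` V by move=> y [].
exact: (Ck_comp (f := h \o cinv c) oW (fun y Wy => Wy.2) (Ck_sub WV (hC k)) (gS k)).
Qed.

Lemma smooth_at_coord (M : manifoldType R) (x : M) (c : chart R M) j :
  atlas M c -> cdom c x -> smooth_at x (fun y => cmap c y 0 j).
Proof.
move=> ac cx; exists c; split=> //; exists (cmap c @` cdom c); split.
- exact: cimg_open.
- by exists x.
move=> k; apply: Ck_ext (@Ck_coord R _ _ k j); first exact: cimg_open.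
by move=> _ [y cy <-] /=; rewrite cmapK.
Qed.

Lemma smooth_at_cst (M : manifoldType R) (x : M) (a : R) : smooth_at x (fun _ => a).
Proof.
have [c ac cx] := atlas_cover x; exists c; split=> //; exists setT; split=> //; first exact: openT.
by move=> k; exact: Ck_cst.
Qed.

(** The pair (f, g) is a map to R^2, which reduces sums and products of germs to the calculus of P
    there. *)
Lemma smooth_at2 (M : manifoldType R) (x : M) (f g : M -> R) (P : R -> R -> R) :
  smooth_on setT (fun z : 'rV[R]_2 => P (z 0 0) (z 0 1)) ->
  smooth_at x f -> smooth_at x g -> smooth_at x (fun y => P (f y) (g y)).
Proof.
move=> PS fS gS.
pose h y : 'rV[R]_2 := \row_j (if j == 0 then f y else g y).
have := @smooth_at_Ck_comp _ x 2 h _ setT _ openT I PS.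
rewrite (_ : _ \o h = (fun y => P (f y) (g y))); last by apply/funext => y; rewrite /= !mxE.
apply=> j; rewrite (_ : (fun y => _) = fun y => if j == 0 then f y else g y).
  by case: (j == 0).
by apply/funext => y; rewrite mxE.
Qed.

Lemma smooth_atD (M : manifoldType R) (x : M) f g : smooth_at x f -> smooth_at x g -> smooth_at x (fun y => f y + g y).
Proof.
by apply: (@smooth_at2 _ _ _ _ (fun a b => a + b)) => k; apply: CkD; [exact: openT|exact: Ck_coord|exact: Ck_coord].
Qed.

Lemma smooth_atM (M : manifoldType R) (x : M) f g : smooth_at x f -> smooth_at x g -> smooth_at x (fun y => f y * g y).
Proof.
by apply: (@smooth_at2 _ _ _ _ (fun a b => a * b)) => k; apply: CkM; [exact: openT|exact: Ck_coord|exact: Ck_coord].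
Qed.

Lemma smooth_at_sum (M : manifoldType R) (x : M) I (r : seq I) (f : I -> M -> R) :
  (forall i, smooth_at x (f i)) -> smooth_at x (fun y => \sum_(i <- r) f i y).
Proof.
move=> fS; elim: r => [|i r IH].
  by rewrite (_ : (fun y => _) = fun _ => 0); [exact: smooth_at_cst|apply/funext => y; rewrite big_nil].
rewrite (_ : (fun y => _) = fun y => f i y + \sum_(i <- r) f i y); first exact: smooth_atD.
by apply/funext => y; rewrite big_cons.
Qed.

(** A formulation free of charts, by pullback of smooth germs, for which compositions are immediate;
    [smooth_mapP] relates it to the definition with charts. *)
Definition smooth_map_at (M N : manifoldType R) (x : M) (F : M -> N) : Prop :=
  {for x, continuous F} /\ forall g, smooth_at (F x) g -> smooth_at x (g \o F).

Lemma smooth_map_at_chart (M N : manifoldType R) (x : M) (F : M -> N) (d : chart R N) :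
  {for x, continuous F} -> atlas N d -> cdom d (F x) ->
  (forall j, smooth_at x (fun y => cmap d (F y) 0 j)) -> smooth_map_at x F.
Proof.
move=> Fc ad dF FS; split=> // g gS.
have [U [oU Ux _ US]] := smooth_at_chart ad dF gS.
have := smooth_at_Ck_comp (h := cmap d \o F) FS oU Ux US.
apply: smooth_at_ext.
have h : \forall y \near x, cdom d (F y).
  by apply: Fc; apply: open_nbhs_nbhs; split=> //; exact: cdom_open.
by apply: filterS h => y dy /=; rewrite cmapK.
Qed.

Lemma smooth_map_at_comp (M N P : manifoldType R) (x : M) (F : M -> N) (G : N -> P) :
  smooth_map_at x F -> smooth_map_at (F x) G -> smooth_map_at x (G \o F).
Proof.
move=> [Fc FS] [Gc GS]; split; first exact: continuous_comp.
by move=> g /GS/FS.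
Qed.

Lemma smooth_map_at_ext (M N : manifoldType R) (x : M) (F G : M -> N) :
  (\forall y \near x, F y = G y) -> smooth_map_at x F -> smooth_map_at x G.
Proof.
move=> FG [Fc FS]; have Fx := nbhs_singleton FG; split.
  move=> A; rewrite /= -Fx => /Fc h.
  suff H : \forall y \near x, A (G y) by exact: H.
  have h' : \forall y \near x, A (F y) by exact: h.
  by apply: filterS2 FG h' => y ->.
move=> g; rewrite -Fx => /FS; apply: smooth_at_ext.
by apply: filterS FG => y /= ->.
Qed.

Lemma smooth_mapP (M N : manifoldType R) (F : M -> N) : smooth_map F <-> forall x, smooth_map_at x F.
Proof.
split=> [[Fc FS] x|FS].
  have [d ad dF] := atlas_cover (F x); have [c ac cx] := atlas_cover x.
  apply: (smooth_map_at_chart (Fc x) ad dF) => j.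
  have oU : open (cmap c @` (cdom c `&` F @^-1` cdom d)).
    by apply: cmap_open_img; apply: open_comp; [move=> ? _; exact: Fc|exact: cdom_open].
  exists c; split=> //; exists (cmap c @` (cdom c `&` F @^-1` cdom d)); split=> //; first by exists x.
  move=> k; exact: ((Ck_coordP k _ oU).1 (FS c d ac ad k) j).
split=> [x|c d ac ad k]; first by case: (FS x).
have oU : open (cmap c @` (cdom c `&` F @^-1` cdom d)).
  by apply: cmap_open_img; apply: open_comp; [move=> x _; case: (FS x)|exact: cdom_open].
apply/(Ck_coordP k _ oU) => j; apply: Ck_local => _ [x [cx dx] <-].
have [_ /(_ _ (smooth_at_coord j ad dx))] := FS x.
by case/(smooth_at_chart ac cx) => U [_ Ux _ /(_ k)]; exists U.
Qed.

Lemma smooth_map_at_cst (M N : manifoldType R) (x : M) (y : N) : smooth_map_at x (fun _ => y).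
Proof. by split; [exact: cst_continuous|move=> g _; exact: smooth_at_cst]. Qed.

Lemma smooth_map_at_id (M : manifoldType R) (x : M) : smooth_map_at x id.
Proof. by split; [exact: cvg_id|]. Qed.

Lemma prod_atlas (M N : manifoldType R) (c : chart R M) (d : chart R N) :
  atlas M c -> atlas N d -> atlas (M * N)%type (prod_chart c d).
Proof. by move=> ac ad; exists c => //; exists d. Qed.

Lemma smooth_map_at_pair (L M N : manifoldType R) (z : L) (F : L -> M) (G : L -> N) :
  smooth_map_at z F -> smooth_map_at z G -> smooth_map_at z (fun y => (F y, G y) : M * N).
Proof.
move=> [Fc FS] [Gc GS]; have [c ac cF] := atlas_cover (F z); have [d ad dG] := atlas_cover (G z).
apply: (smooth_map_at_chart (d := prod_chart c d)).
- exact: (cvg_pair Fc Gc).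
- exact: prod_atlas.
- by split.
move=> j /=; case: (splitP j) => [i ij|i ij].
  have := FS _ (smooth_at_coord i ac cF); rewrite (_ : _ \o F = fun y => row_mx (cmap c (F y)) (cmap d (G y)) 0 j)//.
  by apply/funext => y /=; rewrite mxE; case: splitP => k; rewrite ij => h;
    [congr (_ _ _); apply/val_inj|move: (ltn_ord i); rewrite h ltnNge leq_addr].
have := GS _ (smooth_at_coord i ad dG); rewrite (_ : _ \o G = fun y => row_mx (cmap c (F y)) (cmap d (G y)) 0 j)//.
apply/funext => y /=; rewrite mxE; case: splitP => k; rewrite ij => h.
  by move: (ltn_ord k); rewrite -h ltnNge leq_addr.
by congr (_ _ _); apply/val_inj; move/addnI: h.
Qed.

Lemma smooth_map_at_fst (M N : manifoldType R) (p : M * N) : smooth_map_at p (fst : M * N -> M).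
Proof.
have [c ac cx] := atlas_cover p.1; have [d ad dx] := atlas_cover p.2.
apply: (smooth_map_at_chart (d := c)) => //; first exact: cvg_fst.
move=> j; have := @smooth_at_coord (M * N)%type p (prod_chart c d) (lshift _ j) (prod_atlas ac ad) (conj cx dx).
by rewrite (_ : (fun y => _) = fun y : M * N => cmap c y.1 0 j)//; apply/funext => y; rewrite /= row_mxEl.
Qed.

Lemma smooth_map_at_snd (M N : manifoldType R) (p : M * N) : smooth_map_at p (snd : M * N -> N).
Proof.
have [c ac cx] := atlas_cover p.1; have [d ad dx] := atlas_cover p.2.
apply: (smooth_map_at_chart (d := d)) => //; first exact: cvg_snd.
move=> j; have := @smooth_at_coord (M * N)%type p (prod_chart c d) (rshift _ j) (prod_atlas ac ad) (conj cx dx).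
by rewrite (_ : (fun y => _) = fun y : M * N => cmap d y.2 0 j)//; apply/funext => y; rewrite /= row_mxEr.
Qed.

(** The last clause says that the support of psi lies where P holds, in the form of the case
    distinction that is made when psi multiplies a function controlled only on P. *)
Lemma bump_exists (M : manifoldType R) (x : M) (P : M -> Prop) : (\forall y \near x, P y) ->
  exists psi : M -> R, [/\ Cinf psi, \forall y \near x, psi y = 1 &
    forall y, P y \/ \forall z \near y, psi z = 0].
Proof.
move=> hP; have [c ac cx] := atlas_cover x; set a := cmap c x.
have /nbhs_ballP[r0 /= r00 rB] : \forall z \near a, (cmap c @` cdom c) z /\ P (cinv c z).
  exact: filterI (near_cimg cx) ((near_chart _ cx).1 hP).
(* The bump vanishes beyond 2 r, and the closed ball of that radius has to fit into the open one of
   radius r0. *)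
pose r := r0 / 4; have r_gt0 : 0 < r by rewrite divr_gt0.
have [b [bS b1 b0]] := rV_bump a r_gt0.
pose K : set 'rV[R]_(cdim c) := [set z | `|z - a| <= 2 * r].
have KB z : K z -> (cmap c @` cdom c) z /\ P (cinv c z).
  by move=> Kz; apply: rB; rewrite -ball_normE /= distrC; apply: le_lt_trans Kz _; rewrite /r; lra.
have Kc : compact K.
  apply: bounded_closed_compact.
    exists (2 * r + `|a|); split; first exact: num_real.
    move=> B hB z Kz; apply: ltW; apply: le_lt_trans hB.
    by rewrite -[z in leLHS](subrK a); apply: le_trans (ler_normD _ _) _; rewrite lerD2r.
  have -> : K = (fun z : 'rV[R]_(cdim c) => `|z - a|) @^-1` [set t | t <= 2 * r] by [].
  apply: closed_comp; last exact: closed_le.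
  move=> z _; apply: (@continuous_comp _ _ _ (fun z : 'rV[R]_(cdim c) => z - a) (fun z : 'rV[R]_(cdim c) => `|z|)).
    by apply: continuousB; [exact: cvg_id|exact: cst_continuous].
  exact: norm_continuous.
(* Here the Hausdorff condition enters: the compact image of K is closed, so the extension by 0
   vanishes near every point outside it. *)
have K'c : closed (cinv c @` K).
  apply: compact_closed; first exact: mfd_hausdorff.
  apply: continuous_compact => //; apply: continuous_in_subspaceT => z; rewrite inE => /KB[zi _].
  exact: cinv_cont.
pose psi y := if `[< cdom c y >] then b (cmap c y) else 0.
have bx y : cdom c y -> smooth_at y psi.
  move=> cy; have h : \forall z \near y, cdom c z by apply: open_nbhs_nbhs; split=> //; exact: cdom_open.
  have := smooth_at_Ck_comp (h := cmap c) (fun j => smooth_at_coord j ac cy) openT I bS.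
  by apply: smooth_at_ext; apply: filterS h => z cz /=; rewrite /psi asboolT.
have K'0 y : ~ (cinv c @` K) y -> psi y = 0.
  move=> nK; rewrite /psi; case: asboolP => // cy; apply/eqP; apply: contra_notT nK => /b0 h.
  by exists (cmap c y) => //; rewrite cmapK.
have far y : ~ (cinv c @` K) y -> \forall z \near y, psi z = 0.
  move=> nK; have h : \forall z \near y, (~` (cinv c @` K)) z.
    by apply: open_nbhs_nbhs; split=> //; exact: closed_openC.
  by apply: filterS h => z; exact: K'0.
exists psi; split.
- apply/CinfP => y; case: (pselect ((cinv c @` K) y)) => [[z Kz <-]|/far h].
    by have [[u cu uz] _] := KB z Kz; apply: bx; rewrite -uz cmapK.
  by apply: smooth_at_ext (smooth_at_cst y 0); apply: filterS h => z ->.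
- have h1 : \forall y \near x, cdom c y by apply: open_nbhs_nbhs; split=> //; exact: cdom_open.
  have h2 : \forall y \near x, `|cmap c y - a| <= r.
    have : \forall z \near a, `|z - a| <= r.
      by apply/nbhs_ballP; exists r => //= z; rewrite -ball_normE /= distrC => /ltW.
    exact: (cmap_cont cx).
  by apply: filterS2 h1 h2 => y cy yr; rewrite /psi asboolT// b1.
- move=> y; case: (pselect ((cinv c @` K) y)) => [[z Kz <-]|/far]; last by right.
  by left; case: (KB z Kz).
Qed.

(** Derivations act on global functions only; this makes germs, such as chart coordinates,
    accessible to them. *)
Lemma smooth_at_extension (M : manifoldType R) (x : M) f : smooth_at x f ->
  exists2 F, Cinf F & \forall y \near x, F y = f y.
Proof.
move=> /smooth_at_near/bump_exists[psi [psiS psi1 psi0]].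
exists (fun y => psi y * f y).
  apply/CinfP => y; case: (psi0 y) => [fy|h]; first by apply: smooth_atM => //; exact: ((CinfP psi).1 psiS).
  by apply: smooth_at_ext (smooth_at_cst y 0); apply: filterS h => z ->; rewrite mul0r.
by apply: filterS psi1 => y ->; rewrite mul1r.
Qed.

End LocalSmoothness.

(** * Tangent vectors in charts *)

Section TangentVectors.
Context {R : realType}.

Lemma CinfD (M : manifoldType R) (f g : M -> R) : Cinf f -> Cinf g -> Cinf (fun y => f y + g y).
Proof. by move=> /CinfP fS /CinfP gS; apply/CinfP => x; exact: smooth_atD. Qed.

Lemma CinfM (M : manifoldType R) (f g : M -> R) : Cinf f -> Cinf g -> Cinf (fun y => f y * g y).
Proof. by move=> /CinfP fS /CinfP gS; apply/CinfP => x; exact: smooth_atM. Qed.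

Lemma Cinf_cst (M : manifoldType R) (a : R) : Cinf (fun _ : M => a).
Proof. by apply/CinfP => x; exact: smooth_at_cst. Qed.

Lemma Cinf_lincomb (M : manifoldType R) a (f g : M -> R) :
  Cinf f -> Cinf g -> Cinf (fun y => a * f y + g y).
Proof. by move=> fS gS; apply: CinfD => //; apply: CinfM => //; exact: Cinf_cst. Qed.

Lemma Cinf_comp (M N : manifoldType R) (F : M -> N) f : smooth_map F -> Cinf f -> Cinf (f \o F).
Proof. by move=> /smooth_mapP FS /CinfP fS; apply/CinfP => x; exact: (FS x).2. Qed.

Lemma on_CinfE (M : manifoldType R) (v : functional M) f : Cinf f -> on_Cinf v f = v f.
Proof. by move=> fS; rewrite /on_Cinf asboolT. Qed.

Lemma pushforwardE (M N : manifoldType R) (F : M -> N) v u : Cinf u -> pushforward F v u = v (u \o F).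
Proof. exact: on_CinfE. Qed.

Lemma functional_eq (M : manifoldType R) (v w : functional M) :
  (forall f, ~ Cinf f -> v f = 0) -> (forall f, ~ Cinf f -> w f = 0) ->
  (forall f, Cinf f -> v f = w f) -> v = w.
Proof.
move=> v0 w0 vw; apply/funext => f; case: (pselect (Cinf f)) => [/vw//|nf].
by rewrite v0// w0.
Qed.

Lemma on_Cinf0 (M : manifoldType R) (v : functional M) f : ~ Cinf f -> on_Cinf v f = 0.
Proof. by move=> nf; rewrite /on_Cinf asboolF. Qed.

Lemma tangent_eq (M : manifoldType R) (x : M) (v w : functional M) :
  tangent x v -> tangent x w -> (forall f, Cinf f -> v f = w f) -> v = w.
Proof. by move=> [v0 _ _] [w0 _ _]; exact: functional_eq. Qed.

Lemma tangent0 (M : manifoldType R) (x : M) : tangent x (fun _ : M -> R => 0).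
Proof. by split=> [//|a f g _ _|f g _ _]; rewrite !mulr0 addr0. Qed.

Lemma tangent_lincomb (M : manifoldType R) (x : M) a (v w : functional M) :
  tangent x v -> tangent x w -> tangent x (fun f => a * v f + w f).
Proof.
move=> [v0 vl vm] [w0 wl wm]; split=> [f nf|b f g fS gS|f g fS gS].
- by rewrite v0// w0// mulr0 addr0.
- by rewrite vl// wl//; ring.
- by rewrite vm// wm//; ring.
Qed.

Lemma tangent_pushforward (M N : manifoldType R) (F : M -> N) (x : M) v :
  smooth_map F -> tangent x v -> tangent (F x) (pushforward F v).
Proof.
move=> FS [v0 vl vm]; split=> [f nf|b f g fS gS|f g fS gS].
- exact: on_Cinf0.
- rewrite !pushforwardE//; last exact: Cinf_lincomb.
  by rewrite -vl; [|exact: Cinf_comp|exact: Cinf_comp].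
- rewrite !pushforwardE//; last exact: CinfM.
  by rewrite -vm; [|exact: Cinf_comp|exact: Cinf_comp].
Qed.

Section AtPoint.
Variables (M : manifoldType R) (x : M) (v : functional M).
Hypothesis vT : tangent x v.

Lemma tangentD f g : Cinf f -> Cinf g -> v (fun y => f y + g y) = v f + v g.
Proof.
case: vT => _ vl _ fS gS; have := vl 1 f g fS gS; rewrite mul1r => <-.
by congr v; apply/funext => y; rewrite mul1r.
Qed.

Lemma tangent_of0 : v (fun _ => 0) = 0.
Proof.
have := tangentD (@Cinf_cst M 0) (@Cinf_cst M 0).
rewrite (_ : (fun _ => 0 + 0) = (fun _ => 0)); last by apply/funext => y; rewrite addr0.
by move=> h; apply: (addrI (v (fun _ => 0))); rewrite -h addr0.
Qed.

Lemma tangentZ a f : Cinf f -> v (fun y => a * f y) = a * v f.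
Proof.
case: vT => _ vl _ fS; have := vl a f _ fS (@Cinf_cst M 0); rewrite tangent_of0 addr0 => <-.
by congr v; apply/funext => y; rewrite addr0.
Qed.

Lemma tangentM f g : Cinf f -> Cinf g -> v (fun y => f y * g y) = f x * v g + g x * v f.
Proof. by case: vT => _ _ vm fS gS; exact: vm. Qed.

Lemma tangent_of_cst a : v (fun _ => a) = 0.
Proof.
have v1 : v (fun _ => 1) = 0.
  have := tangentM (@Cinf_cst M 1) (@Cinf_cst M 1).
  rewrite (_ : (fun _ => 1 * 1) = (fun _ => 1)); last by apply/funext => y; rewrite mulr1.
  by rewrite mul1r => h; apply: (addrI (v (fun _ => 1))); rewrite -h addr0.
have := tangentZ a (@Cinf_cst M 1); rewrite v1 mulr0 => <-.
by congr v; apply/funext => y; rewrite mulr1.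
Qed.

Lemma tangent_sum I (r : seq I) (f : I -> M -> R) : (forall i, Cinf (f i)) ->
  v (fun y => \sum_(i <- r) f i y) = \sum_(i <- r) v (f i).
Proof.
move=> fS; elim: r => [|i r IH].
  by rewrite big_nil -[RHS]tangent_of0; congr v; apply/funext => y; rewrite big_nil.
rewrite big_cons -IH -tangentD//; last first.
  by apply/CinfP => y; apply: smooth_at_sum => j; exact: ((CinfP _).1 (fS j)).
by congr v; apply/funext => y; rewrite big_cons.
Qed.

(** Locality of derivations: a bump psi supported where f = g satisfies psi (f - g) = 0, and the
    product rule at x, where psi = 1 and f - g = 0, leaves v (f - g) = 0. *)
Lemma tangent_near f g : Cinf f -> Cinf g -> (\forall y \near x, f y = g y) -> v f = v g.
Proof.
move=> fS gS fg; pose h y := (-1) * g y + f y.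
have hS : Cinf h by exact: Cinf_lincomb.
have [psi [psiS psi1 psi0]] := bump_exists fg.
have z : (fun y => psi y * h y) = (fun _ => 0).
  apply/funext => y; rewrite /h; case: (psi0 y) => [->|/nbhs_singleton ->]; last by rewrite mul0r.
  by rewrite mulN1r addNr mulr0.
have := tangentM psiS hS; rewrite z tangent_of0 (nbhs_singleton psi1) mul1r.
rewrite {2}/h (nbhs_singleton fg) mulN1r addNr mul0r addr0.
case: vT => _ vl _; rewrite /h vl// => e.
by apply/eqP; rewrite -subr_eq0 addrC -mulN1r -e.
Qed.

End AtPoint.

Definition dvec (M : manifoldType R) (c : chart R M) (x : M) (w : 'rV[R]_(cdim c)) : functional M :=
  on_Cinf (fun f => 'D_w (f \o cinv c) (cmap c x)).

Arguments dvec {M} c x w _.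

Lemma smooth_at_differentiable (M : manifoldType R) (x : M) f (c : chart R M) :
  atlas M c -> cdom c x -> smooth_at x f -> differentiable (f \o cinv c) (cmap c x).
Proof.
by move=> ac cx /(smooth_at_chart ac cx)[U [_ Ux _ /(_ 1%N)[fd _]]]; exact: fd.
Qed.

Lemma tangent_dvec (M : manifoldType R) (c : chart R M) (x : M) w :
  atlas M c -> cdom c x -> tangent x (dvec c x w).
Proof.
move=> ac cx; split=> [f nf|b f g fS gS|f g fS gS].
- exact: on_Cinf0.
- have fd : derivable (f \o cinv c) (cmap c x) w.
    by apply: diff_derivable; apply: smooth_at_differentiable ac cx ((CinfP _).1 fS x).
  have gd : derivable (g \o cinv c) (cmap c x) w.
    by apply: diff_derivable; apply: smooth_at_differentiable ac cx ((CinfP _).1 gS x).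
  rewrite /dvec !on_CinfE//; last exact: Cinf_lincomb.
  have bfd : derivable (b \*: (f \o cinv c)) (cmap c x) w by exact: derivableZ.
  have -> : (fun y => b * f y + g y) \o cinv c = (b \*: (f \o cinv c)) \+ (g \o cinv c) by [].
  by rewrite (deriveD bfd gd) (deriveZ b fd).
- have fd : derivable (f \o cinv c) (cmap c x) w.
    by apply: diff_derivable; apply: smooth_at_differentiable ac cx ((CinfP _).1 fS x).
  have gd : derivable (g \o cinv c) (cmap c x) w.
    by apply: diff_derivable; apply: smooth_at_differentiable ac cx ((CinfP _).1 gS x).
  rewrite /dvec !on_CinfE//; last exact: CinfM.
  have -> : (fun y => f y * g y) \o cinv c = (f \o cinv c) * (g \o cinv c) by [].
  by rewrite (deriveM fd gd) /= cmapK.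
Qed.

(** Hadamard's lemma writes f near x as f x + sum X_i G_i, with coordinates and coefficients
    extended to global functions, and the product rule at X_i = 0 leaves v(X_i) G_i(x). The numbers
    G are the same for all v, so a tangent vector is determined by its values on the X_i. *)
Lemma chart_factor (M : manifoldType R) (c : chart R M) (x : M) : atlas M c -> cdom c x ->
  exists X : 'I_(cdim c) -> M -> R, [/\ forall i, Cinf (X i),
    forall i, \forall y \near x, X i y = cmap c y 0 i - cmap c x 0 i &
    forall f, Cinf f -> exists G : 'I_(cdim c) -> R,
      forall v, tangent x v -> v f = \sum_i v (X i) * G i].
Proof.
move=> ac cx; set a := cmap c x.
have XS i : smooth_at x (fun y => cmap c y 0 i - a 0 i).
  by apply: smooth_atD; [exact: smooth_at_coord|exact: smooth_at_cst].
pose X i := s2val (cid2 (smooth_at_extension (XS i))).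
have X1 i : Cinf (X i) by rewrite /X; case: cid2.
have X2 i : \forall y \near x, X i y = cmap c y 0 i - a 0 i by rewrite /X; case: cid2.
exists X; split=> // f fS.
have [U [oU Ux UI US]] := smooth_at_chart ac cx ((CinfP _).1 fS x).
have /nbhs_ballP[r /= r0 rU] : nbhs a U by exact: open_nbhs_nbhs.
have [g gS fE] := hadamard r0 (fun k => Ck_sub rU (US k)).
have GS i : smooth_at x (g i \o cmap c).
  apply: (smooth_at_Ck_comp (B := ball a r)) => //; [|exact: ball_open|exact: ballxx].
  by move=> j; exact: smooth_at_coord.
pose G i := s2val (cid2 (smooth_at_extension (GS i))).
have G1 i : Cinf (G i) by rewrite /G; case: cid2.
have G2 i : \forall y \near x, G i y = g i (cmap c y) by rewrite /G; case: cid2.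
exists (fun i => g i a) => v vT.
have XGS i : Cinf (fun y => X i y * G i y) by exact: CinfM.
have SS : Cinf (fun y => \sum_i X i y * G i y).
  by apply/CinfP => y; apply: smooth_at_sum => j; exact: ((CinfP _).1 (XGS j)).
have fN : \forall y \near x, f y = f x + \sum_i X i y * G i y.
  have h1 : \forall y \near x, cdom c y by apply: open_nbhs_nbhs; split=> //; exact: cdom_open.
  have h2 : \forall y \near x, ball a r (cmap c y).
    by apply: (cmap_cont cx); exact: nbhsx_ballx.
  have h3 : \forall y \near x, forall i, X i y = cmap c y 0 i - a 0 i /\ G i y = g i (cmap c y).
    apply: (@filter_forall _ _ _ (nbhs x) (nbhs_filter x)) => i.
    by apply: filterS2 (X2 i) (G2 i).
  apply: filterS3 h1 h2 h3 => y cy yr h.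
  have := fE _ yr; rewrite /= cmapK// cmapK// => ->; congr (_ + _).
  by apply: eq_bigr => i _; have [-> ->] := h i.
have cS := @Cinf_cst M (f x).
rewrite (tangent_near vT fS (CinfD cS SS) fN) (tangentD vT cS SS) (tangent_of_cst vT) add0r.
rewrite (tangent_sum vT)//; apply: eq_bigr => i _.
rewrite (tangentM vT)// (nbhs_singleton (X2 i)) subrr mul0r add0r mulrC.
by rewrite (nbhs_singleton (G2 i)).
Qed.

Lemma derive_proj n (x w : 'rV[R]_n) i : 'D_w (fun z : 'rV[R]_n => z 0 i : R) x = w 0 i.
Proof.
have Llin : linear (fun u : 'rV[R]_n => u 0 i : R) by move=> a u v; rewrite !mxE.
pose LM := GRing.isLinear.Build _ _ _ _ _ Llin.
pose L : {linear 'rV[R]_n -> R} := HB.pack (fun u : 'rV[R]_n => u 0 i : R) LM.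
have Lc : continuous L by exact: linear_continuous_rV.
have Ld : differentiable L x by exact: linear_differentiable.
have h := deriveE w Ld; rewrite (diff_lin _ Lc) in h; exact: h.
Qed.

Lemma dvec_coord (M : manifoldType R) (c : chart R M) (x : M) w i (X : M -> R) :
  atlas M c -> cdom c x -> Cinf X ->
  (\forall y \near x, X y = cmap c y 0 i - cmap c x 0 i) -> dvec c x w X = w 0 i.
Proof.
move=> ac cx XS XE; rewrite /dvec on_CinfE//.
pose L (z : 'rV[R]_(cdim c)) : R := z 0 i.
have Ld z : differentiable L z by exact: differentiable_coord.
have e : \forall z \near cmap c x, (L \+ cst (- cmap c x 0 i)) z = (X \o cinv c) z.
  have h := (near_chart _ cx).1 XE; have h' := near_cimg cx.
  by apply: filterS2 h' h => _ [y cy <-] /= ->; rewrite cmapK.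
rewrite -(near_eq_derive w e) deriveD; [|exact: diff_derivable|exact: derivable_cst].
rewrite derive_cst addr0.
exact: derive_proj.
Qed.

Lemma tangent_dvecP (M : manifoldType R) (c : chart R M) (x : M) v :
  atlas M c -> cdom c x -> tangent x v -> exists w, v = dvec c x w.
Proof.
move=> ac cx vT; have [X [XS XE Xf]] := chart_factor ac cx.
exists (\row_i v (X i)); apply: (tangent_eq vT); first exact: tangent_dvec.
move=> f /Xf[G GE]; rewrite (GE _ vT) (GE _ (tangent_dvec _ ac cx)).
by apply: eq_bigr => i _; rewrite (dvec_coord _ ac cx (XS i) (XE i)) mxE.
Qed.

Lemma dvec_inj (M : manifoldType R) (c : chart R M) (x : M) :
  atlas M c -> cdom c x -> injective (dvec c x).
Proof.
move=> ac cx w w' ww'; have [X [XS XE _]] := chart_factor ac cx.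
apply/rowP => i; rewrite -(dvec_coord w ac cx (XS i) (XE i)).
by rewrite -(dvec_coord w' ac cx (XS i) (XE i)) ww'.
Qed.

Lemma smooth_map_at_vec (M N : manifoldType R) (F : M -> N) (x : M) (c : chart R M) (d : chart R N) :
  atlas M c -> cdom c x -> atlas N d -> cdom d (F x) -> smooth_map_at x F ->
  exists V, [/\ open V, V (cmap c x) & smooth_on V (cmap d \o F \o cinv c)].
Proof.
move=> ac cx ad dF [_ FS]; apply: (smooth_at_vec ac cx) => j.
exact: FS (smooth_at_coord j ad dF).
Qed.

Lemma derive_smap (M N : manifoldType R) (F : M -> N) (x : M) (c : chart R M) (d : chart R N) f w :
  atlas M c -> cdom c x -> atlas N d -> cdom d (F x) -> smooth_map_at x F -> smooth_at (F x) f ->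
  'D_w (f \o F \o cinv c) (cmap c x) =
  'D_('D_w (cmap d \o F \o cinv c) (cmap c x)) (f \o cinv d) (cmap d (F x)).
Proof.
move=> ac cx ad dF FS fS; have [V [oV Vx VS]] := smooth_map_at_vec ac cx ad dF FS.
set T := cmap d \o F \o cinv c; have Td : differentiable T (cmap c x).
  by case: (VS 1%N) => h _; exact: h.
have Tx : T (cmap c x) = cmap d (F x) by rewrite /T /= cmapK.
have fd : differentiable (f \o cinv d) (T (cmap c x)).
  by rewrite Tx; exact: smooth_at_differentiable.
rewrite -Tx -(derive_chain w Td fd); apply: near_eq_derive.
have h : \forall y \near x, cdom d (F y).
  by apply: FS.1; apply: open_nbhs_nbhs; split=> //; exact: cdom_open.
have h' := (near_chart _ cx).1 h.
by apply: filterS h' => z dz; rewrite /T /= cmapK.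
Qed.

Lemma pushforward_dvec (M N : manifoldType R) (F : M -> N) (x : M) (c : chart R M) (d : chart R N) w :
  atlas M c -> cdom c x -> atlas N d -> cdom d (F x) -> smooth_map F ->
  pushforward F (dvec c x w) = dvec d (F x) ('D_w (cmap d \o F \o cinv c) (cmap c x)).
Proof.
move=> ac cx ad dF FS; apply: functional_eq => [f nf|f nf|f fS]; [exact: on_Cinf0|exact: on_Cinf0|].
rewrite pushforwardE// /dvec !on_CinfE//; last exact: Cinf_comp.
apply: derive_smap => //; first exact: ((smooth_mapP F).1 FS).
exact: ((CinfP f).1 fS).
Qed.

End TangentVectors.
Arguments dvec {R M} c x w _.

(** * Derivations in one variable of a function on a product *)

Section ProductTangent.
Context {R : realType}.

Lemma smooth_slicer (M N : manifoldType R) (x : M) : smooth_map (fun y : N => (x, y)).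
Proof. by apply/smooth_mapP => y; apply: smooth_map_at_pair; [exact: smooth_map_at_cst|exact: smooth_map_at_id]. Qed.

Lemma smooth_slicel (M N : manifoldType R) (y : N) : smooth_map (fun x : M => (x, y)).
Proof. by apply/smooth_mapP => x; apply: smooth_map_at_pair; [exact: smooth_map_at_id|exact: smooth_map_at_cst]. Qed.

Lemma smooth_diag (M : manifoldType R) : smooth_map (fun x : M => (x, x)).
Proof. by apply/smooth_mapP => x; apply: smooth_map_at_pair; exact: smooth_map_at_id. Qed.

Lemma Cinf_slicer (M N : manifoldType R) (K : M * N -> R) x : Cinf K -> Cinf (fun y => K (x, y)).
Proof. exact: (Cinf_comp (smooth_slicer N x)). Qed.

Lemma Cinf_slicel (M N : manifoldType R) (K : M * N -> R) y : Cinf K -> Cinf (fun x => K (x, y)).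
Proof. exact: (Cinf_comp (smooth_slicel M y)). Qed.

Lemma Cinf_diag (M : manifoldType R) (K : M * M -> R) : Cinf K -> Cinf (fun x => K (x, x)).
Proof. exact: (Cinf_comp (smooth_diag M)). Qed.

(** The two difference quotients coincide term by term, before any limit is taken. *)
Lemma derive_reparam m n (K : 'rV[R]_m -> R) (L : 'rV[R]_n -> 'rV[R]_m) b w (w' : 'rV[R]_m) :
  (forall h : R, L (h *: w + b) = h *: w' + L b) ->
  'D_w (K \o L) b = 'D_w' K (L b).
Proof.
move=> LE; have E : (fun h : R => h^-1 *: (((K \o L) \o shift b) (h *: w) - (K \o L) b))
    = (fun h => h^-1 *: ((K \o shift (L b)) (h *: w') - K (L b))).
  by apply/funext => h /=; rewrite LE.
by rewrite /derive E.
Qed.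

Section Kernel.
Variables (M N : manifoldType R) (K : M * N -> R).
Hypothesis KS : Cinf K.
Variables (c : chart R M) (d : chart R N).
Hypotheses (ac : atlas M c) (ad : atlas N d).

Let k := K \o cinv (prod_chart c d).

Lemma dvec_slicer x y w : cdom c x -> cdom d y ->
  dvec d y w (fun y' => K (x, y')) = 'D_(row_mx 0 w) k (row_mx (cmap c x) (cmap d y)).
Proof.
move=> cx dy; rewrite /dvec on_CinfE; last exact: Cinf_slicer.
have -> : (fun y' => K (x, y')) \o cinv d = k \o (fun z => row_mx (cmap c x) z).
  by apply/funext => z; rewrite /k /= row_mxKl row_mxKr cmapK.
apply: (@derive_reparam _ _ k (fun z => row_mx (cmap c x) z) (cmap d y) w).
by move=> h; rewrite scale_row_mx add_row_mx scaler0 add0r.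
Qed.

Lemma dvec_slicel x y w : cdom c x -> cdom d y ->
  dvec c x w (fun x' => K (x', y)) = 'D_(row_mx w 0) k (row_mx (cmap c x) (cmap d y)).
Proof.
move=> cx dy; rewrite /dvec on_CinfE; last exact: Cinf_slicel.
have -> : (fun x' => K (x', y)) \o cinv c = k \o (fun z => row_mx z (cmap d y)).
  by apply/funext => z; rewrite /k /= row_mxKl row_mxKr cmapK.
apply: (@derive_reparam _ _ k (fun z => row_mx z (cmap d y)) (cmap c x) w).
by move=> h; rewrite scale_row_mx add_row_mx scaler0 add0r.
Qed.

Lemma kernel_smooth x y : cdom c x -> cdom d y ->
  exists U, [/\ open U, U (row_mx (cmap c x) (cmap d y)) & smooth_on U k].
Proof.
move=> cx dy; have [U [oU Ux _ US]] := @smooth_at_chart R (M * N)%type (x, y) K (prod_chart c d)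
  (prod_atlas ac ad) (conj cx dy) ((CinfP K).1 KS (x, y)).
by exists U.
Qed.

End Kernel.

(** In a product chart the value is the derivative of K in the direction (0, w), which depends
    smoothly on the first variable. For K(g, h) = u(g h) this is the smoothness of left-invariant
    vector fields. *)
Lemma tangent_slicer_Cinf (M N : manifoldType R) (K : M * N -> R) y w : Cinf K -> tangent y w ->
  Cinf (fun x => w (fun y' => K (x, y'))).
Proof.
move=> KS wT; apply/CinfP => x.
have [c ac cx] := atlas_cover x; have [d ad dy] := atlas_cover y.
have [w0 ->] := tangent_dvecP ad dy wT.
have [U [oU Ux US]] := kernel_smooth KS ac ad cx dy.
have := @smooth_at_Ck_comp R M x _ (fun x => row_mx (cmap c x) (cmap d y)) ('D_(row_mx 0 w0) (K \o cinv (prod_chart c d))) U _ oU Ux (fun k => (US k.+1).2 (row_mx 0 w0)).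
have h j : smooth_at x (fun x => row_mx (cmap c x) (cmap d y) 0 j).
  rewrite (_ : (fun x => _) = fun x => match fintype.split j with inl i => cmap c x 0 i | inr i => cmap d y 0 i end).
    by case: (fintype.split j) => i; [exact: smooth_at_coord|exact: smooth_at_cst].
  by apply/funext => z; rewrite mxE.
move=> /(_ h); apply: smooth_at_ext.
have hd : \forall y \near x, cdom c y by apply: open_nbhs_nbhs; split=> //; exact: cdom_open.
by apply: filterS hd => x' cx' /=; rewrite (dvec_slicer KS w0 cx' dy).
Qed.

(** The symmetry of second derivatives in a product chart; the inner expressions are smooth by
    [tangent_slicer_Cinf]. *)
Lemma tangent_swap (M N : manifoldType R) (K : M * N -> R) x v y w : Cinf K -> tangent x v -> tangent y w ->
  v (fun x' => w (fun y' => K (x', y'))) = w (fun y' => v (fun x' => K (x', y'))).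
Proof.
move=> KS vT wT.
have S1 := tangent_slicer_Cinf KS wT.
have S2 : Cinf (fun y' => v (fun x' => K (x', y'))).
  have KS' : Cinf (fun p : N * M => K (p.2, p.1)).
    apply: (@Cinf_comp _ _ _ (fun p : N * M => (p.2, p.1))) => //; apply/smooth_mapP => p.
    by apply: smooth_map_at_pair; [exact: smooth_map_at_snd|exact: smooth_map_at_fst].
  exact: tangent_slicer_Cinf KS' vT.
have [c ac cx] := atlas_cover x; have [d ad dy] := atlas_cover y.
have [v0 vE] := tangent_dvecP ac cx vT; have [w0 wE] := tangent_dvecP ad dy wT.
have [U [oU Ux US]] := kernel_smooth KS ac ad cx dy.
set k := K \o cinv (prod_chart c d) in US.
set a := cmap c x in Ux *; set b := cmap d y in Ux *.
have -> : v (fun x' => w (fun y' => K (x', y'))) = 'D_(row_mx v0 0) ('D_(row_mx 0 w0) k) (row_mx a b).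
  rewrite {1}vE /dvec on_CinfE//.
  rewrite -(@derive_reparam _ _ ('D_(row_mx 0 w0) k) (fun z => row_mx z b) a v0); last first.
    by move=> h; rewrite scale_row_mx add_row_mx scaler0 add0r.
  apply: near_eq_derive; have h := near_cimg cx.
  by apply: filterS h => _ [x' cx' <-] /=; rewrite cmapK// wE (dvec_slicer KS w0 cx' dy).
have -> : w (fun y' => v (fun x' => K (x', y'))) = 'D_(row_mx 0 w0) ('D_(row_mx v0 0) k) (row_mx a b).
  rewrite {1}wE /dvec on_CinfE//.
  rewrite -(@derive_reparam _ _ ('D_(row_mx v0 0) k) (fun z => row_mx a z) b w0); last first.
    by move=> h; rewrite scale_row_mx add_row_mx scaler0 add0r.
  apply: near_eq_derive; have h := near_cimg dy.
  by apply: filterS h => _ [y' dy' <-] /=; rewrite cmapK// vE (dvec_slicel KS v0 cx dy').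
exact: schwarz oU Ux (US 2%N).
Qed.

(** In a product chart the diagonal direction (v, v) is the sum of (v, 0) and (0, v). This is the
    form in which the product h h^-1 on a group gets differentiated. *)
Lemma tangent_diag (M : manifoldType R) (K : M * M -> R) x v : Cinf K -> tangent x v ->
  v (fun y => K (y, y)) = v (fun y => K (y, x)) + v (fun y => K (x, y)).
Proof.
move=> KS vT; have [c ac cx] := atlas_cover x; have [v0 ->] := tangent_dvecP ac cx vT.
have [U [oU Ux US]] := kernel_smooth KS ac ac cx cx.
rewrite (dvec_slicel KS v0 cx cx) (dvec_slicer KS v0 cx cx).
set k := K \o cinv (prod_chart c c) in US *; set a := cmap c x in Ux *.
have kd : differentiable k (row_mx a a) by case: (US 1%N) => h _; exact: h.
have -> : 'D_(row_mx v0 0) k (row_mx a a) + 'D_(row_mx 0 v0) k (row_mx a a) = 'D_(row_mx v0 v0) k (row_mx a a).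
  by rewrite !(deriveE _ kd) -linearD add_row_mx addr0 add0r.
rewrite /dvec on_CinfE; last exact: Cinf_diag.
have -> : (fun y => K (y, y)) \o cinv c = k \o (fun z => row_mx z z).
  by apply/funext => z; rewrite /k /= row_mxKl row_mxKr.
apply: (@derive_reparam _ _ k (fun z => row_mx z z) a v0).
by move=> h; rewrite scale_row_mx add_row_mx.
Qed.

End ProductTangent.

(** * Immersions and submersions *)

Section ImmersionsSubmersions.
Context {R : realType}.

Lemma smooth_at_vec_continuous (M : manifoldType R) (x : M) m (h : M -> 'rV[R]_m) :
  (forall j, smooth_at x (fun y => h y 0 j)) -> {for x, continuous h}.
Proof.
move=> hS; have [c ac cx] := atlas_cover x.
have [V [oV Vx VS]] := smooth_at_vec ac cx hS => A hA.
have hA' : nbhs ((h \o cinv c) (cmap c x)) A by rewrite /= cmapK.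
exact: ((near_chart _ cx).2 (VS 0%N _ Vx _ hA')).
Qed.

Lemma smooth_map_at_cinv (M N : manifoldType R) (x : M) (c : chart R N) (G : M -> 'rV[R]_(cdim c)) :
  atlas N c -> (forall j, smooth_at x (fun y => G y 0 j)) -> (cmap c @` cdom c) (G x) ->
  smooth_map_at x (cinv c \o G).
Proof.
move=> ac GS cG; have Gc := smooth_at_vec_continuous GS.
have [z cz zG] := cG.
have cx : cdom c ((cinv c \o G) x) by rewrite /= -zG cmapK.
apply: (smooth_map_at_chart (d := c)) => //.
  by apply: continuous_comp; [exact: Gc|exact: cinv_cont].
move=> j; apply: smooth_at_ext (GS j).
have h : \forall y \near x, (cmap c @` cdom c) (G y).
  by apply: Gc; apply: open_nbhs_nbhs; split=> //; exact: cimg_open.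
by apply: filterS h => y [u cu uG] /=; rewrite -uG cmapK.
Qed.

Lemma smooth_at_affine (M : manifoldType R) (x : M) m n (h : M -> 'rV[R]_m) (A : 'M[R]_(m, n)) (b : 'rV[R]_n) :
  (forall j, smooth_at x (fun y => h y 0 j)) -> forall j, smooth_at x (fun y => (h y *m A + b) 0 j).
Proof.
move=> hS j; rewrite (_ : (fun y => _) = fun y => \sum_k h y 0 k * A k j + b 0 j).
  apply: smooth_atD; last exact: smooth_at_cst.
  by apply: smooth_at_sum => k; apply: smooth_atM => //; exact: smooth_at_cst.
by apply/funext => y; rewrite !mxE.
Qed.

Lemma derive_jacobian m n (f : 'rV[R]_m -> 'rV[R]_n) x : differentiable f x ->
  forall v, 'D_v f x = v *m lin1_mx ('d f x).
Proof. by move=> fd v; rewrite (deriveE _ fd) mul_rV_lin1. Qed.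

Lemma derive_mulmxr m n p (f : 'rV[R]_m -> 'rV[R]_n) (K : 'M[R]_(n, p)) x v : differentiable f x ->
  differentiable (fun z => f z *m K) x /\ 'D_v (fun z => f z *m K) x = 'D_v f x *m K.
Proof.
move=> fd; pose L : {linear 'rV[R]_n -> 'rV[R]_p} := mulmxr K.
have Lc : continuous L by exact: linear_continuous_rV.
have Ld y : differentiable L y by exact: linear_differentiable.
split; first exact: (differentiable_comp fd (Ld _)).
have h := derive_chain v fd (Ld (f x)); rewrite (deriveE _ (Ld _)) (diff_lin _ Lc) in h.
exact: h.
Qed.

Lemma Ck_mulmxr m n p (A : set 'rV[R]_m) k (f : 'rV[R]_m -> 'rV[R]_n) (K : 'M[R]_(n, p)) :
  open A -> Ck A k f -> Ck A k (fun z => f z *m K).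
Proof.
move=> oA fC; pose L : {linear 'rV[R]_n -> 'rV[R]_p} := mulmxr K.
have Lc : continuous L by exact: linear_continuous_rV.
exact: (Ck_lin_comp oA Lc fC).
Qed.

Lemma smooth_map_at_chart_rep (M N : manifoldType R) (F : M -> N) (x : M) (c : chart R M) (d : chart R N) :
  atlas M c -> cdom c x -> atlas N d -> cdom d (F x) -> smooth_map_at x F ->
  exists U, [/\ open U, U (cmap c x), U `<=` cmap c @` cdom c,
    forall z, U z -> cdom d (F (cinv c z)) & smooth_on U (cmap d \o F \o cinv c)].
Proof.
move=> ac cx ad dF FS; have [V [oV Vx VS]] := smooth_map_at_vec ac cx ad dF FS.
have h1 := near_cimg cx.
have h2 : \forall z \near cmap c x, cdom d (F (cinv c z)).
  by apply/(near_chart (fun y => cdom d (F y)) cx); apply: FS.1; apply: open_nbhs_nbhs; split=> //; exact: cdom_open.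
have h3 : \forall z \near cmap c x, V z by exact: open_nbhs_nbhs.
have h : \forall z \near cmap c x, [/\ (cmap c @` cdom c) z, cdom d (F (cinv c z)) & V z].
  by apply: filterS3 h1 h2 h3.
have [U [oU Ux UP]] := near_open h.
exists U; split=> //; [by move=> z /UP[]|by move=> z /UP[]|].
by move=> k; apply: Ck_sub (VS k) => z /UP[].
Qed.

(** For row vectors an injective Jacobian J has a matrix K with J K = 1. The chart representative T
    of i followed by K has identity derivative, and its local inverse, applied after the chart of M
    and K, retracts onto N. *)
Lemma embedding_retraction (N M : manifoldType R) (i : N -> M) (a : N) : embedding i ->
  exists2 kappa : M -> N, smooth_map_at (i a) kappa & \forall b \near a, kappa (i b) = b.
Proof.
move=> [iS _ imm _]; have [c ac ca] := atlas_cover a; have [d ad dia] := atlas_cover (i a).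
have [U [oU Ua UI Ud US]] := smooth_map_at_chart_rep ac ca ad dia ((smooth_mapP i).1 iS a).
set T := cmap d \o i \o cinv c in US; set a0 := cmap c a in Ua.
have Td : differentiable T a0 by case: (US 1%N) => h _; exact: h.
have DT := derive_jacobian Td; set J := lin1_mx _ in DT.
have Jf : row_free J.
  apply: inj_row_free => v vJ.
  apply: (dvec_inj ac ca); apply: (imm a); [exact: tangent_dvec|exact: tangent_dvec|].
  by rewrite !(pushforward_dvec _ ac ca ad dia iS) !DT vJ mul0mx.
have [K JK] := row_freeP Jf.
pose f z := T z *m K.
have fS : smooth_on U f by move=> k; exact: Ck_mulmxr (US k).
have fD v : 'D_v f a0 = v.
  by rewrite (derive_mulmxr K v Td).2 DT -mulmxA JK mulmx1.
have [g [W [oW Wf gS gf [gW gK]]]] := inverse_function oU Ua fS fD.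
have Ta : T a0 = cmap d (i a) by rewrite /T /= cmapK.
have HS j : smooth_at (i a) (fun y => (cmap d y *m K + 0) 0 j).
  by apply: (smooth_at_affine K 0 _ j) => k; exact: smooth_at_coord.
have Ha : cmap d (i a) *m K + 0 = f a0 by rewrite addr0 /f Ta.
exists (cinv c \o (fun y => g (cmap d y *m K + 0))).
  apply: smooth_map_at_cinv => //; last by rewrite Ha gf; exact: UI.
  move=> j; apply: (smooth_at_Ck_comp (h := fun y => cmap d y *m K + 0) (g := fun z => g z 0 j) (B := W)) => //.
    by rewrite Ha.
  by move=> k; exact: ((Ck_coordP k _ oW).1 (gS k) j).
have h1 : \forall b \near a, g (f (cmap c b)) = cmap c b by exact: (cmap_cont ca gK).
have h2 : \forall b \near a, cdom c b by apply: open_nbhs_nbhs; split=> //; exact: cdom_open.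
apply: filterS2 h1 h2 => b gb cb /=; rewrite addr0.
have -> : cmap d (i b) *m K = f (cmap c b) by rewrite /f /T /= cmapK.
by rewrite gb cmapK.
Qed.

Lemma derive_const_line n (F : 'rV[R]_n -> R) b v : differentiable F b ->
  (\forall t \near (0 : R), F (b + t *: v) = F b) -> 'D_v F b = 0.
Proof.
move=> Fd h; have Fd0 : differentiable F (b + (0 : R) *: v) by rewrite scale0r addr0.
have := is_derive_line Fd0; rewrite scale0r addr0 => h'.
have e : \forall t \near (0 : R), F (b + t *: v) = cst (F b) t by exact: h.
have h2 := near_eq_is_derive e h'.
have h3 : is_derive (0 : R) (1 : R) (cst (F b)) (0 : R) by exact: is_derive_cst.
by have [_ <-] := h2; have [_ ->] := h3.
Qed.

(** Both conclusions come from one straightening Phi of q. The second says that a vertical vector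
    kills every function that is constant on the fibre through x near x; no manifold structure on
    the fibre is involved. *)
Lemma submersion_local (M Q : manifoldType R) (q : M -> Q) (x : M) : smooth_map q -> submersion q ->
  (exists sigma : Q -> M, [/\ smooth_map_at (q x) sigma, sigma (q x) = x &
    \forall y \near q x, q (sigma y) = y]) /\
  (forall v F, tangent x v -> (forall u, Cinf u -> v (u \o q) = 0) -> Cinf F ->
    (\forall y \near x, q y = q x -> F y = F x) -> v F = 0).
Proof.
move=> qS sub; have [c ac cx] := atlas_cover x; have [d ad dqx] := atlas_cover (q x).
have [U [oU Ux UI Ud US]] := smooth_map_at_chart_rep ac cx ad dqx ((smooth_mapP q).1 qS x).
set T := cmap d \o q \o cinv c in US; set a0 := cmap c x in Ux.
have Td : differentiable T a0 by case: (US 1%N) => h _; exact: h.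
have DT := derive_jacobian Td; set J := lin1_mx _ in DT.
have surj (u : 'rV[R]_(cdim d)) : exists v : 'rV[R]_(cdim c), v *m J = u.
  have [v vT vE] := sub x _ (tangent_dvec u ad dqx).
  have [v0 v0E] := tangent_dvecP ac cx vT; exists v0; rewrite -DT.
  by apply: (dvec_inj ad dqx); rewrite -vE v0E (pushforward_dvec _ ac cx ad dqx qS).
pose K := \matrix_(i < cdim d) projT1 (cid (surj (delta_mx 0 i))).
have KJ : K *m J = 1%:M.
  by apply/row_matrixP => i; rewrite row_mul rowK row1; case: cid.
(* L projects onto the kernel of J along the image of K. Phi combines the value of q, lifted by K,
   with the kernel component, and in the coordinates Phi the map q is the linear map J. *)
pose L : 'M[R]_(cdim c) := 1%:M - J *m K.
have LJ : L *m J = 0 by rewrite mulmxBl mul1mx -mulmxA KJ mulmx1 subrr.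
pose Phi z := T z *m K + z *m L.
have PhiJ z : Phi z *m J = T z by rewrite mulmxDl -!mulmxA KJ LJ mulmx1 mulmx0 addr0.
have idd z : differentiable (@id 'rV[R]_(cdim c)) z by exact: ex_diff.
have PhiS : smooth_on U Phi.
  move=> k; apply: CkD; [exact: oU|exact: Ck_mulmxr (US k)|].
  apply: Ck_mulmxr; first exact: oU.
  by apply/(Ck_coordP k _ oU) => j; exact: Ck_coord.
have PhiD v : 'D_v Phi a0 = v.
  have [d1 e1] := derive_mulmxr K v Td; have [d2 e2] := derive_mulmxr L v (idd a0).
  rewrite (deriveD (diff_derivable d1) (diff_derivable d2)) e1 e2 derive_id DT -mulmxA -mulmxDr.
  by rewrite /L addrC subrK mulmx1.
have [g [W [oW Wf gS gf [gW gK]]]] := inverse_function oU Ux PhiS PhiD.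
have Ta : T a0 = cmap d (q x) by rewrite /T /= cmapK.
have Tg w : W w -> T (g w) = w *m J by move=> Ww; rewrite -PhiJ (gW w Ww).2.
split.
  (* The kernel component is frozen at its value at x, so the section passes through x. *)
  pose b := a0 *m L.
  have HS j : smooth_at (q x) (fun y => (cmap d y *m K + b) 0 j).
    by apply: (smooth_at_affine K b _ j) => k; exact: smooth_at_coord.
  have Ha : cmap d (q x) *m K + b = Phi a0 by rewrite /Phi Ta.
  exists (cinv c \o (fun y => g (cmap d y *m K + b))); split.
  - apply: smooth_map_at_cinv => //; last by rewrite Ha gf; exact: UI.
    move=> j; apply: (smooth_at_Ck_comp (h := fun y => cmap d y *m K + b) (g := fun z => g z 0 j) (B := W)) => //.
      by rewrite Ha.
    by move=> k; exact: ((Ck_coordP k _ oW).1 (gS k) j).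
  - by rewrite /= Ha gf cmapK.
  have h1 : \forall y \near q x, W (cmap d y *m K + b).
    by apply: (smooth_at_vec_continuous HS); rewrite Ha; exact: open_nbhs_nbhs.
  have h2 : \forall y \near q x, cdom d y by apply: open_nbhs_nbhs; split=> //; exact: cdom_open.
  apply: filterS2 h1 h2 => y Wy dy /=; set w := _ + b in Wy *.
  have := Tg w Wy; rewrite /w mulmxDl -!mulmxA KJ LJ mulmx1 mulmx0 addr0 -/w /T /= => e.
  by rewrite -[RHS](cmapK dy) -e cmapK//; apply: Ud; exact: (gW w Wy).1.
move=> v F vT vq FS Fc; have [v0 v0E] := tangent_dvecP ac cx vT.
have v0J : v0 *m J = 0.
  rewrite -DT; apply: (dvec_inj ad dqx); apply: functional_eq => [f nf|f nf|f fS]; [exact: on_Cinf0|exact: on_Cinf0|].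
  rewrite -(pushforward_dvec _ ac cx ad dqx qS) pushforwardE// -v0E vq//.
  by rewrite /dvec on_CinfE// derive0.
pose Fg := F \o cinv c \o g.
have FgS : exists2 V, open V /\ V (Phi a0) & Ck V 1 Fg.
  have [V [oV Vx _ VS]] := smooth_at_chart ac cx ((CinfP F).1 FS x).
  have oV' := open_preimage_within oW oV (gS 0%N).
  exists (W `&` g @^-1` V); first by split=> //; split=> //; rewrite /preimage /= gf.
  have WV : W `&` g @^-1` V `<=` W by move=> y [].
  exact: (@Ck_comp R _ _ _ V 1 g (F \o cinv c) oV' (fun y Wy => Wy.2) (Ck_sub WV (gS 1%N)) (VS 1%N)).
have Fgd : differentiable Fg (Phi a0) by case: FgS => V [_ Vx] [h _]; exact: h.
have Phid : differentiable Phi a0 by case: (PhiS 1%N) => h _; exact: h.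
have -> : v F = 'D_v0 Fg (Phi a0).
  rewrite v0E /dvec on_CinfE// -[in RHS](PhiD v0) -(derive_chain v0 Phid Fgd).
  by apply: near_eq_derive; apply: filterS gK => z zE /=; rewrite /Fg /= zE.
(* As v0 J = 0, the line Phi a0 + t v0 stays in the fibre of q through x. *)
apply: derive_const_line Fgd _.
have line : {for (0 : R), continuous (fun t : R => Phi a0 + t *: v0)}.
  apply: cvgD; first exact: cvg_cst.
  by apply: cvgZr_tmp; exact: cvg_id.
have l0 : Phi a0 + (0 : R) *: v0 = Phi a0 by rewrite scale0r addr0.
have h1 : \forall w \near Phi a0, W w by exact: open_nbhs_nbhs.
have h2 : \forall w \near Phi a0, q (cinv c (g w)) = q x -> F (cinv c (g w)) = F x.
  have g2 : {for Phi a0, continuous (cinv c \o g)}.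
    apply: continuous_comp; first exact: gS 0%N _ Wf.
    by apply: cinv_cont; rewrite gf; exact: UI.
  have Fc' : nbhs ((cinv c \o g) (Phi a0)) (fun y => q y = q x -> F y = F x) by rewrite /= gf cmapK.
  exact: (g2 _ Fc').
have h3 : \forall t \near (0 : R), W (Phi a0 + t *: v0) /\
   (q (cinv c (g (Phi a0 + t *: v0))) = q x -> F (cinv c (g (Phi a0 + t *: v0))) = F x).
  have h12 : nbhs (Phi a0 + (0 : R) *: v0) (fun w => W w /\ (q (cinv c (g w)) = q x -> F (cinv c (g w)) = F x)).
    by rewrite l0; exact: filterI.
  exact: (line _ h12).
apply: filterS h3 => t [Wt ht]; rewrite /Fg /= gf cmapK// ht//.
have := Tg _ Wt; rewrite mulmxDl -scalemxAl v0J scaler0 addr0 PhiJ Ta /T /= => e.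
have dt := Ud _ (gW _ Wt).1.
by rewrite -[LHS](cmapK dt) e cmapK.
Qed.

End ImmersionsSubmersions.

(** * Lie algebras of products *)

Section LiftsAndDescent.
Context {R : realType}.

Lemma smooth_comp (M N P : manifoldType R) (F : M -> N) (G : N -> P) :
  smooth_map F -> smooth_map G -> smooth_map (G \o F).
Proof.
move=> /smooth_mapP FS /smooth_mapP GS; apply/smooth_mapP => x.
by apply: smooth_map_at_comp; [exact: FS|exact: GS].
Qed.

Lemma smooth_pair (L M N : manifoldType R) (F : L -> M) (G : L -> N) :
  smooth_map F -> smooth_map G -> smooth_map (fun z => (F z, G z) : M * N).
Proof.
move=> /smooth_mapP FS /smooth_mapP GS; apply/smooth_mapP => x.
by apply: smooth_map_at_pair; [exact: FS|exact: GS].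
Qed.

Lemma smooth_fst (M N : manifoldType R) : smooth_map (fst : M * N -> M).
Proof. by apply/smooth_mapP => x; exact: smooth_map_at_fst. Qed.

Lemma smooth_snd (M N : manifoldType R) : smooth_map (snd : M * N -> N).
Proof. by apply/smooth_mapP => x; exact: smooth_map_at_snd. Qed.

Lemma smooth_cst (M N : manifoldType R) (y : N) : smooth_map (fun _ : M => y).
Proof. by apply/smooth_mapP => x; exact: smooth_map_at_cst. Qed.

Lemma smooth_id (M : manifoldType R) : smooth_map (@id M).
Proof. by apply/smooth_mapP => x; exact: smooth_map_at_id. Qed.

(** The topological clause of an embedding, phrased through the fibres of i so that points off the
    image of i need no preimage. *)
Lemma near_embedding (N M : manifoldType R) (i : N -> M) a (P : N -> Prop) : embedding i ->
  (\forall b \near a, P b) -> \forall y \near i a, forall b, i b = y -> P b.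
Proof.
move=> [_ _ _ top] /near_open[U [oU Ua UP]].
have [V oV UV] := top U oU.
have h : \forall y \near i a, V y.
  by apply: open_nbhs_nbhs; split=> //; move: Ua; rewrite UV.
by apply: filterS h => y Vy b iby; apply: UP; rewrite UV /preimage /= iby.
Qed.

(** Near l the map f is kappa o (i o f) for a smooth local retraction kappa. Continuity of f is not
    given: the topological clause of the embedding is what places f y near f l, where kappa o i is
    the identity. *)
Lemma embedding_lift (L N M : manifoldType R) (i : N -> M) (f : L -> N) l :
  embedding i -> smooth_map_at l (i \o f) -> smooth_map_at l f.
Proof.
move=> ie [ifc ifS]; have [kap kS kK] := embedding_retraction (f l) ie.
have near_f (P : N -> Prop) : (\forall b \near f l, P b) -> \forall y \near l, P (f y).
  move=> hP; have h := near_embedding ie hP; have h' := ifc _ h.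
  have h2 : \forall y \near l, forall b, i b = i (f y) -> P b by exact: h'.
  by apply: filterS h2 => y /(_ (f y) erefl).
apply: (@smooth_map_at_ext _ _ _ _ (kap \o (i \o f))).
  exact: (near_f (fun b => kap (i b) = b) kK).
by apply: smooth_map_at_comp.
Qed.

Lemma embedding_lift_smooth (L N M : manifoldType R) (i : N -> M) (f : L -> N) :
  embedding i -> smooth_map (i \o f) -> smooth_map f.
Proof.
move=> ie /smooth_mapP h; apply/smooth_mapP => l; exact: embedding_lift ie (h l).
Qed.

Lemma embedding_extension (N M : manifoldType R) (i : N -> M) a f :
  embedding i -> smooth_at a f -> exists2 F, Cinf F & \forall b \near a, F (i b) = f b.
Proof.
move=> ie fS; have [kap kS kK] := embedding_retraction a ie; have [[iC _] _ _ _] := ie.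
have ka : kap (i a) = a := nbhs_singleton kK.
have fkS : smooth_at (i a) (f \o kap) by apply: kS.2; rewrite ka.
have [F FS FE] := smooth_at_extension fkS; exists F => //.
have h : \forall b \near a, F (i b) = (f \o kap) (i b) by exact: (iC a _ FE).
by apply: filterS2 h kK => b -> /= ->.
Qed.

Lemma submersion_descend (M Q L : manifoldType R) (q : M -> Q) (f : Q -> L) x :
  smooth_map q -> submersion q -> smooth_map_at x (f \o q) -> smooth_map_at (q x) f.
Proof.
move=> qS sub fqS; have [[sg [sS sx sK]] _] := submersion_local x qS sub.
apply: (@smooth_map_at_ext _ _ _ _ ((f \o q) \o sg)); first by apply: filterS sK => y /= ->.
by apply: smooth_map_at_comp => //; rewrite sx.
Qed.

Lemma submersion_descend_smat (M Q : manifoldType R) (q : M -> Q) f x :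
  smooth_map q -> submersion q -> smooth_at x (f \o q) -> smooth_at (q x) f.
Proof.
move=> qS sub fqS; have [[sg [sS sx sK]] _] := submersion_local x qS sub.
apply: (@smooth_at_ext _ _ _ ((f \o q) \o sg)); first by apply: filterS sK => y /= ->.
by apply: sS.2; rewrite sx.
Qed.

Lemma submersion_open (M Q : manifoldType R) (q : M -> Q) (U : set M) :
  smooth_map q -> submersion q -> open U -> open (q @` U).
Proof.
move=> qS sub oU; rewrite openE => _ [x Ux <-].
have [[sg [sS sx sK]] _] := submersion_local x qS sub.
have h : \forall y \near q x, U (sg y) by apply: sS.1; rewrite /= sx; exact: open_nbhs_nbhs.
suff H : \forall y \near q x, (q @` U) y by exact: H.
by apply: filterS2 h sK => y Uy yE; exists (sg y).
Qed.

Lemma embedding_id (M : manifoldType R) : embedding (@id M).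
Proof.
split=> //; first exact: smooth_id.
- move=> x v w vT wT vw; apply: (tangent_eq vT wT) => f fS.
  by move: (congr1 (fun t : functional M => t f) vw); rewrite !pushforwardE.
- by move=> U oU; exists U.
Qed.

End LiftsAndDescent.

(** * The Lie algebra of a Lie group and of a product *)

Section LieAlgebra.
Context {R : realType}.

Lemma smooth_mulgl (G : lieGroupType R) (g : G) : smooth_map (fun h : G => (g * h)%g).
Proof. exact: (smooth_comp (smooth_slicer G g) (@mulg_smooth R G)). Qed.

Lemma smooth_mulgr (G : lieGroupType R) (g : G) : smooth_map (fun h : G => (h * g)%g).
Proof. exact: (smooth_comp (smooth_slicel G g) (@mulg_smooth R G)). Qed.

Lemma linvE (G : lieGroupType R) xi (g : G) u : Cinf u -> linv xi g u = xi (fun h => u (g * h)%g).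
Proof. exact: pushforwardE. Qed.

Lemma rinvE (G : lieGroupType R) xi (g : G) u : Cinf u -> rinv xi g u = xi (fun h => u (h * g)%g).
Proof. exact: pushforwardE. Qed.

Lemma Cinf_mulg (G : lieGroupType R) (u : G -> R) : Cinf u -> Cinf (fun p : G * G => u (p.1 * p.2)%g).
Proof. exact: (Cinf_comp (@mulg_smooth R G)). Qed.

Lemma Cinf_linv (G : lieGroupType R) xi (u : G -> R) : lie_algebra xi -> Cinf u ->
  Cinf (fun g => linv xi g u).
Proof.
move=> xT uS; have := tangent_slicer_Cinf (Cinf_mulg uS) xT.
by congr Cinf; apply/funext => g; rewrite linvE.
Qed.

Lemma bracketE (G : lieGroupType R) (xi eta : functional G) u : Cinf u ->
  bracket xi eta u = xi (fun g => linv eta g u) - eta (fun g => linv xi g u).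
Proof. exact: on_CinfE. Qed.

Lemma linv1 (G : lieGroupType R) xi (u : G -> R) : Cinf u -> linv xi 1%g u = xi u.
Proof. by move=> uS; rewrite linvE//; congr xi; apply/funext => h; rewrite mul1g. Qed.

Lemma linv_tangent (G : lieGroupType R) xi (g : G) : lie_algebra xi -> tangent g (linv xi g).
Proof.
by move=> xT; have := tangent_pushforward (smooth_mulgl g) xT; rewrite mulg1.
Qed.

(** The cross terms xi f eta g + xi g eta f of the product rule are symmetric in xi and eta and
    cancel in the difference. *)
Lemma bracket_lie (G : lieGroupType R) (xi eta : functional G) :
  lie_algebra xi -> lie_algebra eta -> lie_algebra (bracket xi eta).
Proof.
move=> xT eT; split=> [f nf|a f g fS gS|f g fS gS]; first exact: on_Cinf0.
  have h (z : functional G) : lie_algebra z ->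
     (fun k => linv z k (fun y => a * f y + g y)) = (fun k => a * linv z k f + linv z k g).
    by move=> zT; apply/funext => k; have [_ zl _] := linv_tangent k zT; exact: zl.
  rewrite !bracketE//; last exact: Cinf_lincomb.
  have [_ xl _] := xT; have [_ el _] := eT.
  rewrite !h// xl ?el; [ring|exact: Cinf_linv..].
have h (z : functional G) : lie_algebra z ->
   (fun k => linv z k (fun y => f y * g y)) = (fun k => f k * linv z k g + g k * linv z k f).
  by move=> zT; apply/funext => k; have [_ _ zm] := linv_tangent k zT; exact: zm.
rewrite !bracketE//; last exact: CinfM.
rewrite !h//.
have P (z z' : functional G) : lie_algebra z -> lie_algebra z' ->
   z (fun k => f k * linv z' k g + g k * linv z' k f) =
   f 1%g * z (fun k => linv z' k g) + z' g * z f + (g 1%g * z (fun k => linv z' k f) + z' f * z g).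
  move=> zT zT'; rewrite (tangentD zT); [|by apply: CinfM => //; exact: Cinf_linv..].
  by rewrite !(tangentM zT)//; [rewrite !linv1|exact: Cinf_linv..].
by rewrite !P//; ring.
Qed.

Lemma tangent_lin_sum (M : manifoldType R) (x : M) I (r : seq I) (c : I -> R) (v : I -> functional M) :
  (forall i, tangent x (v i)) -> tangent x (fun u => \sum_(i <- r) c i * v i u).
Proof.
move=> vT; elim: r => [|i r IH].
  by rewrite (_ : (fun u => _) = fun _ => 0); [exact: tangent0|apply/funext => u; rewrite big_nil].
rewrite (_ : (fun u => _) = fun u => c i * v i u + \sum_(i <- r) c i * v i u).
  exact: tangent_lincomb.
by apply/funext => u; rewrite big_cons.
Qed.

Lemma sharp_lie (G : lieGroupType R) (s : tensor2 G) al : in_S2 s -> lie_algebra (sharp s al).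
Proof.
move=> [sT _]; rewrite /sharp (_ : (fun u => _) =
  fun u => \sum_i 1 * (\sum_j tcoef s i j * al (tvec s i) * tvec s j u)).
  by apply: tangent_lin_sum => i; exact: tangent_lin_sum.
by apply/funext => u; apply: eq_bigr => i _; rewrite mul1r.
Qed.

Section PairVec.
Variables G H : lieGroupType R.

Lemma smooth_inl : smooth_map (@inl_mor R G H).
Proof. exact: smooth_slicel. Qed.

Lemma smooth_inr : smooth_map (@inr_mor R G H).
Proof. exact: smooth_slicer. Qed.

Lemma pair_vecE (xi : functional G) (eta : functional H) u : Cinf u ->
  pair_vec xi eta u = xi (fun g => u (g, 1%g)) + eta (fun h => u (1%g, h)).
Proof. by move=> uS; rewrite /pair_vec !pushforwardE. Qed.

Lemma pair_vec0 (xi : functional G) (eta : functional H) u : ~ Cinf u -> pair_vec xi eta u = 0.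
Proof. by move=> nu; rewrite /pair_vec /pushforward !on_Cinf0// addr0. Qed.

Lemma pair_vec_lie (xi : functional G) (eta : functional H) :
  lie_algebra xi -> lie_algebra eta -> lie_algebra (pair_vec xi eta).
Proof.
move=> xT eT; have x' := tangent_pushforward smooth_inl xT; have e' := tangent_pushforward smooth_inr eT.
have := tangent_lincomb 1 x' e'; congr (tangent _ _).
by apply/funext => u; rewrite mul1r.
Qed.

(** a and b are arbitrary functions rather than linear forms, so that the same splitting serves
    [sharp] and the moment map condition. *)
Lemma tensor_add_sum (sG : tensor2 G) (sH : tensor2 H) (a b : functional (G * H)%type -> R) :
  \sum_i \sum_j tcoef (tensor_add sG sH) i j * a (tvec (tensor_add sG sH) i) * b (tvec (tensor_add sG sH) j) =
  \sum_i \sum_j tcoef sG i j * a (pushforward (@inl_mor R G H) (tvec sG i)) * b (pushforward (@inl_mor R G H) (tvec sG j)) +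
  \sum_i \sum_j tcoef sH i j * a (pushforward (@inr_mor R G H) (tvec sH i)) * b (pushforward (@inr_mor R G H) (tvec sH j)).
Proof.
rewrite /tensor_add /= big_split_ord /=.
have E1 i : (match fintype.split (lshift (tdim sH) i) with
   | inl i => pushforward (@inl_mor R G H) (tvec sG i) | inr j => pushforward (@inr_mor R G H) (tvec sH j) end)
   = pushforward (@inl_mor R G H) (tvec sG i) by rewrite (unsplitK (inl i)).
have E2 i : (match fintype.split (rshift (tdim sG) i) with
   | inl i => pushforward (@inl_mor R G H) (tvec sG i) | inr j => pushforward (@inr_mor R G H) (tvec sH j) end)
   = pushforward (@inr_mor R G H) (tvec sH i) by rewrite (unsplitK (inr i)).
congr (_ + _); apply: eq_bigr => i _; rewrite big_split_ord /=.
  rewrite [X in _ + X]big1 ?addr0; last by move=> j _; rewrite block_mxEur mxE !mul0r.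
  by apply: eq_bigr => j _; rewrite block_mxEul !E1.
rewrite [X in X + _]big1 ?add0r; last by move=> j _; rewrite block_mxEdl mxE !mul0r.
by apply: eq_bigr => j _; rewrite block_mxEdr !E2.
Qed.

Lemma sharp_add (sG : tensor2 G) (sH : tensor2 H) (be : functional (G * H)%type -> R) :
  sharp (tensor_add sG sH) be =
  pair_vec (sharp sG (be \o pushforward (@inl_mor R G H))) (sharp sH (be \o pushforward (@inr_mor R G H))).
Proof.
apply/funext => u; rewrite /sharp (tensor_add_sum sG sH be (fun xi => xi u)).
case: (pselect (Cinf u)) => uS; last first.
  rewrite pair_vec0// !big1 ?addr0// => i _; rewrite big1// => j _;
    by rewrite /pushforward on_Cinf0// mulr0.
by rewrite pair_vecE//; congr (_ + _); apply: eq_bigr => i _; apply: eq_bigr => j _;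
  rewrite pushforwardE.
Qed.

(** The mixed terms, with one derivative along G and one along H, commute by [tangent_swap] and
    cancel. *)
Lemma bracket_pair (xi xi' : functional G) (eta eta' : functional H) :
  lie_algebra xi -> lie_algebra xi' -> lie_algebra eta -> lie_algebra eta' ->
  bracket (pair_vec xi eta) (pair_vec xi' eta') = pair_vec (bracket xi xi') (bracket eta eta').
Proof.
move=> xT xT' eT eT'; apply: functional_eq => [u|u|u uS]; [exact: on_Cinf0|exact: pair_vec0|].
have uGS : Cinf (fun g => u (g, 1%g)) by exact: Cinf_slicel.
have uHS : Cinf (fun h => u (1%g, h)) by exact: Cinf_slicer.
have L z e g h : linv (pair_vec z e) (g, h) u = z (fun g' => u (g * g', h)%g) + e (fun h' => u (g, h * h')%g).
  rewrite linvE// pair_vecE; last exact: (Cinf_comp (@smooth_mulgl (G * H)%type (g, h))).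
  by congr (z _ + e _); apply/funext => k; congr u; congr pair; rewrite mulg1.
have uS' : Cinf (fun p : H * G => u (p.2, p.1)).
  exact: (Cinf_comp (smooth_pair (@smooth_snd _ H G) (@smooth_fst _ H G))).
have D (z z' : functional G) (e e' : functional H) : lie_algebra z -> lie_algebra z' -> lie_algebra e -> lie_algebra e' ->
  pair_vec z e (fun k => linv (pair_vec z' e') k u) =
   z (fun g => linv z' g (fun g => u (g, 1%g))) + z (fun g => e' (fun h => u (g, h)))
   + (e (fun h => z' (fun g => u (g, h))) + e (fun h => linv e' h (fun h => u (1%g, h)))).
  move=> zT zT' eT1 eT2.
  rewrite pair_vecE; last by apply: Cinf_linv => //; exact: pair_vec_lie.
  congr (_ + _).
    rewrite -(tangentD zT); [|exact: Cinf_linv|exact: (tangent_slicer_Cinf uS eT2)].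
    congr z; apply/funext => g; rewrite L linvE//; congr (_ + e' _).
    by apply/funext => h; rewrite mul1g.
  rewrite -(tangentD eT1); [|exact: (tangent_slicer_Cinf uS' zT')|exact: Cinf_linv].
  congr e; apply/funext => h; rewrite L linvE//; congr (z' _ + _).
  by apply/funext => g; rewrite mul1g.
rewrite bracketE// !D// pair_vecE// !bracketE//.
rewrite (tangent_swap uS xT eT') (tangent_swap uS xT' eT); ring.
Qed.

End PairVec.

End LieAlgebra.

(** * Reduction along a submanifold *)

Section Bivectors.
Context {R : realType}.
Variables (M : manifoldType R) (pi : M -> (M -> R) -> (M -> R) -> R).
Hypothesis pib : bivector_field pi.

Lemma bivector_tangent x f : tangent x (pi x f).
Proof. by case: pib => h _; exact: (h x).1. Qed.

Lemma bivector_skew x f g : pi x f g = - pi x g f.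
Proof. by case: pib => h _; exact: (h x).2. Qed.

Lemma bivector_subr x f g h : Cinf g -> Cinf h ->
  pi x f (fun y => (-1) * h y + g y) = pi x f g - pi x f h.
Proof.
move=> gS hS; have [_ pl _] := bivector_tangent x f.
by rewrite pl// mulN1r addrC.
Qed.

Lemma bivector_Cinf f g : Cinf f -> Cinf g -> Cinf (fun x => pi x f g).
Proof. by case: pib => _; apply. Qed.

End Bivectors.

Section Actions.
Context {R : realType}.
Variables (G : lieGroupType R) (M : manifoldType R) (act : G -> M -> M).
Hypothesis actL : lie_action act.

Lemma smooth_act g : smooth_map (act g).
Proof. by case: actL => _ _ aS; exact: (smooth_comp (smooth_slicer M g) aS). Qed.

Lemma smooth_orbit x : smooth_map (fun g => act g x).
Proof. by case: actL => _ _ aS; exact: (smooth_comp (smooth_slicel G x) aS). Qed.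

Lemma rhoE xi x f : Cinf f -> rho act xi x f = - xi (fun g => f (act g x)).
Proof. by move=> fS; rewrite /rho pushforwardE. Qed.

End Actions.

Lemma same_differential_sub (R : realType) (M : manifoldType R) (x : M) (f g : M -> R) :
  Cinf f -> Cinf g -> same_differential x f g ->
  forall v, tangent x v -> v (fun y => (-1) * g y + f y) = 0.
Proof.
move=> fS gS fg v vT; have [_ vl _] := vT.
by rewrite vl// fg// mulN1r addNr.
Qed.

(** * The quasi-Poisson structure on the orbit space of a stable submanifold *)

Section Reduction.
Context {R : realType}.
Variables (G H : lieGroupType R) (sG : tensor2 G) (sH : tensor2 H).
Hypotheses (hsG : in_S2 sG) (hsH : in_S2 sH).
Variables (M : manifoldType R) (act : G * H -> M -> M)
  (pi : M -> (M -> R) -> (M -> R) -> R).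
Hypothesis hM : quasi_poisson (tensor_add sG sH) act pi.
Variables (C : lieGroupType R) (iC : C -> G).
Hypotheses (hC : lie_subgroup iC) (hred : reducing sG iC).
Variables (N : manifoldType R) (i : N -> M).
Hypothesis ie : embedding i.
Hypothesis stabC : forall c a, exists b, i b = act (iC c, 1%g) (i a).
Hypothesis stabH : forall h a, exists b, i b = act (1%g, h) (i a).
Variables (P : manifoldType R) (p : N -> P).
Hypothesis hp : quotient_by (fun a b => exists c : C, i b = act (iC c, 1%g) (i a)) p.
(* This is what makes pi descend; for N = M it is void. *)
Hypothesis conormal : forall a F F' f', Cinf F -> Cinf F' -> Cinf f' ->
  (forall v, tangent a v -> v (F \o i) = 0) ->
  same_differential a (F' \o i) (f' \o p) -> pi (i a) F F' = 0.

Let iS : smooth_map i. Proof. by case: ie. Qed.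
Let iI : injective i. Proof. by case: ie. Qed.
Let pS : smooth_map p. Proof. by case: hp. Qed.
Let pQ : submersion p. Proof. by case: hp. Qed.
Let pE a b : p a = p b <-> exists c : C, i b = act (iC c, 1%g) (i a). Proof. by case: hp. Qed.
Let actL : lie_action act. Proof. by case: hM. Qed.
Let pib : bivector_field pi. Proof. by case: hM. Qed.
Let iCM : {morph iC : x y / (x * y)%g}. Proof. by case: hC. Qed.
Let iCS : smooth_map iC. Proof. by case: hC. Qed.

Lemma subgroup_one : iC 1%g = 1%g.
Proof. by apply: (mulgI (iC 1%g)); rewrite -iCM !mulg1. Qed.

Let actM k l x : act (k * l)%g x = act k (act l x). Proof. by case: actL. Qed.
Let act1 x : act 1%g x = x. Proof. by case: actL. Qed.

Let actC c a := projT1 (cid (stabC c a)).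
Let actN h a := projT1 (cid (stabH h a)).

Let actCE c a : i (actC c a) = act (iC c, 1%g) (i a). Proof. by rewrite /actC; case: cid. Qed.
Let actNE h a : i (actN h a) = act (1%g, h) (i a). Proof. by rewrite /actN; case: cid. Qed.

Let actC1 a : actC 1%g a = a.
Proof. by apply: iI; rewrite actCE subgroup_one; exact: act1. Qed.

Let actN1 a : actN 1%g a = a.
Proof. by apply: iI; rewrite actNE; exact: act1. Qed.

Let pC c a : p (actC c a) = p a.
Proof. by apply/esym/pE; exists c; exact: actCE. Qed.

Let actS : smooth_map (fun q : (G * H) * M => act q.1 q.2). Proof. by case: actL. Qed.

(** [actC] is chosen point by point; its smoothness is that of its composite with the embedding
    i. *)
Let actCS : smooth_map (fun q : C * N => actC q.1 q.2).
Proof.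
apply: (embedding_lift_smooth ie).
have -> : i \o (fun q : C * N => actC q.1 q.2) =
    (fun q : (G * H) * M => act q.1 q.2) \o (fun q : C * N => ((iC q.1, 1%g), i q.2)).
  by apply/funext => q /=; rewrite actCE.
apply: smooth_comp actS; apply: smooth_pair; last exact: (smooth_comp (smooth_snd C N) iS).
by apply: smooth_pair; [exact: (smooth_comp (smooth_fst C N) iCS)|exact: smooth_cst].
Qed.

Let actNS : smooth_map (fun q : H * N => actN q.1 q.2).
Proof.
apply: (embedding_lift_smooth ie).
have -> : i \o (fun q : H * N => actN q.1 q.2) =
    (fun q : (G * H) * M => act q.1 q.2) \o (fun q : H * N => ((1%g, q.1), i q.2)).
  by apply/funext => q /=; rewrite actNE.
apply: smooth_comp actS; apply: smooth_pair; last exact: (smooth_comp (smooth_snd H N) iS).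
by apply: smooth_pair; [exact: smooth_cst|exact: smooth_fst].
Qed.

Let actCSr c : smooth_map (actC c).
Proof. exact: (smooth_comp (smooth_slicer N c) actCS). Qed.

Let actNSr h : smooth_map (actN h).
Proof. exact: (smooth_comp (smooth_slicer N h) actNS). Qed.

Let p_surj z : exists a, p a = z.
Proof. by case: hp => _ pr _ _; have [a _ <-] : range p z by [rewrite pr]; exists a. Qed.

Let pre z := projT1 (cid (p_surj z)).
Let preK z : p (pre z) = z. Proof. by rewrite /pre; case: cid. Qed.

(** [pre z] is an arbitrary representative; the choice is harmless because the actions of H and C
    commute. *)
Definition reduced_action (h : H) (z : P) : P := p (actN h (pre z)).

Lemma commute_act c h x : act (1%g, h) (act (iC c, 1%g) x) = act (iC c, 1%g) (act (1%g, h) x).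
Proof.
rewrite -!actM; congr (act _ x).
by apply: (f_equal2 pair); rewrite ?mul1g ?mulg1.
Qed.

Lemma reduced_actionE h a : reduced_action h (p a) = p (actN h a).
Proof.
have /pE[c e] := preK (p a); apply/pE; exists c.
by rewrite !actNE e commute_act.
Qed.

Lemma reduced_residual : residual_action act i p reduced_action.
Proof. by move=> h a b ib; rewrite reduced_actionE; congr p; apply: iI; rewrite actNE ib. Qed.

Lemma reduced_lie_action : lie_action reduced_action.
Proof.
split=> [z|h k z|].
- by rewrite -(preK z) reduced_actionE actN1.
- rewrite -(preK z) !reduced_actionE; congr p; apply: iI; rewrite !actNE -actM.
  by congr (act _ _); apply: (f_equal2 pair); rewrite ?mul1g.
apply/smooth_mapP => -[h z]; rewrite -(preK z); set a := pre z.
(* The representatives [pre] need not vary smoothly, so smoothness is tested with a local section of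
   p. *)
have [[sg [sS sa sK]] _] := submersion_local a pS pQ.
have e : \forall q \near (h, p a), p (actN q.1 (sg q.2)) = reduced_action q.1 q.2.
  have h1 : \forall q \near (h, p a), p (sg q.2) = q.2.
    have c : {for (h, p a), continuous (snd : H * P -> P)} := (smooth_map_at_snd (h, p a)).1.
    exact: (c _ sK).
  by apply: filterS h1 => q e; rewrite -[in RHS]e reduced_actionE.
apply: (smooth_map_at_ext e).
apply: (@smooth_map_at_comp _ _ _ _ _ (fun q : H * P => (q.1, sg q.2)) (fun q : H * N => p (actN q.1 q.2))).
  apply: smooth_map_at_pair; first exact: smooth_map_at_fst.
  by apply: (@smooth_map_at_comp _ _ _ _ _ snd sg); [exact: smooth_map_at_snd|].
exact: ((smooth_mapP _).1 (smooth_comp actNS pS)).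
Qed.

(** Agreement on a neighbourhood of a in N, stronger than [same_differential]: it is inherited by
    nearby points and hence by pi(F, F'), which gets differentiated in the Schouten bracket. *)
Definition extends (a : N) (F : M -> R) (f : P -> R) :=
  Cinf F /\ \forall b \near a, F (i b) = f (p b).

Lemma extension_exists a f : Cinf f -> exists F, extends a F f.
Proof.
move=> fS; have [|F FS FE] := @embedding_extension _ _ _ i a (f \o p) ie.
  exact: ((CinfP _).1 (Cinf_comp pS fS)).
by exists F.
Qed.

Lemma extends_near a F f : extends a F f -> \forall b \near a, extends b F f.
Proof.
move=> [FS /near_open[U [oU Ua UP]]].
have h : \forall b \near a, U b by exact: open_nbhs_nbhs.
apply: filterS h => b Ub; split=> //.
have h' : \forall b' \near b, U b' by exact: open_nbhs_nbhs.
by apply: filterS h'.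
Qed.

Lemma extends_at a F f : extends a F f -> F (i a) = f (p a).
Proof. by move=> [_ /nbhs_singleton]. Qed.

Lemma extends_same a F f : Cinf f -> extends a F f -> same_differential a (F \o i) (f \o p).
Proof.
move=> fS [FS h] v vT; apply: (tangent_near vT) => //; exact: Cinf_comp.
Qed.

(** The difference F1 - F2 kills T_a N, and [conormal] applies to it after the two arguments are
    exchanged. *)
Lemma pi_well_defined_r a F F1 F2 f f' : Cinf F -> Cinf F1 -> Cinf F2 -> Cinf f -> Cinf f' ->
  same_differential a (F \o i) (f \o p) ->
  same_differential a (F1 \o i) (f' \o p) -> same_differential a (F2 \o i) (f' \o p) ->
  pi (i a) F F1 = pi (i a) F F2.
Proof.
move=> FS F1S F2S fS fS' Ff F1f F2f.
apply/eqP; rewrite -subr_eq0 -(bivector_subr pib)// (bivector_skew pib) oppr_eq0; apply/eqP.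
apply: (@conormal a _ F f) => //; first exact: Cinf_lincomb.
move=> v vT; apply: (same_differential_sub _ _ _ vT); try exact: Cinf_comp.
by move=> w wT; rewrite (F1f w wT) (F2f w wT).
Qed.

Lemma pi_well_defined a F1 F2 F1' F2' f f' :
  Cinf F1 -> Cinf F2 -> Cinf F1' -> Cinf F2' -> Cinf f -> Cinf f' ->
  same_differential a (F1 \o i) (f \o p) -> same_differential a (F2 \o i) (f \o p) ->
  same_differential a (F1' \o i) (f' \o p) -> same_differential a (F2' \o i) (f' \o p) ->
  pi (i a) F1 F1' = pi (i a) F2 F2'.
Proof.
move=> S1 S2 S1' S2' fS fS' e1 e2 e1' e2'.
rewrite (pi_well_defined_r S1 S1' S2' fS fS' e1 e1' e2').
rewrite (bivector_skew pib) [RHS](bivector_skew pib); congr (- _).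
exact: (pi_well_defined_r S2' S1 S2 fS' fS e2' e1 e2).
Qed.

Let ext a f := if pselect (Cinf f) is left fS then projT1 (cid (extension_exists a fS)) else fun _ => 0.

Let extP a f : Cinf f -> extends a (ext a f) f.
Proof. by move=> fS; rewrite /ext; case: pselect => // fS'; case: cid. Qed.

(** The value 0 at functions that are not smooth is the convention that [tangent] imposes on
    functionals. *)
Definition reduced_bivector (z : P) (f g : P -> R) : R :=
  if `[< Cinf f /\ Cinf g >] then pi (i (pre z)) (ext (pre z) f) (ext (pre z) g) else 0.

(** The representative b of p a used in the definition lies on the C-orbit of a. Invariance of pi
    carries the extensions from b to a, where [pi_well_defined] compares them with F and F'. *)
Lemma reduced_induced : induced_bivector pi i p reduced_bivector.
Proof.
move=> a F F' f f' FS FS' fS fS' Ff Ff'; rewrite /reduced_bivector asboolT//.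
set b := pre (p a); have /pE[c e] : p a = p b by rewrite preK.
have [S1 E1] := extP b fS; have [S1' E1'] := extP b fS'.
have [_ _ inv _] := hM.
have aS := smooth_act actL (iC c, 1%g).
rewrite e inv//.
have tr f0 F0 : Cinf f0 -> extends b F0 f0 -> same_differential a ((F0 \o act (iC c, 1%g)) \o i) (f0 \o p).
  move=> f0S F0E; have sd := extends_same f0S F0E.
  have bE : b = actC c a by apply: iI; rewrite actCE.
  move=> v vT; have vT' := tangent_pushforward (actCSr c) vT.
  rewrite bE in sd; have := sd _ vT'; rewrite !pushforwardE; [|exact: Cinf_comp|by apply: Cinf_comp => //; case: F0E].
  have -> : (F0 \o i) \o actC c = (F0 \o act (iC c, 1%g)) \o i by apply/funext => y /=; rewrite actCE.
  by have -> : (f0 \o p) \o actC c = f0 \o p by apply/funext => y /=; rewrite pC.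
apply: (pi_well_defined (f := f) (f' := f')) => //; try exact: Cinf_comp.
  by apply: tr => //; exact: extP.
by apply: tr => //; exact: extP.
Qed.

Lemma reduced_bivectorE a F F' f f' : Cinf f -> Cinf f' -> extends a F f -> extends a F' f' ->
  reduced_bivector (p a) f f' = pi (i a) F F'.
Proof.
move=> fS fS' FE FE'; apply: reduced_induced => //; [by case: FE|by case: FE'| |]; exact: extends_same.
Qed.

Lemma extends_lincomb a k F G0 f g : extends a F f -> extends a G0 g ->
  extends a (fun y => k * F y + G0 y) (fun y => k * f y + g y).
Proof.
move=> [FS FE] [GS GE]; split; first exact: Cinf_lincomb.
by apply: filterS2 FE GE => b -> ->.
Qed.

Lemma extendsM a F G0 f g : extends a F f -> extends a G0 g ->
  extends a (fun y => F y * G0 y) (fun y => f y * g y).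
Proof.
move=> [FS FE] [GS GE]; split; first exact: CinfM.
by apply: filterS2 FE GE => b -> ->.
Qed.

Lemma reduced_bivector0 z f g : ~ (Cinf f /\ Cinf g) -> reduced_bivector z f g = 0.
Proof. by move=> n; rewrite /reduced_bivector asboolF. Qed.

Lemma reduced_near a f f' F F' : Cinf f -> Cinf f' -> extends a F f -> extends a F' f' ->
  \forall b \near a, reduced_bivector (p b) f f' = pi (i b) F F'.
Proof.
move=> fS fS' /extends_near h /extends_near h'.
by apply: filterS2 h h' => b Fb Fb'; exact: reduced_bivectorE.
Qed.

Lemma reduced_Cinf f g : Cinf f -> Cinf g -> Cinf (fun z => reduced_bivector z f g).
Proof.
move=> fS gS; apply/CinfP => z; rewrite -(preK z); set a := pre z.
apply: (submersion_descend_smat pS pQ).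
have h := reduced_near fS gS (extP a fS) (extP a gS).
have FS : Cinf (fun x => pi x (ext a f) (ext a g)).
  by apply: (bivector_Cinf pib); [case: (extP a fS)|case: (extP a gS)].
apply: (@smooth_at_ext _ _ _ ((fun x => pi x (ext a f) (ext a g)) \o i)).
  by apply: filterS h => b /= ->.
exact: ((CinfP _).1 (Cinf_comp iS FS)).
Qed.

Lemma reduced_bivector_field : bivector_field reduced_bivector.
Proof.
split; last exact: reduced_Cinf.
move=> z; rewrite -(preK z); set a := pre z; split=> [f|f g].
  case: (pselect (Cinf f)) => fS; last first.
    rewrite (_ : reduced_bivector _ f = fun _ => 0); first exact: tangent0.
    by apply/funext => g; rewrite reduced_bivector0// => -[].
  have eF := extP a fS.
  have [_ pl pm] := bivector_tangent pib (i a) (ext a f).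
  split=> [g ng|k g h gS hS|g h gS hS].
  - by rewrite reduced_bivector0// => -[].
  - have eg := extP a gS; have eh := extP a hS.
    rewrite (reduced_bivectorE fS (Cinf_lincomb k gS hS) eF (extends_lincomb k eg eh)).
    by rewrite (reduced_bivectorE fS gS eF eg) (reduced_bivectorE fS hS eF eh) pl//; [case: eg|case: eh].
  - have eg := extP a gS; have eh := extP a hS.
    rewrite (reduced_bivectorE fS (CinfM gS hS) eF (extendsM eg eh)).
    rewrite (reduced_bivectorE fS gS eF eg) (reduced_bivectorE fS hS eF eh) pm//; [|by case: eg|by case: eh].
    by rewrite (extends_at eg) (extends_at eh).
case: (pselect (Cinf f /\ Cinf g)) => [[fS gS]|n]; last first.
  by rewrite !reduced_bivector0 ?oppr0// => -[? ?]; apply: n.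
have ef := extP a fS; have eg := extP a gS.
by rewrite (reduced_bivectorE fS gS ef eg) (reduced_bivectorE gS fS eg ef) (bivector_skew pib).
Qed.

Lemma reduced_invariant k z f g : Cinf f -> Cinf g ->
  reduced_bivector (reduced_action k z) f g =
  reduced_bivector z (f \o reduced_action k) (g \o reduced_action k).
Proof.
move=> fS gS; rewrite -(preK z); set a := pre z; rewrite reduced_actionE.
set b := actN k a; have ef := extP b fS; have eg := extP b gS.
have [_ _ inv _] := hM; have aS := smooth_act actL (1%g, k).
have kS := smooth_act reduced_lie_action k.
have tr f0 F0 : extends b F0 f0 -> extends a (F0 \o act (1%g, k)) (f0 \o reduced_action k).
  move=> [F0S F0E]; split; first exact: Cinf_comp.
  have [c _] := actNSr k; have h : \forall a' \near a, F0 (i (actN k a')) = f0 (p (actN k a')) by exact: (c a _ F0E).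
  by apply: filterS h => a' /=; rewrite reduced_actionE -actNE.
rewrite (reduced_bivectorE fS gS ef eg).
rewrite (reduced_bivectorE (Cinf_comp kS fS) (Cinf_comp kS gS) (tr _ _ ef) (tr _ _ eg)).
by rewrite {1}/b actNE inv//; [case: ef|case: eg].
Qed.

(** The inner function pi(G0, H0) is again an extension near a of the reduced bracket, so the
    comparison of brackets can be iterated. *)
Lemma reduced_schouten a f g h F F' F'' : Cinf f -> Cinf g -> Cinf h ->
  extends a F f -> extends a F' g -> extends a F'' h ->
  schouten reduced_bivector reduced_bivector (p a) f g h = schouten pi pi (i a) F F' F''.
Proof.
move=> fS gS hS eF eG eH.
have nest f0 g0 h0 F0 G0 H0 : Cinf f0 -> Cinf g0 -> Cinf h0 ->
    extends a F0 f0 -> extends a G0 g0 -> extends a H0 h0 ->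
    reduced_bivector (p a) f0 (fun y => reduced_bivector y g0 h0) = pi (i a) F0 (fun y => pi y G0 H0).
  move=> f0S g0S h0S e1 e2 e3; apply: (reduced_bivectorE f0S (reduced_Cinf g0S h0S) e1).
  split; first by apply: (bivector_Cinf pib); [case: e2|case: e3].
  have := reduced_near g0S h0S e2 e3.
  by apply: filterS => b ->.
rewrite /schouten.
by rewrite (nest f g h F F' F'')// (nest g h f F' F'' F)// (nest h f g F'' F F').
Qed.

(** The C-orbit of i a lies in i(N), where F agrees to first order with a function pulled back from
    P, and such a function is constant on the orbit. *)
Lemma rho_ann a F f : Cinf F -> Cinf f -> same_differential a (F \o i) (f \o p) ->
  ann (lie_subalgebra iC) (fun xi => rho act (pushforward (@inl_mor R G H) xi) (i a) F).
Proof.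
move=> FS fS Ff.
have E xi : rho act (pushforward (@inl_mor R G H) xi) (i a) F = - xi (fun g => F (act (g, 1%g) (i a))).
  by rewrite rhoE// pushforwardE//; exact: (Cinf_comp (smooth_orbit actL (i a))).
split=> [k xi eta _ _|_ [zeta zT <-]]; first by rewrite !E; ring.
have oS : smooth_map (fun c : C => actC c a) by exact: (smooth_comp (smooth_slicel C a) actCS).
rewrite E pushforwardE; last first.
  exact: (Cinf_comp (smooth_comp (smooth_slicel G (1%g : H)) (smooth_orbit actL (i a))) FS).
have -> : (fun g => F (act (g, 1%g) (i a))) \o iC = (F \o i) \o (fun c => actC c a).
  by apply/funext => c /=; rewrite actCE.
rewrite -pushforwardE; last exact: Cinf_comp.
have zT' : tangent a (pushforward (fun c : C => actC c a) zeta).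
  by have := tangent_pushforward oS zT; rewrite actC1.
rewrite (Ff _ zT') pushforwardE; last exact: Cinf_comp.
have -> : (f \o p) \o (fun c => actC c a) = (fun _ => f (p a)) by apply/funext => c /=; rewrite pC.
by rewrite (tangent_of_cst zT) oppr0.
Qed.

(** The H-orbit map of i a factors through N, so only the restriction of F to N enters, and it
    agrees with f o p to first order at a. *)
Lemma rho_reduced a F f eta : Cinf F -> Cinf f -> same_differential a (F \o i) (f \o p) ->
  lie_algebra eta ->
  rho act (pushforward (@inr_mor R G H) eta) (i a) F = rho reduced_action eta (p a) f.
Proof.
move=> FS fS Ff eT.
have oS : smooth_map (fun h : H => actN h a) by exact: (smooth_comp (smooth_slicel H a) actNS).
rewrite !rhoE// pushforwardE; last exact: (Cinf_comp (smooth_orbit actL (i a))).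
congr (- _).
have -> : (fun k => F (act k (i a))) \o @inr_mor R G H = (F \o i) \o (fun h => actN h a).
  by apply/funext => h /=; rewrite actNE.
rewrite -pushforwardE; last exact: Cinf_comp.
have eT' : tangent a (pushforward (fun h : H => actN h a) eta).
  by have := tangent_pushforward oS eT; rewrite actN1.
rewrite (Ff _ eT') pushforwardE; last exact: Cinf_comp.
by congr eta; apply/funext => h /=; rewrite reduced_actionE.
Qed.

Lemma reduced_rho_phi a f g h F F' F'' : Cinf f -> Cinf g -> Cinf h ->
  extends a F f -> extends a F' g -> extends a F'' h ->
  rho_phi (tensor_add sG sH) act (i a) F F' F'' = rho_phi sH reduced_action (p a) f g h.
Proof.
move=> fS gS hS eF eG eH; rewrite /rho_phi /phi; congr (_ * _).
have [FS _] := eF; have [GS _] := eG; have [HS _] := eH.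
have sF := extends_same fS eF; have sg := extends_same gS eG; have sh := extends_same hS eH.
have aF := rho_ann FS fS sF; have aG := rho_ann GS gS sg; have aH := rho_ann HS hS sh.
rewrite !sharp_add bracket_pair; try exact: sharp_lie.
have -> v w : rho act (pair_vec v w) (i a) F = rho act (pushforward (@inl_mor R G H) v) (i a) F + rho act (pushforward (@inr_mor R G H) w) (i a) F.
  rewrite !rhoE// {1}/pair_vec; ring.
have shE b F0 f0 : Cinf F0 -> Cinf f0 -> same_differential b (F0 \o i) (f0 \o p) ->
    sharp sH ((fun xi => rho act xi (i b) F0) \o pushforward (@inr_mor R G H)) =
    sharp sH (fun xi => rho reduced_action xi (p b) f0).
  move=> F0S f0S s0; apply/funext => u; apply: eq_bigr => j _; apply: eq_bigr => k _.
  by rewrite /= (rho_reduced F0S f0S s0)//; case: hsH.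
rewrite (shE _ _ _ GS gS sg) (shE _ _ _ HS hS sh).
have := hred aG aH => /(aF.2) ->; rewrite add0r.
by apply: (rho_reduced FS fS sF); apply: bracket_lie; exact: sharp_lie.
Qed.

Lemma reduced_quasi_poisson : quasi_poisson sH reduced_action reduced_bivector.
Proof.
split; [exact: reduced_lie_action|exact: reduced_bivector_field|by move=> k z f g; exact: reduced_invariant|].
move=> z f g h fS gS hS; rewrite -(preK z); set a := pre z.
have eF := extP a fS; have eG := extP a gS; have eH := extP a hS.
rewrite (reduced_schouten fS gS hS eF eG eH) -(reduced_rho_phi fS gS hS eF eG eH).
by have [_ _ _ q] := hM; apply: q; [case: eF|case: eG|case: eH].
Qed.

End Reduction.

(** * Clean position *)

(** The system A psi = phi, B psi = 0 is solvable if every left kernel vector (w, - t) of the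
    stacked matrix annihilates the stacked right-hand side, which is what the hypothesis says. *)
Lemma covector_factor (F : fieldType) m l g (A : 'M[F]_(m, g)) (B : 'M[F]_(l, g)) (phi : 'cV[F]_m) :
  (forall (w : 'rV_m) (t : 'rV_l), w *m A = t *m B -> w *m phi = 0) ->
  exists psi : 'cV[F]_g, A *m psi = phi /\ B *m psi = 0.
Proof.
move=> h; pose X := col_mx A B; pose Y := col_mx phi (0 : 'cV[F]_l).
have XY (z : 'rV_(m + l)) : z *m X = 0 -> z *m Y = 0.
  rewrite -(hsubmxK z) !mul_row_col mulmx0 addr0 => e.
  by apply: (h _ (- rsubmx z)); rewrite mulNmx; apply/eqP; rewrite -addr_eq0 e.
(* The rows of 1 - X X^+ lie in the left kernel of X, hence annihilate Y, and X^+ Y is then a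
   solution. *)
have E : (1%:M - X *m pinvmx X) *m Y = 0.
  apply/row_matrixP => k; rewrite row_mul row0; apply: XY.
  by rewrite -row_mul mulmxBl mul1mx mulmxKpV// subrr row0.
have XE : X *m (pinvmx X *m Y) = Y.
  by apply/esym/eqP; rewrite -subr_eq0 mulmxA -{1}(mul1mx Y) -mulmxBl E.
exists (pinvmx X *m Y); move: XE; rewrite mul_col_mx /Y => /eq_col_mx[].
by rewrite -/Y.
Qed.

Section CleanPosition.
Context {R : realType}.

Lemma dvec_jacobian (M N : manifoldType R) (F : M -> N) (x : M) (c : chart R M) (d : chart R N) :
  atlas M c -> cdom c x -> atlas N d -> cdom d (F x) -> smooth_map F ->
  exists A : 'M_(cdim c, cdim d), forall w, pushforward F (dvec c x w) = dvec d (F x) (w *m A).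
Proof.
move=> ac cx ad dF FS.
have [U [oU Ux UI Ud US]] := smooth_map_at_chart_rep ac cx ad dF ((smooth_mapP F).1 FS x).
set T := cmap d \o F \o cinv c in US; set a0 := cmap c x in Ux.
have Td : differentiable T a0 by case: (US 1%N) => h _; exact: h.
exists (lin1_mx ('d T a0)) => w.
by rewrite (pushforward_dvec _ ac cx ad dF FS) (derive_jacobian Td).
Qed.

Lemma dvec_gradient (M : manifoldType R) (x : M) (c : chart R M) f : atlas M c -> cdom c x -> Cinf f ->
  exists phi : 'cV[R]_(cdim c), forall w, dvec c x w f = (w *m phi) 0 0.
Proof.
move=> ac cx fS; have fd := smooth_at_differentiable ac cx ((CinfP f).1 fS x).
exists (\col_k 'D_(delta_mx 0 k) (f \o cinv c) (cmap c x)) => w.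
rewrite /dvec on_CinfE// (derive_sum_coord _ fd) mxE.
by apply: eq_bigr => k _; rewrite mxE.
Qed.

Lemma function_with_gradient (M : manifoldType R) (x : M) (c : chart R M) (psi : 'cV[R]_(cdim c)) :
  atlas M c -> cdom c x -> exists2 u, Cinf u & forall w, dvec c x w u = (w *m psi) 0 0.
Proof.
move=> ac cx; have [X [XS XE _]] := chart_factor ac cx.
have S k : Cinf (fun y => psi k 0 * X k y) by apply: CinfM => //; exact: Cinf_cst.
exists (fun y => \sum_k psi k 0 * X k y).
  by apply/CinfP => y; apply: smooth_at_sum => k; exact: ((CinfP _).1 (S k)).
move=> w; have wT := tangent_dvec w ac cx.
rewrite (tangent_sum wT)// mxE; apply: eq_bigr => k _.
by rewrite (tangentZ wT)// (dvec_coord _ ac cx (XS k) (XE k)) mulrC.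
Qed.

(** The hypothesis says that dF annihilates the fibre product of T_x M and T_s S over the tangent
    space of L. By linear algebra dF is then pulled back from a covector on L that vanishes on T S,
    and u is a function with this differential. *)
Lemma conormal_factor (M L S : manifoldType R) (mu : M -> L) (k : S -> L) (x : M) (s : S) F :
  smooth_map mu -> smooth_map k -> k s = mu x -> Cinf F ->
  (forall w t, tangent x w -> tangent s t -> pushforward mu w = pushforward k t -> w F = 0) ->
  exists u, [/\ Cinf u, forall w, tangent x w -> w F = w (u \o mu) &
    forall t, tangent s t -> t (u \o k) = 0].
Proof.
move=> muS kS ks FS h.
have [c ac cx] := atlas_cover x; have [d ad dx] := atlas_cover (mu x); have [e ae es] := atlas_cover s.
have dk : cdom d (k s) by rewrite ks.
have [A AE] := dvec_jacobian ac cx ad dx muS; have [B BE] := dvec_jacobian ae es ad dk kS.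
have [phi phiE] := dvec_gradient ac cx FS.
have [|psi [Apsi Bpsi]] := @covector_factor R _ _ _ A B phi.
  move=> w t wt; apply/matrixP => i j; rewrite !ord1 -phiE mxE.
  apply: (h _ (dvec e s t)); [exact: tangent_dvec|exact: tangent_dvec|].
  by rewrite AE BE wt ks.
have [u uS uE] := function_with_gradient psi ad dx.
exists u; split=> // v vT.
  have [w ->] := tangent_dvecP ac cx vT.
  by rewrite -(pushforwardE mu (dvec c x w) uS) AE uE phiE -mulmxA Apsi.
have [w ->] := tangent_dvecP ae es vT.
by rewrite -(pushforwardE k (dvec e s w) uS) BE ks uE -mulmxA Bpsi mulmx0 mxE.
Qed.

Lemma embedding_graph (G : lieGroupType R) (M : manifoldType R) (mu : M -> G) : smooth_map mu ->
  embedding (fun x => (mu x, x)) /\ range (fun x => (mu x, x)) = graph_of mu.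
Proof.
move=> muS; have gS : smooth_map (fun x => (mu x, x)) by apply: smooth_pair; [|exact: smooth_id].
split; last first.
  apply/seteqP; split=> [_ [x _ <-]//|[g x]]; rewrite /graph_of /= => ->.
  by exists x.
split=> [//|x y [_ //]|x v w vT wT vw|U oU].
  apply: (tangent_eq vT wT) => f fS.
  have := congr1 (fun t : functional (G * M)%type => t (f \o snd)) vw.
  by rewrite !pushforwardE//; exact: (Cinf_comp (smooth_snd G M)).
exists (snd @^-1` U); last by [].
by apply: open_comp => // p _; exact: (smooth_map_at_snd p).1.
Qed.

Section Position.
Variables (G : lieGroupType R) (M : manifoldType R) (mu : M -> G) (S : set G).
Hypotheses (muS : smooth_map mu) (clean : clean_position mu S).

Let gS := (embedding_graph muS).1.

(** A map into the graph is recovered from its M-component; this turns the intersection in G * M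
    into a statement about the preimage of S in M. *)
Lemma range_clean (N2 : manifoldType R) (i2 : N2 -> G * M) :
  range i2 = graph_of mu `&` (S `*` setT) ->
  i2 = (fun x => (mu x, x)) \o (snd \o i2) /\ range (snd \o i2) = mu @^-1` S.
Proof.
move=> rE; have E b : i2 b = (mu (i2 b).2, (i2 b).2) /\ S (mu (i2 b).2).
  have [] : (graph_of mu `&` (S `*` setT)) (i2 b) by rewrite -rE; exists b.
  rewrite /graph_of /=; case: (i2 b) => g x /= -> [/=]; by split.
split; first by apply/funext => b; exact: (E b).1.
apply/seteqP; split=> [_ [b _ <-]|x Sx]; first exact: (E b).2.
have [b _ bx] : range i2 (mu x, x) by rewrite rE.
by exists b => //=; rewrite bx.
Qed.

(** The M-component of a parametrization of the clean intersection is an embedding, because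
    composing it with the graph map gives the parametrization back. *)
Lemma clean_preimage_submanifold : submanifold (mu @^-1` S).
Proof.
have [[N2 [i2 [i2e rE]]] _] := clean; have [e r] := range_clean rE.
exists N2, (snd \o i2); split=> //.
have [i2S i2I i2imm i2top] := i2e.
have jS : smooth_map (snd \o i2) by exact: (smooth_comp i2S (smooth_snd G M)).
split=> //.
- by move=> a b ab; apply: i2I; rewrite e /= -/((snd \o i2) a) ab.
- move=> a v w vT wT vw; apply: (i2imm a) => //.
  have pf z : tangent a z -> pushforward i2 z = pushforward (fun x => (mu x, x)) (pushforward (snd \o i2) z).
    move=> zT; have [gSS _ _ _] := gS.
    apply: functional_eq => [f nf|f nf|f fS]; [exact: on_Cinf0|exact: on_Cinf0|].
    rewrite !pushforwardE//; last exact: Cinf_comp.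
    by rewrite {1}e.
  by rewrite !pf// vw.
- move=> U oU; have [V oV ->] := i2top U oU.
  have [[gSS _] _ _ _] := gS.
  exists ((fun x => (mu x, x)) @^-1` V); first by apply: open_comp.
  by rewrite {1}e.
Qed.

Variables (N : manifoldType R) (i : N -> M).
Hypotheses (ie : embedding i) (ri : range i = mu @^-1` S).

(** If mu_* w is tangent to S, cleanness makes the lift of w to the graph tangent to the
    intersection, and therefore w tangent to N, so that w F = 0. [conormal_factor] dualizes this. *)
Lemma clean_conormal (S' : manifoldType R) (k : S' -> G) a s F :
  embedding k -> range k = S -> k s = mu (i a) -> Cinf F ->
  (forall v, tangent a v -> v (F \o i) = 0) ->
  exists u, [/\ Cinf u, forall w, tangent (i a) w -> w F = w (u \o mu) &
    forall t, tangent s t -> t (u \o k) = 0].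
Proof.
move=> ke rk ks FS F0; have [kS _ _ _] := ke.
apply: (conormal_factor muS kS ks FS) => w t wT tT wt.
have pS : (graph_of mu `&` (S `*` setT)) (mu (i a), i a).
  by split=> //; split=> //; rewrite /= -ks -rk; exists s.
have [gSS _ _ _] := gS; have rg := (embedding_graph muS).2.
have fstE : pushforward fst (pushforward (fun x => (mu x, x)) w) = pushforward mu w.
  apply: functional_eq => [f nf|f nf|f fS]; [exact: on_Cinf0|exact: on_Cinf0|].
  by rewrite !pushforwardE//; exact: (Cinf_comp (smooth_fst G M)).
have sndE : pushforward snd (pushforward (fun x => (mu x, x)) w) = w.
  apply: functional_eq => [f nf|f nf|f fS]; [exact: on_Cinf0|by case: wT => h _ _; exact: h|].
  by rewrite !pushforwardE//; exact: (Cinf_comp (smooth_snd G M)).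
have /(clean.2 _ pS)[N2 [i2 [b [w2 [i2e rE ib w2T vE]]]]] :
  [/\ tangent_sub (graph_of mu) (mu (i a), i a) (pushforward (fun x => (mu x, x)) w),
      tangent_sub S (mu (i a), i a).1 (pushforward fst (pushforward (fun x => (mu x, x)) w)) &
      tangent (mu (i a), i a).2 (pushforward snd (pushforward (fun x => (mu x, x)) w))].
  split; [|by rewrite fstE; exists S', k, s, t|by rewrite sndE].
  by exists M, (fun x => (mu x, x)), (i a), w.
(* Cleanness supplies its own parametrization N2 of the intersection; it is compared with N through
   the lift [lam] of snd o i2 along i. *)
have [e r] := range_clean rE; have [i2S _ _ _] := i2e.
have jS : smooth_map (snd \o i2) by exact: (smooth_comp i2S (smooth_snd G M)).
have lift y : exists z, i z = (snd \o i2) y.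
  have [z _ zE] : range i ((snd \o i2) y) by rewrite ri -r; exists y.
  by exists z.
pose lam y := projT1 (cid (lift y)).
have lamE : i \o lam = snd \o i2 by apply/funext => y; rewrite /lam /=; case: cid.
have lamS : smooth_map lam by apply: (embedding_lift_smooth ie); rewrite lamE.
have lamb : lam b = a.
  by have [_ iI _ _] := ie; apply: iI; have := congr1 (fun f => f b) lamE; rewrite /= ib.
have -> : w F = w2 ((F \o i) \o lam).
  have FS2 : Cinf (F \o (snd : G * M -> M)) by exact: (Cinf_comp (smooth_snd G M) FS).
  have := congr1 (fun t : functional (G * M)%type => t (F \o snd)) vE.
  rewrite !pushforwardE// => E.
  have -> : (F \o i) \o lam = (F \o snd) \o i2.
    by apply/funext => y /=; have := congr1 (fun f => f y) lamE => /= ->.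
  by rewrite -E.
have [iS _ _ _] := ie.
rewrite -pushforwardE; last exact: Cinf_comp.
by apply: F0; have := tangent_pushforward lamS w2T; rewrite lamb.
Qed.

End Position.

(** The constant function u(g (h h^-1)) is differentiated in its two occurrences of h separately by
    [tangent_diag]. *)
Lemma tangent_inv (G : lieGroupType R) (v : functional G) (g : G) u : lie_algebra v -> Cinf u ->
  v (fun h => u (g * h^-1)%g) = - v (fun h => u (g * h)%g).
Proof.
move=> vT uS; have iS := @invg_smooth R G; have mS := @mulg_smooth R G.
pose K (p : G * G) := u (g * (p.1 * p.2^-1))%g.
have KS : Cinf K.
  apply: (@Cinf_comp _ _ _ (fun p : G * G => (g * (p.1 * p.2^-1))%g) u) => //.
  have h1 := smooth_pair (smooth_fst G G) (smooth_comp (smooth_snd G G) iS).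
  exact: (smooth_comp (smooth_comp h1 mS) (smooth_mulgl g)).
have := tangent_diag KS vT; rewrite /K.
rewrite (_ : (fun y => _) = fun _ => u g); last by apply/funext => y /=; rewrite mulgV mulg1.
rewrite (tangent_of_cst vT).
rewrite (_ : (fun y => _) = fun h => u (g * h)%g); last by apply/funext => y /=; rewrite invg1 mulg1.
rewrite (_ : (fun y => u (g * ((1%g, y).1 * (1%g, y).2^-1))%g) = fun h => u (g * h^-1)%g); last first.
  by apply/funext => y /=; rewrite mul1g.
by move=> h; apply/eqP; rewrite -addr_eq0 addrC -h.
Qed.

End CleanPosition.

(** * Twisted moment maps *)

Section MomentMaps.
Context {R : realType}.
Variables (G H : lieGroupType R) (sG : tensor2 G) (sH : tensor2 H).
Hypotheses (hsG : in_S2 sG) (hsH : in_S2 sH).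

Variables (M : manifoldType R) (act : G * H -> M -> M) (pi : M -> (M -> R) -> (M -> R) -> R).
Variables (tauG : G -> G) (tauH : H -> H).
Hypotheses (tauGA : lie_automorphism tauG) (tauHA : lie_automorphism tauH).
Variables (muG : M -> G) (muH : M -> H).
Hypothesis hmu : moment_map (tensor_add sG sH) (fun k => (tauG k.1, tauH k.2)) act pi
      (fun x => (muG x, muH x)).

Let tauGS : smooth_map tauG. Proof. by case: tauGA. Qed.
Let tauHS : smooth_map tauH. Proof. by case: tauHA. Qed.
Let tauS : smooth_map (fun k : G * H => (tauG k.1, tauH k.2)).
Proof.
by apply: smooth_pair; [exact: (smooth_comp (smooth_fst G H) tauGS)|exact: (smooth_comp (smooth_snd G H) tauHS)].
Qed.

Lemma automorphism_one (K : lieGroupType R) (tau : K -> K) : lie_automorphism tau -> tau 1%g = 1%g.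
Proof. by case=> tM _ _; apply: (mulgI (tau 1%g)); rewrite -tM !mulg1. Qed.

Lemma smooth_muG : smooth_map muG.
Proof. by case: hmu => mS _ _; exact: (smooth_comp mS (smooth_fst G H)). Qed.

Lemma smooth_muH : smooth_map muH.
Proof. by case: hmu => mS _ _; exact: (smooth_comp mS (smooth_snd G H)). Qed.

Lemma muG_act g h x : muG (act (g, h) x) = (tauG g * muG x * g^-1)%g.
Proof. by case: hmu => _ e _; have := congr1 fst (e (g, h) x). Qed.

Lemma muH_act g h x : muH (act (g, h) x) = (tauH h * muH x * h^-1)%g.
Proof. by case: hmu => _ e _; have := congr1 snd (e (g, h) x). Qed.

(** Testing the moment map condition with u o fst isolates G: this function is constant along the
    H-directions, so the h-part of the tensor drops out. *)
Lemma moment_left x u f : Cinf u -> Cinf f ->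
  pi x (u \o muG) f =
   - 2^-1 * \sum_i \sum_j tcoef sG i j *
     (linv (tvec sG i) (muG x) u + rinv (pushforward tauG (tvec sG i)) (muG x) u) *
     rho act (pushforward (@inl_mor R G H) (tvec sG j)) x f.
Proof.
move=> uS fS; case: hmu => _ _ h; pose U : G * H -> R := u \o fst.
have US : Cinf U by exact: (Cinf_comp (smooth_fst G H)).
rewrite (h x U f US fS); congr (_ * _).
pose a xi := linv xi (muG x, muH x) U + rinv (pushforward (fun k : G * H => (tauG k.1, tauH k.2)) xi) (muG x, muH x) U.
have /= -> := tensor_add_sum sG sH a (fun xi => rho act xi x f).
have lS := Cinf_comp (smooth_mulgl ((muG x, muH x) : G * H)) US.
have rS := Cinf_comp (smooth_mulgr ((muG x, muH x) : G * H)) US.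
rewrite [X in _ + X]big1 ?addr0.
  apply: eq_bigr => i _; apply: eq_bigr => j _; congr (_ * _ * _); rewrite /a; congr (_ + _).
    by rewrite !linvE// pushforwardE.
  rewrite !rinvE// !pushforwardE//; last 2 first.
  - exact: (Cinf_comp (smooth_mulgr (muG x))).
  - exact: (Cinf_comp tauS).
have [eT _] := hsH; move=> i _; rewrite big1// => j _.
rewrite /a linvE// rinvE// !pushforwardE//; last exact: (Cinf_comp tauS).
rewrite (_ : _ \o _ = fun _ => u (muG x)); last by apply/funext => k /=; rewrite /U /= mulg1.
rewrite (_ : _ \o _ = fun _ => u (muG x)); last first.
  by apply/funext => k /=; rewrite /U /= (automorphism_one tauGA) mul1g.
by rewrite !(tangent_of_cst (eT i)) addr0 mulr0 mul0r.
Qed.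

Lemma moment_right x u f : Cinf u -> Cinf f ->
  pi x (u \o muH) f =
   - 2^-1 * \sum_i \sum_j tcoef sH i j *
     (linv (tvec sH i) (muH x) u + rinv (pushforward tauH (tvec sH i)) (muH x) u) *
     rho act (pushforward (@inr_mor R G H) (tvec sH j)) x f.
Proof.
move=> uS fS; case: hmu => _ _ h; pose U : G * H -> R := u \o snd.
have US : Cinf U by exact: (Cinf_comp (smooth_snd G H)).
rewrite (h x U f US fS); congr (_ * _).
pose a xi := linv xi (muG x, muH x) U + rinv (pushforward (fun k : G * H => (tauG k.1, tauH k.2)) xi) (muG x, muH x) U.
have /= -> := tensor_add_sum sG sH a (fun xi => rho act xi x f).
have lS := Cinf_comp (smooth_mulgl ((muG x, muH x) : G * H)) US.
have rS := Cinf_comp (smooth_mulgr ((muG x, muH x) : G * H)) US.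
rewrite [X in X + _]big1 ?add0r.
  apply: eq_bigr => i _; apply: eq_bigr => j _; congr (_ * _ * _); rewrite /a; congr (_ + _).
    by rewrite !linvE// pushforwardE.
  rewrite !rinvE// !pushforwardE//; last 2 first.
  - exact: (Cinf_comp (smooth_mulgr (muH x))).
  - exact: (Cinf_comp tauS).
have [eT _] := hsG; move=> i _; rewrite big1// => j _.
rewrite /a linvE// rinvE// !pushforwardE//; last exact: (Cinf_comp tauS).
rewrite (_ : _ \o _ = fun _ => u (muH x)); last by apply/funext => k /=; rewrite /U /= mulg1.
rewrite (_ : _ \o _ = fun _ => u (muH x)); last first.
  by apply/funext => k /=; rewrite /U /= (automorphism_one tauHA) mul1g.
by rewrite !(tangent_of_cst (eT i)) addr0 mulr0 mul0r.
Qed.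

(* The sum is al (sharp sG be) with al(xi) = (xi^L + tau(xi)^R) u, and the element
   (sharp sG be, - sharp sG be) of c_hat acts on G by a vector tangent to S,
   whose derivative of u is al (sharp sG be). *)
Lemma twisted_pairing_zero (C C' : lieGroupType R) (iC : C -> G) (iC' : C' -> G * G) (S : set G)
    (S' : manifoldType R) (k : S' -> G) (s : S') (be : functional G -> R) u :
  integrates_c_hat sG iC iC' ->
  (forall (c : C') (g : G), S g -> S (tauG (iC' c).1 * g * ((iC' c).2)^-1)%g) ->
  embedding k -> range k = S -> Cinf u -> (forall t, tangent s t -> t (u \o k) = 0) ->
  ann (lie_subalgebra iC) be ->
  \sum_i \sum_j tcoef sG i j *
     (linv (tvec sG i) (k s) u + rinv (pushforward tauG (tvec sG i)) (k s) u) * be (tvec sG j) = 0.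
Proof.
move=> [[iM iS iI imm] intC _] stab ke rk uS u0 bA; set g := k s.
have tau1 := automorphism_one tauGA.
have [eT sym] := hsG.
pose v := sharp sG be; have vT : lie_algebra v by exact: sharp_lie.
pose al (xi : functional G) := xi (fun h => u (g * h)%g) + xi (fun h => u (tauG h * g)%g).
have S1 : Cinf (fun h => u (h * g)%g) by exact: (Cinf_comp (smooth_mulgr g)).
have E xi : linv xi g u + rinv (pushforward tauG xi) g u = al xi.
  by rewrite linvE// rinvE// pushforwardE.
have -> : \sum_i \sum_j tcoef sG i j * (linv (tvec sG i) g u + rinv (pushforward tauG (tvec sG i)) g u) * be (tvec sG j)
    = al v.
  (* [sharp] contracts be with the first index, the sum with the second; the symmetry of s
     reconciles them. *)
  rewrite /al /v /sharp -big_split exchange_big; apply: eq_bigr => i _ /=.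
  rewrite -big_split; apply: eq_bigr => j _ /=.
  rewrite E /al (_ : tcoef sG j i = tcoef sG i j); last by rewrite -[in LHS]sym mxE.
  ring.
pose O (c : C') := (tauG (iC' c).1 * g * ((iC' c).2)^-1)%g.
have OS c : exists s', k s' = O c.
  have [s' _ e] : range k (O c) by rewrite rk; apply: stab; rewrite -rk; exists s.
  by exists s'.
(* The orbit map of hat C through k s, regarded as a map to S': it is smooth because its composite
   with the embedding k is. *)
pose o c := projT1 (cid (OS c)); have oE : k \o o = O by apply/funext => c; rewrite /o /=; case: cid.
pose act2 (q : G * G) := (tauG q.1 * g * (q.2)^-1)%g.
have act2S : smooth_map act2.
  have h1 := smooth_comp (smooth_comp (smooth_fst G G) tauGS) (smooth_mulgr g).
  have h2 := smooth_comp (smooth_snd G G) (@invg_smooth R G).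
  exact: (smooth_comp (smooth_pair h1 h2) (@mulg_smooth R G)).
have oSm : smooth_map o by apply: (embedding_lift_smooth ke); rewrite oE; exact: (smooth_comp iS act2S).
have i1 : iC' 1%g = 1%g by apply: (mulgI (iC' 1%g)); rewrite -iM !mulg1.
have o1 : o 1%g = s.
  have [_ kI _ _] := ke; apply: kI; have := congr1 (fun f => f 1%g) oE => /= ->.
  by rewrite /O i1 /= tau1 mul1g invg1 mulg1.
(* The c-component is taken to be 0; the summands 0 + v f and 0 - v f reproduce the literal shape of
   [c_hat]. *)
have [zeta zT zE] : lie_subalgebra iC' (pair_vec (fun f => 0 + v f) (fun f => 0 - v f)).
  rewrite intC; exists (fun _ => 0), be; split=> //.
  exists (fun _ => 0); first exact: tangent0.
  by apply: functional_eq => [f nf|//|f fS]; [exact: on_Cinf0|rewrite pushforwardE].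
have z0 : zeta (u \o O) = 0.
  rewrite -oE -[u \o (k \o o)]/((u \o k) \o o) -pushforwardE; last first.
    by apply: Cinf_comp => //; case: ke.
  by apply: u0; have := tangent_pushforward oSm zT; rewrite o1.
have US : Cinf (u \o act2) by exact: Cinf_comp.
have := congr1 (fun t : functional (G * G)%type => t (u \o act2)) zE.
rewrite /= pushforwardE// [in LHS]/act2 -[LHS]/(zeta (u \o O)) z0 pair_vecE// /act2 /=.
rewrite (_ : (fun h : G => _) = fun h => u (tauG h * g)%g); last first.
  by apply/funext => h /=; rewrite invg1 mulg1.
rewrite (_ : (fun h : G => u (tauG 1%g * g * h^-1)%g) = fun h => u (g * h^-1)%g); last first.
  by apply/funext => h /=; rewrite tau1 mul1g.
(* The inverse in the second factor of the action turns - v into + v, so the two contributions add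
   up to al v. *)
by rewrite (tangent_inv g vT uS) add0r sub0r opprK /al addrC => <-.
Qed.

End MomentMaps.

(** * The reduction theorem *)

Section Descent.
Context {R : realType}.

Lemma quotient_surj (N Q : manifoldType R) (E : N -> N -> Prop) (q : N -> Q) z :
  quotient_by E q -> exists a, q a = z.
Proof. by case=> _ qr _ _; have [a _ <-] : range q z by [rewrite qr]; exists a. Qed.

Lemma quotient_descend (N Q L : manifoldType R) (E : N -> N -> Prop) (q : N -> Q) (F : N -> L) :
  quotient_by E q -> smooth_map F -> (forall a b, E a b -> F a = F b) ->
  exists2 f : Q -> L, smooth_map f & forall a, f (q a) = F a.
Proof.
move=> hq FS FE; have [qS _ sub qE] := hq.
pose f z := F (projT1 (cid (quotient_surj z hq))).
have fE a : f (q a) = F a by rewrite /f; case: cid => b /= /qE/FE.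
exists f => //; apply/smooth_mapP => z; have [a <-] := quotient_surj z hq.
apply: submersion_descend => //.
have -> : f \o q = F by apply/funext => b; exact: fE.
exact: ((smooth_mapP F).1 FS a).
Qed.

(** All clauses use that the C-orbit in M of a point of N stays in N. The immersion clause rests on
    the kernel half of [submersion_local]. For the topological clause q is open: if W cuts out
    p^-1(U) in N, then q(W) cuts out U in P. *)
Lemma induced_embedding (G H C : lieGroupType R) (M N P Q : manifoldType R) (act : G * H -> M -> M)
    (iC : C -> G) (i : N -> M) (p : N -> P) (q : M -> Q) (j : P -> Q) :
  embedding i ->
  (forall c a, exists b, i b = act (iC c, 1%g) (i a)) ->
  quotient_by (fun a b => exists c : C, i b = act (iC c, 1%g) (i a)) p ->
  quotient_by (fun x y => exists c : C, y = act (iC c, 1%g) x) q ->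
  (forall a, j (p a) = q (i a)) -> smooth_map j -> embedding j.
Proof.
move=> ie stab hp hq jE jS; have [iS iI iimm itop] := ie.
have [pS _ psub pE] := hp; have [qS _ qsub qE] := hq.
have jI : injective j.
  move=> z w; have [a <-] := quotient_surj z hp; have [b <-] := quotient_surj w hp.
  by rewrite !jE => /qE ab; apply/pE.
split=> //.
- move=> z v w; have [a <-] := quotient_surj z hp => vT wT vw.
  have [v' vT' vE] := psub a v vT; have [w' wT' wE] := psub a w wT.
  apply: (tangent_eq vT wT) => f fS.
  have [|F FS FE] := @embedding_extension _ _ _ i a (f \o p) ie.
    exact: ((CinfP _).1 (Cinf_comp pS fS)).
  (* The lifts v' and w' may differ by a vertical vector; only the effect of their difference on
     functions pulled back from P matters, and it is computed after pushing forward to M, with F as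
     test function. *)
  pose d (u : N -> R) := (-1) * w' u + v' u.
  have dT : tangent a d by exact: tangent_lincomb.
  have FiS := Cinf_comp iS FS.
  have dF : pushforward i d F = 0.
    have [_ ker] := submersion_local (i a) qS qsub.
    apply: (ker _ _ (tangent_pushforward iS dT)) => //.
      move=> u uS; rewrite pushforwardE; last exact: Cinf_comp.
      have e : (u \o q) \o i = (u \o j) \o p by apply/funext => b /=; rewrite jE.
      have ujS := Cinf_comp jS uS.
      have vu : v (u \o j) = w (u \o j).
        by rewrite -(pushforwardE j v uS) vw pushforwardE.
      rewrite e /d -(pushforwardE p v' ujS) vE -(pushforwardE p w' ujS) wE vu.
      by rewrite mulN1r addNr.
    have h := near_embedding ie FE.
    apply: filterS h => y hy /esym/qE[c yE].
    (* A point of the q-fibre of i a is a C-translate of i a, so it lies in i(N), where F near i a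
       is f o p. *)
    have [b bE] := stab c a; rewrite yE -bE hy ?yE// (nbhs_singleton FE) /=.
    by congr f; apply/esym/pE; exists c.
  have : v' (f \o p) = w' (f \o p).
    have fpS := Cinf_comp pS fS.
    rewrite -(tangent_near vT' FiS fpS FE) -(tangent_near wT' FiS fpS FE).
    move: dF; rewrite pushforwardE// /d mulN1r addrC => /eqP; rewrite subr_eq0 => /eqP; exact.
  by rewrite -(pushforwardE p v' fS) vE -(pushforwardE p w' fS) wE.
move=> U oU; have oPU : open (p @^-1` U).
  by apply: open_comp => // a _; case: pS => c _; exact: c.
have [W oW WE] := itop _ oPU.
exists (q @` W); first exact: submersion_open.
apply/seteqP; split=> z; have [a <-] := quotient_surj z hp.
  move=> Ua; rewrite /preimage /= jE; exists (i a) => //.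
  by have : (i @^-1` W) a by rewrite -WE.
rewrite /preimage /= jE => -[w Ww /esym/qE[c wE]].
have [b bE] := stab c a; have : (p @^-1` U) b by rewrite WE /preimage /= bE -wE.
by rewrite /preimage /=; congr U; apply/esym/pE; exists c.
Qed.

End Descent.

Theorem theorem1 (R : realType) (G H : lieGroupType R)
    (sG : tensor2 G) (sH : tensor2 H)
    (hsG : in_S2 sG) (hsH : in_S2 sH)
    (hAdG : Ad_invariant sG) (hAdH : Ad_invariant sH)
    (M : manifoldType R) (act : G * H -> M -> M)
    (pi : M -> (M -> R) -> (M -> R) -> R)
    (hM : quasi_poisson (tensor_add sG sH) act pi)
    (C : lieGroupType R) (iC : C -> G)
    (hC : lie_subgroup iC) (hred : reducing sG iC) :
  (* 1 *)
  (forall (Q : manifoldType R) (q : M -> Q),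
    quotient_by (fun x y => exists c : C, y = act (iC c, 1%g) x) q ->
    exists (actQ : H -> Q -> Q) (piQ : Q -> (Q -> R) -> (Q -> R) -> R),
      [/\ residual_action act id q actQ,
          descends pi q piQ &
          quasi_poisson sH actQ piQ]) /\
  (* 2 *)
  (forall (tauG : G -> G) (tauH : H -> H),
    lie_automorphism tauG -> preserves sG (pushforward tauG) ->
    lie_automorphism tauH -> preserves sH (pushforward tauH) ->
    forall (muG : M -> G) (muH : M -> H),
    moment_map (tensor_add sG sH) (fun k => (tauG k.1, tauH k.2)) act pi
      (fun x => (muG x, muH x)) ->
    forall (C' : lieGroupType R) (iC' : C' -> G * G),
    integrates_c_hat sG iC iC' ->
    forall S : set G,
    submanifold S ->
    (forall (c : C') (g : G), S g -> S (tauG (iC' c).1 * g * ((iC' c).2)^-1)%g) ->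
    clean_position muG S ->
    submanifold (muG @^-1` S) /\
    forall (N : manifoldType R) (i : N -> M),
    embedding i -> range i = muG @^-1` S ->
    forall (P : manifoldType R) (p : N -> P),
    quotient_by (fun a b => exists c : C, i b = act (iC c, 1%g) (i a)) p ->
    exists (actP : H -> P -> P) (piP : P -> (P -> R) -> (P -> R) -> R)
        (muP : P -> H),
      [/\ residual_action act i p actP,
          induced_bivector pi i p piP,
          quasi_poisson sH actP piP,
          (forall a, muP (p a) = muH (i a)) /\ moment_map sH tauH actP piP muP &
          (* moreover *)
          forall (Q : manifoldType R) (q : M -> Q),
          quotient_by (fun x y => exists c : C, y = act (iC c, 1%g) x) q ->
          forall (actQ : H -> Q -> Q) (piQ : Q -> (Q -> R) -> (Q -> R) -> R),
          residual_action act id q actQ ->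
          descends pi q piQ ->
          quasi_poisson sH actQ piQ ->
          exists2 j : P -> Q, (forall a, j (p a) = q (i a)) &
            quasi_poisson_submanifold sH actQ piQ actP piP j]).
Proof.
have pib : bivector_field pi by case: hM.
split=> [Q q hq|].
  have stC c (x : M) : exists b, id b = act (iC c, 1%g) (id x) by exists (act (iC c, 1%g) x).
  have stH h (x : M) : exists b, id b = act (1%g, h) (id x) by exists (act (1%g, h) x).
  have ie := embedding_id M.
  have con (a : M) (F F' : M -> R) (f' : Q -> R) : Cinf F -> Cinf F' -> Cinf f' ->
      (forall v, tangent a v -> v (F \o id) = 0) ->
      same_differential a (F' \o id) (f' \o q) -> pi (id a) F F' = 0.
    (* With N = M the functional pi(F', .) is itself one of the tangent vectors that annihilate
       F. *)
    move=> FS FS' _ F0 _; rewrite (bivector_skew pib) (F0 (pi a F')) ?oppr0//.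
    exact: bivector_tangent.
  exists (reduced_action stH hq), (reduced_bivector pi ie hq); split.
  - exact: (reduced_residual hM ie stH hq).
  - move=> x f g fS gS; have [qS _ _ _] := hq.
    by apply: (reduced_induced hM hC ie stC hq con) => //; exact: Cinf_comp.
  - exact: (reduced_quasi_poisson hsG hsH hM hC hred ie stC stH hq con).
move=> tauG tauH tauGA _ tauHA _ muG muH hmu C' iC' intC S [S' [k [ke rk]]] stab clean.
have muGS := smooth_muG hmu; have muHS := smooth_muH hmu.
split; first exact: (clean_preimage_submanifold muGS clean).
move=> N i ie ri P p hp.
have [iS iI _ _] := ie; have [pS _ _ pE] := hp.
have lift x : S (muG x) -> exists b, i b = x.
  by move=> Sx; have [b _ bx] : range i x by [rewrite ri]; exists b.
have Si a : S (muG (i a)) by have : (muG @^-1` S) (i a) by [rewrite -ri; exists a].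
have stC c a : exists b, i b = act (iC c, 1%g) (i a).
  apply: lift; rewrite (muG_act hmu).
  (* C preserves S through its diagonal lift to C': the pair (c, c) acts on G by tau(c) g c^-1, the
     twisted action for which muG is equivariant. *)
  have [_ _ [jC [_ _ jE]]] := intC.
  by have := stab (jC c) _ (Si a); rewrite jE.
have stH h a : exists b, i b = act (1%g, h) (i a).
  by apply: lift; rewrite (muG_act hmu) (automorphism_one tauGA) mul1g invg1 mulg1.
have con (a : N) (F F' : M -> R) (f' : P -> R) : Cinf F -> Cinf F' -> Cinf f' ->
    (forall v, tangent a v -> v (F \o i) = 0) ->
    same_differential a (F' \o i) (f' \o p) -> pi (i a) F F' = 0.
  move=> FS FS' fS' F0 Ff'.
  have [s _ ks] : range k (muG (i a)) by rewrite rk.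
  have [u [uS uF u0]] := clean_conormal muGS clean ie ri ke rk ks FS F0.
  (* pi(F', .) is a tangent vector at i a, and tangent vectors there do not distinguish F from u o
     muG. *)
  have -> : pi (i a) F F' = pi (i a) (u \o muG) F'.
    rewrite (bivector_skew pib) [RHS](bivector_skew pib); congr (- _).
    by apply: uF; exact: bivector_tangent.
  rewrite (moment_left hsH tauGA tauHA hmu (i a) uS FS') -ks.
  have bA := rho_ann hM hC ie stC hp FS' fS' Ff'.
  by rewrite (twisted_pairing_zero hsG tauGA intC stab ke rk uS u0 bA) mulr0.
set actP := reduced_action stH hp; set piP := reduced_bivector pi ie hp.
have res : residual_action act i p actP := reduced_residual hM ie stH hp.
have ind : induced_bivector pi i p piP := reduced_induced hM hC ie stC hp con.
have qp : quasi_poisson sH actP piP := reduced_quasi_poisson hsG hsH hM hC hred ie stC stH hp con.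
have [||muP muPS muPE] := @quotient_descend R N P H _ p (muH \o i) hp.
- exact: (smooth_comp iS muHS).
- move=> a b [c e] /=; rewrite e (muH_act hmu).
  by rewrite (automorphism_one tauHA) mul1g invg1 mulg1.
have redE := reduced_bivectorE hM hC ie stC hp con.
exists actP, piP, muP; split=> //.
- split=> //; split=> // [h z|z u f uS fS]; have [a <-] := quotient_surj z hp.
    have [b bE] := stH h a; rewrite (res h a b bE) !muPE /= bE (muH_act hmu) //.
  have [F eF] := extension_exists ie hp a fS; have [FS _] := eF.
  (* u o muH lives on all of M and restricts on N to the pullback of u o muP, so it is itself an
     extension, to which the moment map condition on M applies. *)
  have eu : extends i p a (u \o muH) (u \o muP).
    by split; [exact: Cinf_comp|apply: nearW => b /=; rewrite muPE].
  rewrite /piP (redE a _ _ _ _ (Cinf_comp muPS uS) fS eu eF) (moment_right hsG tauGA tauHA hmu (i a) uS FS).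
  rewrite muPE; congr (_ * _); apply: eq_bigr => x _; apply: eq_bigr => y _; congr (_ * _).
  have sd := extends_same ie hp fS eF.
  exact: (rho_reduced hM ie stH hp FS fS sd (hsH.1 y)).
move=> Q q hq actQ piQ resQ desQ qpQ; have [qS _ _ qE] := hq.
have [||j jS jE] := @quotient_descend R N P Q _ p (q \o i) hp.
- exact: (smooth_comp iS qS).
- by move=> a b [c e] /=; apply/qE; exists c.
exists j => //; split=> //.
- exact: (induced_embedding ie stC hp hq jE jS).
- move=> h z; have [a <-] := quotient_surj z hp; have [b bE] := stH h a.
  by rewrite (res h a b bE) !jE /=; apply/esym/resQ.
move=> z f g fS gS; have [a <-] := quotient_surj z hp; rewrite jE /= desQ//.
(* Since q o i = j o p, the function f o q on M is an extension of f o j, and piP can be evaluated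
   with it. *)
apply/esym/redE; [exact: Cinf_comp|exact: Cinf_comp| |];
  by split; [exact: Cinf_comp|apply: nearW => b /=; rewrite jE].
Qed.
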